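(* Let $(\tau_1,\tau_2)$ be $\operatorname{CDPH}(\bm{\alpha},\bm{P},\bm{U},\bm{Q}_1,\bm{Q}_2)$ distributed. Let $\{(X_{1,\ell},X_{2,\ell})\}_{\ell\ge1}$ be an i.i.d. sequence of bivariate random vectors with positive components, independent of $(\tau_1,\tau_2)$, each following an $\operatorname{MPH}^*(\bm{\pi},\bm{S},\bm{R})$ distribution with state space $\mathcal{C}$, and let $$Y_1:=\sum_{\ell=1}^{\tau_1}X_{1,\ell},\qquad Y_2:=\sum_{\ell=1}^{\tau_2}X_{2,\ell}.$$ Then $(Y_1,Y_2)$ follows an $\operatorname{MPH}^*$ distribution with underlying continuous-time Markov jump process on the state space $\big(\mathcal{E}\cup(\mathcal{S}\times\mathcal{S})\cup(\{\partial_1\}\times\mathcal{S})\cup(\mathcal{S}\times\{\partial_2\})\big)\times\mathcal{C}$, initial probability vector $(\bm{\alpha},\bm{0},\bm{0},\bm{0})\otimes\bm{\pi}$, subintensity matrix $$\begin{pmatrix}\bm{I}&\bm{0}&\bm{0}&\bm{0}\\ \bm{0}&\bm{I}&\bm{0}&\bm{0}\\ \bm{0}&\bm{0}&\bm{I}&\bm{0}\\ \bm{0}&\bm{0}&\bm{0}&\bm{I}\end{pmatrix}\otimes\bm{S}+\begin{pmatrix}\bm{P}&\bm{U}^*&\bm{0}&\bm{0}\\ \bm{0}&\bm{Q}_1\otimes\bm{Q}_2&\bm{q}_1\otimes\bm{Q}_2&\bm{Q}_1\otimes\bm{q}_2\\ \bm{0}&\bm{0}&\bm{Q}_2&\bm{0}\\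 \bm{0}&\bm{0}&\bm{0}&\bm{Q}_1\end{pmatrix}\otimes(-\bm{S}\bm{1}\bm{\pi}),$$ and reward matrix $$\begin{pmatrix}\bm{1}^\intercal\otimes\bm{r}_1&\bm{1}^\intercal\otimes\bm{r}_1&\bm{0}&\bm{1}^\intercal\otimes\bm{r}_1\\ \bm{1}^\intercal\otimes\bm{r}_2&\bm{1}^\intercal\otimes\bm{r}_2&\bm{1}^\intercal\otimes\bm{r}_2&\bm{0}\end{pmatrix},$$ where $\bm{r}_k=(r_{k1},r_{k2},\dots,r_{k|\mathcal{C}|})$ for $k\in\{1,2\}$, so that $\bm{R}=\begin{pmatrix}\bm{r}_1\\ \bm{r}_2\end{pmatrix}$.
   Context: CDPH. $\mathcal{E}$ and $\mathcal{S}$ are disjoint nonempty finite sets. $\bm{\alpha}$ is a probability row vector indexed by $\mathcal{E}$; $\bm{P}$ is a subprobability matrix (nonnegative entries, row sums at most $1$) on $\mathcal{E}$; $\bm{U}=\{u_{ij}\}$ is a nonnegative $\mathcal{E}\times\mathcal{S}$ matrix such that each row of $(\bm{P}\ \bm{U})$ sums to one; $\bm{Q}_1,\bm{Q}_2$ are subprobability matrices on $\mathcal{S}$; $\bm{q}_k=\bm{1}-\bm{Q}_k\bm{1}$ for $k\in\{1,2\}$, where $\bm{1}$ is a column vector of ones of appropriate dimension. All chains terminate almost surely (from every state), i.e. all eigenvalues of $\bm{P},\bm{Q}_1,\bm{Q}_2$ have modulus strictly less than $1$. $M_1$ is a terminating Markov chain (time $n=0,1,2,\dots$) on $\mathcal{E}\cup\mathcal{S}$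 with initial vector $(\bm{\alpha},\bm{0})$ and subprobability transition matrix $\begin{pmatrix}\bm{P}&\bm{U}\\ \bm{0}&\bm{Q}_1\end{pmatrix}$ (the missing mass in a row is the probability of terminating at the next step). Let $\tau_{1,2}:=\inf\{n\ge 1: M_1(n)\notin\mathcal{E}\}$. Set $M_2(n)=M_1(n)$ for $n\le\tau_{1,2}$; after time $\tau_{1,2}$, given the past up to $\tau_{1,2}$, $M_2$ evolves independently of $M_1$ as a terminating Markov chain in $\mathcal{S}$ with subprobability matrix $\bm{Q}_2$. For $k\in\{1,2\}$, $\tau_k:=\inf\{n\ge 1: M_k(n)\notin\mathcal{E}\cup\mathcal{S}\}$. The law of $(\tau_1,\tau_2)$ is called $\operatorname{CDPH}(\bm{\alpha},\bm{P},\bm{U},\bm{Q}_1,\bm{Q}_2)$. $\otimes$ is the Kronecker product; product sets are ordered lexicographically; $\partial_1,\partial_2$ are extra symbols; $\bm{U}^*=\{u^*_{i,(j_1,j_2)}\}_{i\in\mathcal{E},(j_1,j_2)\in\mathcal{S}\times\mathcal{S}}$ with $u^*_{i,(j_1,j_2)}:=u_{ij_1}\delta_{j_1,j_2}$ ($\delta$ the Kronecker delta). $\operatorname{MPH}^*(\bm{\pi},\bm{S},\bm{R})$ (bivariate): let $J=\{J(t)\}_{t\ge0}$ be an almost surely terminating continuous-time Markov jump process on a finite state space $\mathcal{C}$ with initial probability row vector $\bm{\pi}$ and subintensity matrix $\bm{S}$, so that $-\bm{S}\bm{1}$ is the column vector of termination rates; let $\bm{R}=\{r_{kj}\}_{k\in\{1,2\},j\in\mathcal{C}}$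 be a matrix of nonnegative reward rates and $\delta:=\inf\{t\ge0:J(t)\notin\mathcal{C}\}$ the termination time. Then $\operatorname{MPH}^*(\bm{\pi},\bm{S},\bm{R})$ is the law of $(X_1,X_2)$ with $X_k:=\int_0^{\delta}r_{k,J(s)}\,ds$, $k\in\{1,2\}$. *)

(* Defs.v *)
From HB Require Import structures.
From mathcomp Require Export all_boot all_order all_algebra.
From mathcomp Require Export all_classical all_reals all_analysis.
From mathcomp Require Export measurable_realfun complex mxtens.

Set Implicit Arguments.
Unset Strict Implicit.
Unset Printing Implicit Defensive.

Import Order.TTheory GRing.Theory Num.Theory.
Import numFieldNormedType.Exports.

Local Open Scope classical_set_scope.
Local Open Scope ring_scope.

(* Finite state spaces are ordinals 'I_k; disjoint unions and products of state
   spaces are 'I_(k + l) (lshift, rshift) and 'I_(k * l) (mxtens_index, which is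
   the lexicographic order), matching block_mx and the Kronecker product [*t].
   The cemetery state of a terminating process on 'I_k is [None : option 'I_k]. *)

Definition probability_vector (R : realType) (k : nat) (v : 'rV[R]_k) : Prop :=
  (forall i, 0 <= v 0 i) /\ \sum_i v 0 i = 1.

Definition subprobability (R : realType) (k : nat) (A : 'M[R]_k) : Prop :=
  (forall i j, 0 <= A i j) /\ (forall i, \sum_j A i j <= 1).

Definition subintensity (R : realType) (k : nat) (A : 'M[R]_k) : Prop :=
  (forall i j, i != j -> 0 <= A i j) /\ (forall i, \sum_j A i j <= 0).

Definition spectrum_in_unit_disk (R : realType) (k : nat) (A : 'M[R]_k) : Prop :=
  forall z : complex R, eigenvalue (map_mx (real_complex R) A) z -> `|z| < 1.

Definition ones (R : realType) (k : nat) : 'cV[R]_k := const_mx 1.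
Arguments ones {R} k.

Definition exit_vec (R : realType) (k : nat) (A : 'M[R]_k) : 'cV[R]_k :=
  ones k - A *m ones k.

Definition same_law (R : realType) (d d' du : measure_display)
    (T : measurableType d) (T' : measurableType d') (U : measurableType du)
    (P : probability T R) (P' : probability T' R) (X : T -> U) (X' : T' -> U) :
    Prop :=
  forall A : set U, measurable A -> P (X @^-1` A) = P' (X' @^-1` A).

Definition mutually_independent (R : realType) (d du : measure_display)
    (T : measurableType d) (U : measurableType du) (P : probability T R)
    (X : nat -> T -> U) : Prop :=
  forall (L : seq nat) (A : nat -> set U), uniq L ->
    (forall l, measurable (A l)) ->
    P (\big[setI/setT]_(l <- L) (X l @^-1` A l)) =
    (\prod_(l <- L) P (X l @^-1` A l))%E.

(* [Y] is independent of the whole sequence [X]: the finite-dimensional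
   cylinders form a pi-system generating the sigma-algebra of [X]. *)
Definition independent_of (R : realType) (d du dv : measure_display)
    (T : measurableType d) (U : measurableType du) (V : measurableType dv)
    (P : probability T R) (X : nat -> T -> U) (Y : T -> V) : Prop :=
  forall (L : seq nat) (A : nat -> set U) (B : set V),
    (forall l, measurable (A l)) -> measurable B ->
    P (\big[setI/setT]_(l <- L) (X l @^-1` A l) `&` Y @^-1` B) =
    (P (\big[setI/setT]_(l <- L) (X l @^-1` A l)) * P (Y @^-1` B))%E.

Definition init_prob (R : realType) (k : nat) (v : 'rV[R]_k)
    (x : option 'I_k) : R :=
  if x is Some i then v 0 i else 0.

Definition trans_prob (R : realType) (k : nat) (A : 'M[R]_k)
    (x y : option 'I_k) : R :=
  match x, y with
  | Some i, Some j => A i j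
  | Some i, None => 1 - \sum_j A i j
  | None, Some _ => 0
  | None, None => 1
  end.

Definition path_event (T U : Type) (M : nat -> T -> U) (n : nat)
    (s : nat -> U) : set T :=
  [set w | forall i, (i <= n)%N -> M i w = s i].

Definition measurable_states (d : measure_display) (T : measurableType d)
    (U : Type) (M : nat -> T -> U) : Prop :=
  forall n s, measurable [set w | M n w = s].

(* The Markov property P(M_(n+1) = y | M_0, ..., M_n) = trans_prob A (M_n) y,
   multiplied out by the probability of the past. *)
Definition terminating_chain (R : realType) (d : measure_display)
    (T : measurableType d) (P : probability T R) (k : nat)
    (v : 'rV[R]_k) (A : 'M[R]_k) (M : nat -> T -> option 'I_k) : Prop :=
  [/\ measurable_states M,
      forall x, P [set w | M 0%N w = x] = (init_prob v x)%:E &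
      forall (n : nat) (s : nat -> option 'I_k),
        P (path_event M n.+1 s) =
        (P (path_event M n s) * (trans_prob A (s n) (s n.+1))%:E)%E].

Definition exit_time (R : realType) (U : Type) (A : set U) (x : nat -> U) :
    \bar R :=
  ereal_inf [set (n%:R : R)%:E | n in [set n | (0 < n)%N /\ ~ A (x n)]].

Definition CDPH_parameters (R : realType) (m n : nat) (alpha : 'rV[R]_m)
    (Pm : 'M[R]_m) (U : 'M[R]_(m, n)) (Q1 Q2 : 'M[R]_n) : Prop :=
  [/\ probability_vector alpha,
      [/\ subprobability Pm, subprobability Q1 & subprobability Q2],
      forall i j, 0 <= U i j,
      row_mx Pm U *m ones (m + n) = ones m &
      [/\ spectrum_in_unit_disk Pm, spectrum_in_unit_disk Q1 &
          spectrum_in_unit_disk Q2]].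

Definition E_states (m n : nat) : set (option 'I_(m + n)) :=
  range (fun i : 'I_m => Some (lshift n i)).
Arguments E_states : clear implicits.

Definition S_path (m n : nat) (b : nat -> option 'I_n) :
    nat -> option 'I_(m + n) :=
  fun i => omap (@rshift m n) (b i).
Arguments S_path m {n} b.

(* The pair (M_1, M_2). In the last clause, [past] is the event that M_1 follows
   the path s up to time tau_{1,2} = t; given this event, the continuation of M_2
   is independent of that of M_1 and is a terminating chain in S with matrix Q2
   (both statements multiplied out by the conditioning event). *)
Definition CDPH_chains (R : realType) (d : measure_display)
    (T : measurableType d) (P : probability T R) (m n : nat)
    (alpha : 'rV[R]_m) (Pm : 'M[R]_m) (U : 'M[R]_(m, n)) (Q1 Q2 : 'M[R]_n)
    (M1 M2 : nat -> T -> option 'I_(m + n)) : Prop :=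
  [/\ terminating_chain P (row_mx alpha 0) (block_mx Pm U 0 Q1) M1,
      measurable_states M2,
      forall w (t : nat),
        ((t%:R : R)%:E <= exit_time R (E_states m n) (M1 ^~ w))%E ->
        M2 t w = M1 t w &
      forall (t : nat) (s : nat -> option 'I_(m + n)),
        exit_time R (E_states m n) s = (t%:R : R)%:E ->
        let past := path_event M1 t s in
        let future1 k a := path_event (fun i => M1 (t + i)%N) k a in
        let future2 k b :=
          path_event (fun i => M2 (t + i)%N) k (S_path m b) in
        (forall k a l b,
          (P (past `&` future1 k a `&` future2 l b) * P past =
           P (past `&` future1 k a) * P (past `&` future2 l b))%E) /\
        (forall k b,
          P (past `&` future2 k.+1 b) =
          (P (past `&` future2 k b) * (trans_prob Q2 (b k) (b k.+1))%:E)%E)].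

(* [tau] has the CDPH law, compared in \bar R * \bar R as the first exit times
   may be infinite on a null event. *)
Definition CDPH (R : realType) (m n : nat) (alpha : 'rV[R]_m)
    (Pm : 'M[R]_m) (U : 'M[R]_(m, n)) (Q1 Q2 : 'M[R]_n)
    (d : measure_display) (T : measurableType d) (P : probability T R)
    (tau : T -> nat * nat) : Prop :=
  CDPH_parameters alpha Pm U Q1 Q2 /\
  exists (d' : measure_display) (T' : measurableType d')
      (P' : probability T' R) (M1 M2 : nat -> T' -> option 'I_(m + n)),
    CDPH_chains P' alpha Pm U Q1 Q2 M1 M2 /\
    same_law (U := (\bar R * \bar R)%type) P P'
      (fun w => (((tau w).1%:R : R)%:E, ((tau w).2%:R : R)%:E))
      (fun w => (exit_time R [set~ None] (M1 ^~ w),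
                 exit_time R [set~ None] (M2 ^~ w))).

(* Transition matrix of the embedded jump chain; a state with zero rate is
   absorbing. A missing mass in row i is the probability that the jump out of i
   is a termination, namely (- S 1)_i / (- S_ii). *)
Definition jump_mx (R : realType) (p : nat) (S : 'M[R]_p) : 'M[R]_p :=
  \matrix_(i, j) if S i i == 0 then (i == j)%:R
                 else if i == j then 0 else S i j / - S i i.

Definition rate (R : realType) (p : nat) (S : 'M[R]_p) (x : option 'I_p) : R :=
  if x is Some i then - S i i else 0.

(* Jump chain / holding time definition of the (minimal) Markov jump process:
   the successively visited states form the Markov chain [Z]; given the chain,
   the holding times [W] are independent and W_i is exponential with parameter
   rate S (Z_i) (infinite if the rate is 0); J equals Z_i between the i-th and
   the (i+1)-th jump. The convention that J is sent to the cemetery after an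
   accumulation of jumps concerns a null event only. *)
Definition markov_jump_process (R : realType) (d : measure_display)
    (T : measurableType d) (P : probability T R) (p : nat)
    (v : 'rV[R]_p) (S : 'M[R]_p) (J : R -> T -> option 'I_p) : Prop :=
  exists (Z : nat -> T -> option 'I_p) (W : nat -> T -> \bar R),
    let jump_time i w := (\sum_(0 <= j < i) W j w)%E in
    [/\ terminating_chain P v (jump_mx S) Z,
        (forall i, measurable_fun setT (W i)) /\
          (forall i w, 0 <= W i w)%E,
        forall (n : nat) (s : nat -> option 'I_p) (t : nat -> R),
          (forall i, 0 <= t i) ->
          P (path_event Z n s `&`
             [set w | forall i, (i <= n)%N -> ((t i)%:E < W i w)%E]) =
          (P (path_event Z n s) *
           (\prod_(0 <= i < n.+1) expR (- (rate S (s i) * t i)))%:E)%E,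
        forall w (t : R) (i : nat), 0 <= t ->
          (jump_time i w <= t%:E < jump_time i.+1 w)%E -> J t w = Z i w &
        forall w (t : R), 0 <= t ->
          (forall i, jump_time i w <= t%:E)%E -> J t w = None].

Definition termination_time (R : realType) (U : Type) (J : R -> option U) :
    \bar R :=
  ereal_inf [set t%:E | t in [set t : R | 0 <= t /\ J t = None]].

Definition total_reward (R : realType) (p : nat) (r : 'rV[R]_p)
    (J : R -> option 'I_p) : R :=
  \int[lebesgue_measure]_(s in
      [set s : R | 0 <= s /\ (s%:E < termination_time J)%E])
    (if J s is Some c then r 0 c else 0).

(* [X] has the MPH*(v, S, Rw) law; the k-th reward vector is row k of [Rw]. *)
Definition MPHstar (R : realType) (p : nat) (v : 'rV[R]_p) (S : 'M[R]_p)
    (Rw : 'M[R]_(2, p)) (d : measure_display) (T : measurableType d)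
    (P : probability T R) (X : T -> R * R) : Prop :=
  [/\ probability_vector v, subintensity S, forall k c, 0 <= Rw k c &
  exists (d' : measure_display) (T' : measurableType d')
      (P' : probability T' R) (J : R -> T' -> option 'I_p),
    [/\ markov_jump_process P' v S J,
        {ae P', forall w, (termination_time (J ^~ w) < +oo)%E} &
        same_law (U := (R * R)%type) P P' X
          (fun w => (total_reward (row 0 Rw) (J ^~ w),
                     total_reward (row 1 Rw) (J ^~ w)))]].

Definition Ustar (R : realType) (m n : nat) (U : 'M[R]_(m, n)) :
    'M[R]_(m, n * n) :=
  \matrix_(i, j) (U i (mxtens_unindex j).1 *
                  ((mxtens_unindex j).1 == (mxtens_unindex j).2)%:R).

(* E, S x S, {partial_1} x S, S x {partial_2}, in this order. *)
Definition nblocks (m n : nat) : nat := m + (n * n + (1 * n + n * 1)).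

(* Tensoring with 1%:M : 'M_1 only relabels S as {partial_1} x S, resp.
   S x {partial_2}. *)
Definition pair_mx (R : realType) (m n : nat) (Pm : 'M[R]_m)
    (U : 'M[R]_(m, n)) (Q1 Q2 : 'M[R]_n) : 'M[R]_(nblocks m n) :=
  let q1 := exit_vec Q1 in
  let q2 := exit_vec Q2 in
  block_mx Pm (row_mx (Ustar U) (row_mx 0 0))
           0  (block_mx (Q1 *t Q2) (row_mx (q1 *t Q2) (Q1 *t q2))
                        0          (block_mx ((1%:M : 'M[R]_1) *t Q2) 0
                                             0 (Q1 *t (1%:M : 'M[R]_1)))).

Definition compound_init (R : realType) (m n p : nat) (alpha : 'rV[R]_m)
    (v : 'rV[R]_p) : 'rV[R]_(nblocks m n * p) :=
  row_mx alpha (row_mx 0 (row_mx 0 0)) *t v.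

Definition compound_mx (R : realType) (m n p : nat) (Pm : 'M[R]_m)
    (U : 'M[R]_(m, n)) (Q1 Q2 : 'M[R]_n) (v : 'rV[R]_p) (S : 'M[R]_p) :
    'M[R]_(nblocks m n * p) :=
  (1%:M : 'M[R]_(nblocks m n)) *t S +
  pair_mx Pm U Q1 Q2 *t (- (S *m ones p *m v)).

(* Row k of the reward matrix, factored as (row of 0/1 blocks) (x) r_k. *)
Definition compound_reward (R : realType) (m n p : nat) (Rw : 'M[R]_(2, p)) :
    'M[R]_(2, nblocks m n * p) :=
  let ones_row k : 'rV[R]_k := (ones k)^T in
  col_mx
    (row_mx (ones_row m) (row_mx (ones_row (n * n)%N) (row_mx 0 (ones_row (n * 1)%N))) *t row 0 Rw
      : 'rV[R]_(nblocks m n * p))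
    (row_mx (ones_row m) (row_mx (ones_row (n * n)%N) (row_mx (ones_row (1 * n)%N) 0)) *t row 1 Rw
      : 'rV[R]_(nblocks m n * p)).

(* Main.v *)
(* The law of a nonnegative random vector is determined by the values at integer
   points of its Laplace transform. For the rewards of a Markov jump process started
   at v, the transform at th is v L, where L is the least nonnegative solution of
   diag(th) L = S L - S 1. For the random sum, conditioning on (tau_1, tau_2) turns
   the transform into the generating function of (tau_1, tau_2), in which a step of
   the chain costs phi(th1, th2), phi(th1, 0) or phi(0, th2), phi being the common
   transform of the X_l, according to which of M_1 and M_2 are still alive. This
   generating function is again a least solution of a linear system, governed by the
   block matrix that multiplies - S 1 pi, and comparing the two minimality
   properties shows that it is the transform of the rewards of the compound process.
   At th = 0 both are 1, which says that the compound process terminates almost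
   surely; it is realised on the space of trajectories (state, normalised holding
   time). *)

From HB Require Import structures.
Require Import Defs.
From mathcomp Require Import zify ring lra.

Set Implicit Arguments.
Unset Strict Implicit.
Unset Printing Implicit Defensive.

Import Order.TTheory GRing.Theory Num.Theory.
Import numFieldNormedType.Exports.

Local Open Scope classical_set_scope.
Local Open Scope ring_scope.

(** * Neumann series of nonnegative matrices *)

(** Two difficulties shape the proof. An MPH* law asserts that a process exists, so a space carrying
    the jump chain and the holding times of the compound matrix has to be built. And independence is
    given only through joint events, never as a product of spaces. The first is met without an
    extension theorem: trajectories are sorted by the step at which they die, each class receives a
    finite measure by prepending one state at a time, and the classes are summed. The second is met
    by Tonelli with an auxiliary exponential variable, which reduces the mean of exp (- V) to the
    tails of V. No resolvent is inverted: every transform is a series of nonnegative terms whose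
    [N]-th term collects the trajectories dying at step [N + 1]. So states of zero rate, where [S]
    is singular and the process stays forever, need no exclusion. For (tau_1, tau_2) the series is
    ordered by the value [N + 1] of the maximum, which is the step at which the pair chain dies; the
    two sides are then compared term by term. *)

Definition nneg_mx (R : realType) (p q : nat) (A : 'M[R]_(p, q)) : Prop :=
  forall i j, 0 <= A i j.

Definition le_mx (R : realType) (p q : nat) (A B : 'M[R]_(p, q)) : Prop :=
  forall i j, A i j <= B i j.

Definition neumann_term (R : realType) (p : nat) (A : 'M[R]_p) (b : 'cV[R]_p)
    (N : nat) : 'cV[R]_p :=
  iter N (mulmx A) b.

Definition neumann_sum (R : realType) (p : nat) (A : 'M[R]_p) (b : 'cV[R]_p) :
    'cV[R]_p :=
  \col_i limn (fun n => \sum_(k < n) neumann_term A b k i 0).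

Lemma cvg_finsum (R : realType) (I : Type) (r : seq I) (f : I -> nat -> R)
    (l : I -> R) : (forall i, f i n @[n --> \oo] --> l i) ->
  \sum_(i <- r) f i n @[n --> \oo] --> \sum_(i <- r) l i.
Proof. by move=> fl; apply: cvg_big => //; exact: add_continuous. Qed.

Section neumann.
Context {R : realType} {p : nat}.
Implicit Types (A : 'M[R]_p) (b x y : 'cV[R]_p).

Lemma nneg_mulmx q r s (A : 'M[R]_(q, r)) (B : 'M[R]_(r, s)) :
  nneg_mx A -> nneg_mx B -> nneg_mx (A *m B).
Proof.
by move=> A0 B0 i j; rewrite mxE sumr_ge0// => k _; exact: mulr_ge0.
Qed.

Lemma neumann_termS A b N :
  neumann_term A b N.+1 = A *m neumann_term A b N.
Proof. by []. Qed.

Lemma neumann_term_ge0 A b N :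
  nneg_mx A -> nneg_mx b -> nneg_mx (neumann_term A b N).
Proof. by move=> A0 b0; elim: N => // N IH; exact: nneg_mulmx. Qed.

(** Induction on [n]: the bound for [n] terms, multiplied by [A] and inserted in [A y + c b <= y],
    gives the bound for [n.+1]. The factor [c] is kept because minimality is later applied to exit
    rates rescaled by a constant. *)
Lemma partial_neumann_le A b y c n : nneg_mx A -> nneg_mx b -> 0 <= c ->
  nneg_mx y -> le_mx (A *m y + c *: b) y ->
  forall i, c * \sum_(k < n) neumann_term A b k i 0 <= y i 0.
Proof.
move=> A0 b0 c0 y0 Ay; elim: n => [i|n IH i]; first by rewrite big_ord0 mulr0.
apply: le_trans (Ay i 0); rewrite big_ord_recl mulrDr addrC mxE lerD//; last first.
  by rewrite mxE.
under eq_bigr do rewrite [neumann_term _ _ _](neumann_termS A b _) mxE.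
rewrite exchange_big/= mulr_sumr mxE ler_sum// => j _.
by rewrite -mulr_sumr mulrCA ler_wpM2l.
Qed.

Section convergent.
Variables (A : 'M[R]_p) (b x : 'cV[R]_p).
Hypotheses (A0 : nneg_mx A) (b0 : nneg_mx b) (x0 : nneg_mx x).
Hypothesis Axb : le_mx (A *m x + b) x.

(** The partial sums increase and stay below the supersolution [x], which thus replaces any
    condition on the spectral radius. In the applications [x] is the vector of ones. *)
Lemma cvg_neumann i :
  \sum_(k < n) neumann_term A b k i 0 @[n --> \oo] --> neumann_sum A b i 0.
Proof.
rewrite mxE; apply: nondecreasing_is_cvgn.
  apply/nondecreasing_seqP => n; rewrite big_ord_recr /= lerDl.
  exact: neumann_term_ge0.
exists (x i 0) => _ [n _ <-]; rewrite -[leLHS]mul1r.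
by apply: partial_neumann_le => //; rewrite scale1r.
Qed.

Lemma neumann_sum_min y c : 0 <= c -> nneg_mx y ->
  le_mx (A *m y + c *: b) y -> le_mx (c *: neumann_sum A b) y.
Proof.
move=> c0 y0 Ay i j; rewrite ord1 mxE.
have /cvg_lim <- // : c * \sum_(k < n) neumann_term A b k i 0 @[n --> \oo] -->
    c * neumann_sum A b i 0 by apply: cvgZr; exact: cvg_neumann.
apply: limr_le; first by apply: is_cvgZr; apply: cvgP; exact: cvg_neumann.
by apply: nearW => n; exact: partial_neumann_le.
Qed.

Lemma neumann_sum_le : le_mx (neumann_sum A b) x.
Proof. by rewrite -[X in le_mx X _]scale1r; apply: neumann_sum_min; rewrite ?scale1r. Qed.

Lemma neumann_sum_ge0 : nneg_mx (neumann_sum A b).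
Proof.
move=> i j; rewrite ord1; have /cvg_lim <- // := @cvg_neumann i.
apply: limr_ge; first by apply: cvgP; exact: cvg_neumann.
by apply: nearW => n; apply: sumr_ge0 => k _; exact: neumann_term_ge0.
Qed.

Lemma neumann_sum_fix : neumann_sum A b = A *m neumann_sum A b + b.
Proof.
apply/colP => i; rewrite [RHS]mxE [(A *m _) i 0]mxE.
have h1 : \sum_(k < n.+1) neumann_term A b k i 0 @[n --> \oo] -->
    neumann_sum A b i 0 by have := @cvg_neumann i; rewrite -cvg_shiftS.
have /cvg_lim <- // := h1; apply/cvg_lim => //.
rewrite [X in X @ _ --> _](_ : _ = fun n =>
  (\sum_j A i j * \sum_(k < n) neumann_term A b k j 0) + b i 0); last first.
  apply/funext => n; rewrite big_ord_recl addrC; congr (_ + _).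
  under eq_bigr do rewrite [neumann_term _ _ _](neumann_termS A b _) mxE.
  by rewrite exchange_big/=; apply: eq_bigr => j _; rewrite mulr_sumr.
apply: cvgD; last exact: cvg_cst.
apply: cvg_finsum => j; apply: cvgZr; exact: cvg_neumann.
Qed.

(** In the applications [u] is an initial distribution and the [k]-th term the contribution of the
    trajectories dying at step [k + 1]. *)
Lemma nneseries_neumann (u : 'rV[R]_p) : nneg_mx u ->
  (\sum_(0 <= k <oo) ((u *m neumann_term A b k) 0 0)%:E =
   ((u *m neumann_sum A b) 0 0)%:E)%E.
Proof.
move=> u0; apply/cvg_lim => //.
rewrite [X in X @ _ --> _](_ : _ = fun n => (\sum_j u 0 j *
    (\sum_(k < n) neumann_term A b k j 0))%:E); last first.
  apply/funext => n; rewrite sumEFin big_mkord; congr EFin.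
  under eq_bigr do rewrite mxE.
  by rewrite exchange_big/=; apply: eq_bigr => j _; rewrite mulr_sumr.
apply: cvg_EFin; first exact: nearW.
by rewrite mxE/=; apply: cvg_finsum => j; apply: cvgZr; exact: cvg_neumann.
Qed.

End convergent.
End neumann.

(** * Row scaling and the Laplace vector of a jump process *)

Section scaled.
Context {R : realType} {q : nat}.
Implicit Types (x : 'I_q -> R) (A : 'M[R]_q).

Lemma exit_vecE A i : exit_vec A i 0 = 1 - \sum_j A i j.
Proof. by rewrite !mxE; congr (_ - _); apply: eq_bigr => j _; rewrite mxE mulr1. Qed.

Lemma mulmx_onesE r (B : 'M[R]_(r, q)) i : (B *m ones q) i 0 = \sum_j B i j.
Proof. by rewrite mxE; apply: eq_bigr => j _; rewrite mxE mulr1. Qed.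

Lemma ones_ge0 : nneg_mx (ones q : 'cV[R]_q).
Proof. by move=> i j; rewrite mxE. Qed.

(** Each visit to [i] costs a factor [x i]. The last visit before death is charged too, hence the
    same factor on the exit vector in [scaled_exit]. *)
Definition scaled_mx x A : 'M[R]_q := \matrix_(i, j) (x i * A i j).

Definition scaled_exit x A : 'cV[R]_q := \col_i (x i * exit_vec A i 0).

Variables (x : 'I_q -> R) (A : 'M[R]_q).
Hypothesis x01 : forall i, 0 <= x i <= 1.

Lemma scaled_mx_ge0 : nneg_mx A -> nneg_mx (scaled_mx x A).
Proof. by move=> A0 i j; rewrite mxE mulr_ge0//; case/andP: (x01 i). Qed.

Lemma scaled_exit_ge0 : nneg_mx (exit_vec A) -> nneg_mx (scaled_exit x A).
Proof. by move=> e0 i j; rewrite [scaled_exit _ _ _ _]mxE mulr_ge0//; case/andP: (x01 i). Qed.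

(** A row of [A] and its exit entry sum to one, so after scaling they sum to [x i]. This is the
    supersolution behind all the Neumann series below. *)
Lemma scaled_mx_ones :
  le_mx (scaled_mx x A *m ones q + scaled_exit x A) (ones q).
Proof.
move=> i j; rewrite ord1 mxE mulmx_onesE [ones q i 0]mxE [scaled_exit _ _ _ _]mxE exit_vecE.
under eq_bigr do rewrite mxE.
by rewrite -mulr_sumr -mulrDr addrC subrK mulr1; case/andP: (x01 i).
Qed.

End scaled.

(* Laplace transform [l / (l + t)] of the exponential law of rate [l = - S i i]
   at [t = th 0 i], in a form which is [1] when [l = t = 0]. *)
Definition discount (R : realType) (p : nat) (S : 'M[R]_p) (th : 'rV[R]_p)
    (i : 'I_p) : R :=
  1 - th 0 i / (- S i i + th 0 i).

Definition laplace_mx (R : realType) (p : nat) (S : 'M[R]_p) (th : 'rV[R]_p) :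
    'M[R]_p :=
  scaled_mx (discount S th) (jump_mx S).

Definition laplace_exit (R : realType) (p : nat) (S : 'M[R]_p)
    (th : 'rV[R]_p) : 'cV[R]_p :=
  scaled_exit (discount S th) (jump_mx S).

(* The vector of E_i[exp (- int_0^delta th (J s) ds)], i the initial state. *)
Definition laplace_vec (R : realType) (p : nat) (S : 'M[R]_p)
    (th : 'rV[R]_p) : 'cV[R]_p :=
  neumann_sum (laplace_mx S th) (laplace_exit S th).

Section laplace_vector.
Context {R : realType} {p : nat}.
Variables (S : 'M[R]_p) (th : 'rV[R]_p).
Hypotheses (hS : subintensity S) (th0 : nneg_mx th).

Lemma subintensity_diag i : S i i <= 0.
Proof.
case: hS => S0 Sr; apply: le_trans (Sr i); rewrite (bigD1 i)//= lerDl.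
by apply: sumr_ge0 => j ji; rewrite S0// eq_sym.
Qed.

Lemma subintensity_absorbing i j : S i i = 0 -> S i j = 0.
Proof.
case: hS => S0 Sr Sii; have [<-//|ij] := eqVneq i j.
have := Sr i; rewrite (bigD1 i)//= Sii add0r => sum_le0.
apply/eqP; rewrite eq_le S0// andbT; apply: le_trans sum_le0.
rewrite (bigD1 j) 1?eq_sym//= lerDl; apply: sumr_ge0 => k /andP[ki _].
by rewrite S0// eq_sym.
Qed.

Lemma jump_mx_ge0 : nneg_mx (jump_mx S).
Proof.
move=> i j; rewrite mxE; case: ifPn => _; first by rewrite ler0n.
case: ifPn => // ij; apply: divr_ge0; first by case: hS => S0 _; exact: S0.
by rewrite oppr_ge0 subintensity_diag.
Qed.

(** At a state of nonzero rate the jump chain has no self-loop, so the rate times the jump row is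
    the row of [S] without its diagonal. *)
Lemma sum_jump_mx (y : 'cV[R]_p) i : S i i != 0 ->
  - S i i * \sum_j jump_mx S i j * y j 0 = (S *m y) i 0 - S i i * y i 0.
Proof.
move=> Sii; rewrite mxE (bigD1 i)//= [in RHS](bigD1 i)//=.
rewrite mxE (negbTE Sii) eqxx mul0r add0r addrAC subrr add0r mulr_sumr.
apply: eq_bigr => j ji; rewrite mxE (negbTE Sii) eq_sym (negbTE ji).
by rewrite mulrA; congr (_ * _); rewrite mulrCA divff ?oppr_eq0// mulr1.
Qed.

Lemma jump_mx_row_absorbing i : S i i = 0 -> \sum_j jump_mx S i j = 1.
Proof.
move=> Sii; rewrite (bigD1 i)//= mxE Sii !eqxx big1 ?addr0// => j ji.
by rewrite mxE Sii eqxx eq_sym (negbTE ji).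
Qed.

Lemma rate_exit_jump i :
  - S i i * exit_vec (jump_mx S) i 0 = - \sum_j S i j.
Proof.
rewrite exit_vecE; have [Sii|Sii] := eqVneq (S i i) 0.
  by rewrite Sii oppr0 mul0r big1 ?oppr0// => j _; exact: subintensity_absorbing.
rewrite mulrBr mulr1; have := sum_jump_mx (ones p) Sii.
rewrite mulmx_onesE [ones p i 0]mxE mulr1.
under eq_bigr do rewrite [ones p _ _]mxE mulr1.
by move=> ->; ring.
Qed.

Lemma exit_jump_ge0 : nneg_mx (exit_vec (jump_mx S)).
Proof.
move=> i j; rewrite ord1; have [Sii|Sii] := eqVneq (S i i) 0.
  by rewrite exit_vecE jump_mx_row_absorbing// subrr.
have Sii0 : 0 < - S i i by rewrite oppr_gt0 lt_neqAle Sii subintensity_diag.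
rewrite -(pmulr_rge0 _ Sii0) rate_exit_jump oppr_ge0.
by case: hS.
Qed.

Lemma jump_mx_subprobability : subprobability (jump_mx S).
Proof.
split=> [|i]; first exact: jump_mx_ge0.
by have := exit_jump_ge0 i 0; rewrite exit_vecE subr_ge0.
Qed.

Lemma discount_ge0 i : 0 <= discount S th i.
Proof.
rewrite /discount subr_ge0.
have := subintensity_diag i; rewrite -oppr_ge0 => Sii0; have thi := th0 0 i.
have [->|d0] := eqVneq (- S i i + th 0 i) 0; first by rewrite invr0 mulr0.
have d1 : 0 < - S i i + th 0 i by rewrite lt_neqAle eq_sym d0 addr_ge0.
by rewrite ler_pdivrMr// mul1r lerDr.
Qed.

Lemma discount_le1 i : discount S th i <= 1.
Proof.
rewrite /discount lerBlDr lerDl divr_ge0 ?th0// addr_ge0 ?th0//.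
by rewrite oppr_ge0 subintensity_diag.
Qed.

Lemma discountE i : S i i != 0 ->
  (- S i i + th 0 i) * discount S th i = - S i i.
Proof.
move=> Sii; have d0 : - S i i + th 0 i != 0.
  by rewrite gt_eqF// ltr_wpDr// oppr_gt0 lt_neqAle Sii subintensity_diag.
by rewrite /discount; field.
Qed.

Let discount01 i : 0 <= discount S th i <= 1.
Proof. by rewrite discount_ge0 discount_le1. Qed.

Lemma laplace_mx_ge0 : nneg_mx (laplace_mx S th).
Proof. exact: (scaled_mx_ge0 discount01 jump_mx_ge0). Qed.

Lemma laplace_exit_ge0 : nneg_mx (laplace_exit S th).
Proof. exact: (scaled_exit_ge0 discount01 exit_jump_ge0). Qed.

Lemma laplace_mx_ones :
  le_mx (laplace_mx S th *m ones p + laplace_exit S th) (ones p).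
Proof. exact: scaled_mx_ones. Qed.

Lemma laplace_vec_ge0 : nneg_mx (laplace_vec S th).
Proof.
exact: (neumann_sum_ge0 laplace_mx_ge0 laplace_exit_ge0 (@ones_ge0 R p)
  laplace_mx_ones).
Qed.

Lemma laplace_vec_le1 : le_mx (laplace_vec S th) (ones p).
Proof.
exact: (neumann_sum_le laplace_mx_ge0 laplace_exit_ge0 (@ones_ge0 R p)
  laplace_mx_ones).
Qed.

Lemma nneseries_laplace (u : 'rV[R]_p) : nneg_mx u ->
  (\sum_(0 <= k <oo)
     ((u *m neumann_term (laplace_mx S th) (laplace_exit S th) k) 0 0)%:E =
   ((u *m laplace_vec S th) 0 0)%:E)%E.
Proof.
exact: (nneseries_neumann laplace_mx_ge0 laplace_exit_ge0 (@ones_ge0 R p)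
  laplace_mx_ones).
Qed.

(** Multiplication by [- S i i + th 0 i] clears the denominators of the discount and of the jump
    matrix. It is the bridge between the fixed-point form of the Laplace vector and the linear
    system written with [S]. *)
Lemma laplace_stepE (y : 'cV[R]_p) c i : S i i != 0 ->
  (- S i i + th 0 i) * (laplace_mx S th *m y + c *: laplace_exit S th) i 0 =
  (S *m y) i 0 - S i i * y i 0 - c * \sum_j S i j.
Proof.
move=> Sii; have -> : (laplace_mx S th *m y + c *: laplace_exit S th) i 0 =
    (\sum_j discount S th i * (jump_mx S i j * y j 0)) +
    c * (discount S th i * exit_vec (jump_mx S) i 0).
  rewrite mxE; congr (_ + _); last by rewrite mxE [laplace_exit _ _ _ _]mxE.
  by rewrite mxE; apply: eq_bigr => j _; rewrite mxE mulrA.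
rewrite -mulr_sumr mulrCA -mulrDr mulrA discountE// mulrDr sum_jump_mx//.
by rewrite mulrCA rate_exit_jump; ring.
Qed.

Lemma laplace_vec_resolvent i :
  th 0 i * laplace_vec S th i 0 =
  (S *m laplace_vec S th) i 0 - \sum_j S i j.
Proof.
have fixL := neumann_sum_fix laplace_mx_ge0 laplace_exit_ge0 (@ones_ge0 R p)
  laplace_mx_ones.
have [Sii|Sii] := eqVneq (S i i) 0; last first.
  have := laplace_stepE (laplace_vec S th) 1 Sii.
  by rewrite scale1r -fixL -/(laplace_vec S th) mul1r => h; lra.
rewrite big1 ?subr0 => [|j _]; last exact: subintensity_absorbing.
rewrite [(S *m _) i 0]mxE big1 => [|j _]; last by rewrite subintensity_absorbing// mul0r.
(* At an absorbing state the right-hand side is 0. On the left, either the reward rate is zero, or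
   the discount is zero and the transform with it. *)
have [->|thi] := eqVneq (th 0 i) 0; first by rewrite mul0r.
suff -> : laplace_vec S th i 0 = 0 by rewrite mulr0.
have D0 : discount S th i = 0.
  by rewrite /discount Sii oppr0 add0r divff// subrr.
rewrite /laplace_vec fixL !mxE D0 mul0r addr0 big1// => j _.
by rewrite mxE D0 !mul0r.
Qed.

Lemma laplace_vec_min (y : 'cV[R]_p) c : 0 <= c -> nneg_mx y ->
  (forall i, th 0 i * y i 0 = (S *m y) i 0 - c * \sum_j S i j) ->
  le_mx (c *: laplace_vec S th) y.
Proof.
move=> c0 y0 yE; apply: (neumann_sum_min laplace_mx_ge0 laplace_exit_ge0
  (@ones_ge0 R p) laplace_mx_ones) => // i j; rewrite ord1.
have [Sii|Sii] := eqVneq (S i i) 0; last first.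
  have d0 : 0 < - S i i + th 0 i.
    by rewrite ltr_wpDr ?th0// oppr_gt0 lt_neqAle Sii subintensity_diag.
  rewrite -(ler_pM2l d0) laplace_stepE//; have := yE i; lra.
(* At an absorbing state the jump row is the unit row and the exit entry is 0, so the claim reduces
   to [discount <= 1]. *)
rewrite mxE [(_ *m _) i 0]mxE (bigD1 i)//= big1 ?addr0 => [|k ki]; last first.
  by rewrite !mxE Sii eqxx eq_sym (negbTE ki) mulr0 mul0r.
rewrite !mxE Sii !eqxx mulr1 [X in _ * (_ * X)](_ : _ = 0) ?mulr0 ?addr0.
  by rewrite ler_piMl ?discount_le1.
have := exit_vecE (jump_mx S) i.
by rewrite jump_mx_row_absorbing// subrr !mxE.
Qed.

End laplace_vector.

(** * Laplace transforms of nonnegative random vectors *)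

(** The value 0 at [+oo] is that of an infinite holding time with a positive reward rate. With
    reward rate 0 the product with [+oo] is 0, and the factor becomes 1. *)
Definition expN (R : realType) (x : \bar R) : R :=
  if x is r%:E then expR (- r) else 0.

Section tail_integral.
Context {R : realType}.
Local Notation leb := (@lebesgue_measure R).
Local Notation pdf := (@exponential_pdf R 1).

Lemma expN_ge0 (x : \bar R) : 0 <= expN x.
Proof. by case: x => //= r; exact: expR_ge0. Qed.

Lemma expN_le1 (x : \bar R) : (0 <= x)%E -> expN x <= 1.
Proof. by case: x => //= r; rewrite lee_fin => r0; rewrite expR_le1 oppr_le0. Qed.

Lemma measurable_expN : measurable_fun setT (@expN R).
Proof.
rewrite [X in measurable_fun _ X](_ : _ = fun x =>
    if x \is a fin_num then expR (- fine x) else 0); last first.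
  by apply/funext; case.
apply: measurable_fun_ifT => //.
- apply: (measurable_fun_bool true).
  rewrite [X in measurable X](_ : _ = setT `&` [set x | x \is a fin_num]).
    exact: (emeasurable_fin_num measurableT (@measurable_id _ _ setT)).
  by apply/seteqP; split => x //= [].
- apply: measurableT_comp; first exact: measurable_expR.
  by apply: measurableT_comp => //; exact: fine_measurable.
Qed.

Lemma integral_pdf_expN (V : \bar R) : (0 <= V)%E ->
  (\int[leb]_s (pdf s * (s%:E < V)%E%:R)%:E = (1 - expN V)%:E)%E.
Proof.
case: V => [r r0| _ |//]; last first.
  under eq_integral do rewrite ltry mulr1.
  by rewrite integral_exponential_pdf//= subr0.
transitivity (\int[leb]_(s in `[0%R, r[) (pdf s)%:E)%E.
  rewrite [RHS]integral_mkcond; apply: eq_integral => s _.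
  rewrite patchE mem_setE in_itv/= lte_fin; have [s0|s0] := leP 0 s.
    by case: ltP => _; rewrite ?mulr1 ?mulr0.
  by rewrite lt0_exponential_pdf// mul0r.
rewrite lee_fin le_eqVlt in r0; case/predU1P : r0 => [<-|r0].
  by rewrite set_itvco0 integral_set0/= oppr0 expR0 subrr.
rewrite integral_itv_bndo_bndc.
  by have := exponential_prob_itv0c 1 r0; rewrite /exponential_prob /= mulN1r => ->.
by apply/measurable_EFinP; apply: measurable_funTS; exact: measurable_exponential_pdf.
Qed.

(** The truncation [Num.max 0 s] is harmless, since the density vanishes for negative [s]; it makes
    the tail function equal to 1 there, as [integral_prod_expN] requires. *)
Lemma integral_pdf_expR (c : R) : 0 <= c ->
  (\int[leb]_s (pdf s * expR (- (c * Num.max 0 s)))%:E = (1 + c)^-1%:E)%E.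
Proof.
move=> c0; have c1 : 0 < 1 + c by rewrite ltr_wpDr.
transitivity (\int[leb]_s ((1 + c)^-1%:E * (exponential_pdf (1 + c) s)%:E))%E.
  apply: eq_integral => s _; rewrite -EFinM; congr EFin.
  have [s0|s0] := leP 0 s; last by rewrite !lt0_exponential_pdf// mul0r mulr0.
  rewrite !exponential_pdfE// mulrA mulVf ?gt_eqF// !mul1r -expRD; congr expR; ring.
rewrite ge0_integralZl_EFin//=.
- by rewrite integral_exponential_pdf// mule1.
- by move=> s _; rewrite lee_fin exponential_pdf_ge0// ltW.
- by apply/measurable_EFinP; exact: measurable_exponential_pdf.
- by rewrite invr_ge0 ltW.
Qed.

Lemma measurable_natr_lte d (T : measurableType d) (U V : T -> \bar R) :
  measurable_fun setT U -> measurable_fun setT V ->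
  measurable_fun setT (fun w => (U w < V w)%E%:R : R).
Proof.
move=> mU mV; rewrite [X in measurable_fun _ X](_ : _ = fun w =>
    if (U w < V w)%E then 1 else 0); last by apply/funext => x; case: ifP.
by apply: measurable_fun_ifT => //; exact: measurable_fun_lte.
Qed.

Lemma measurable_pdf_lt d (T : measurableType d) (V : T -> \bar R) :
  measurable_fun setT V ->
  measurable_fun setT (fun x : T * R => pdf x.2 * (x.2%:E < V x.1)%E%:R).
Proof.
move=> mV; apply: measurable_funM.
  by apply: measurableT_comp => //; exact: measurable_exponential_pdf.
apply: measurable_natr_lte; last exact: measurableT_comp.
by apply/measurable_EFinP; exact: measurable_snd.
Qed.

Variables (d : measure_display) (T : measurableType d) (P : probability T R).

(* Tonelli, writing [1 - exp (- v)] as the probability that an exponential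
   variable of rate 1 is less than [v]. *)
Lemma integral_expN_tail (G : T -> R) (V : T -> \bar R) (g : R -> R) (C I : R) :
  measurable_fun setT G -> (forall w, 0 <= G w <= 1) ->
  measurable_fun setT V -> (forall w, 0 <= V w)%E ->
  (\int[P]_w (G w)%:E = C%:E)%E ->
  (forall s, (0 <= s)%R ->
    \int[P]_w (G w * (s%:E < V w)%E%:R)%:E = (C * g s)%:E)%E ->
  (\int[leb]_s (pdf s * g s)%:E = I%:E)%E ->
  (forall s, 0 <= g s) -> measurable_fun setT g ->
  (\int[P]_w (G w * expN (V w))%:E = (C * (1 - I))%:E)%E.
Proof.
move=> mG G01 mV V0 intG tailG intg g0 mg.
have G0 w : 0 <= G w by case/andP: (G01 w).
have G1 w : G w <= 1 by case/andP: (G01 w).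
have pdf0 s : 0 <= pdf s by exact: exponential_pdf_ge0.
have mGe : measurable_fun setT (fun w => G w * expN (V w)).
  by apply: measurable_funM => //; apply: measurableT_comp => //; exact: measurable_expN.
have C0 : 0 <= C by rewrite -lee_fin -intG integral_ge0// => w _; rewrite lee_fin.
have compl : (\int[P]_w (G w * (1 - expN (V w)))%:E = (C * I)%:E)%E.
  transitivity (\int[P]_w \int[leb]_s
     (G w * (pdf s * (s%:E < V w)%E%:R))%:E)%E.
    apply: eq_integral => w _; under eq_integral do rewrite EFinM.
    rewrite ge0_integralZl_EFin//.
    - by rewrite integral_pdf_expN.
    - by move=> s _; rewrite lee_fin mulr_ge0.
    - apply/measurable_EFinP.
      exact: (measurableT_comp (measurable_pdf_lt mV) (pair1_measurable w)).
  rewrite (fubini_tonelli (m1 := P) (m2 := leb) (fun x : T * R =>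
     (G x.1 * (pdf x.2 * (x.2%:E < V x.1)%E%:R))%:E)); last 2 first.
  - apply/measurable_EFinP; apply: measurable_funM.
      exact: measurableT_comp.
    exact: measurable_pdf_lt.
  - by move=> x; rewrite lee_fin !mulr_ge0.
  transitivity (\int[leb]_s (C%:E * (pdf s * g s)%:E))%E.
    apply: eq_integral => s _ /=.
    have [s0|s0] := ltP s 0.
      rewrite integral0_eq => [|w _]; first by rewrite lt0_exponential_pdf// mul0r mule0.
      by rewrite lt0_exponential_pdf// mul0r mulr0.
    under eq_integral do rewrite mulrCA EFinM.
    rewrite ge0_integralZl_EFin//.
    - by rewrite tailG// -!EFinM mulrCA.
    - by move=> w _; rewrite lee_fin mulr_ge0.
    - apply/measurable_EFinP; apply: measurable_funM => //.
      exact: measurable_natr_lte.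
  rewrite ge0_integralZl_EFin//.
  - by rewrite intg.
  - by move=> s _; rewrite lee_fin mulr_ge0.
  - apply/measurable_EFinP; apply: measurable_funM => //.
    exact: measurable_exponential_pdf.
have sumG : (\int[P]_w (G w * expN (V w))%:E +
    \int[P]_w (G w * (1 - expN (V w)))%:E = C%:E)%E.
  rewrite -intG -ge0_integralD//.
  - by apply: eq_integral => w _; rewrite -EFinD -mulrDr addrC subrK mulr1.
  - by move=> w _; rewrite lee_fin mulr_ge0// expN_ge0.
  - exact/measurable_EFinP.
  - by move=> w _; rewrite lee_fin mulr_ge0// subr_ge0 expN_le1.
  - apply/measurable_EFinP; apply: measurable_funM => //.
    by apply: measurable_funB => //; apply: measurableT_comp => //; exact: measurable_expN.
move: sumG; rewrite compl => sumG.
rewrite mulrBr mulr1 EFinB -sumG addeK//.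
Qed.

End tail_integral.

Section product_expN.
Context {R : realType} {d : measure_display} {T : measurableType d}.
Local Notation leb := (@lebesgue_measure R).
Local Notation pdf := (@exponential_pdf R 1).

Lemma prodr_natr_all (m n : nat) (b : nat -> bool) :
  \prod_(m <= i < n) (b i)%:R = [forall i : 'I_n, (m <= i)%N ==> b i]%:R :> R.
Proof.
have [/forallP h|] :=
    boolP [forall i : 'I_n, (m <= i)%N ==> b i].
  rewrite big_nat big1// => i /andP[mi ilt].
  by have /implyP/(_ mi) -> := h (Ordinal ilt).
rewrite negb_forall; case/existsP => i; rewrite negb_imply => /andP[mi /negbTE bi].
by rewrite (bigD1_seq (i : nat)) ?mem_index_iota ?mi ?iota_uniq//= bi mul0r.
Qed.

Lemma prodr_ge0_le1 (m n : nat) (F : nat -> R) :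
  (forall i, 0 <= F i <= 1) -> 0 <= \prod_(m <= i < n) F i <= 1.
Proof.
move=> F01; rewrite prodr_ge0 => [|i _]; last by case/andP: (F01 i).
by rewrite prodr_ile1// => i _; exact: F01.
Qed.

Lemma measurable_prodr (I : Type) (r : seq I) (F : I -> T -> R) :
  (forall i, measurable_fun setT (F i)) ->
  measurable_fun setT (fun w => \prod_(i <- r) F i w).
Proof.
move=> mF; elim: r => [|i r IH].
  by under eq_fun do rewrite big_nil; exact: measurable_cst.
by under eq_fun do rewrite big_cons; exact: measurable_funM.
Qed.

Variable P : probability T R.

(** Only the factorisation of the joint tails on [E] is assumed. The tail indicators are replaced by
    exponentials one at a time, each replacement being one use of [integral_expN_tail]. *)
Lemma integral_prod_expN (E : set T) (n : nat) (V : nat -> T -> \bar R)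
    (c : R) (g : nat -> R -> R) (I : nat -> R) :
  measurable E -> (forall i, measurable_fun setT (V i)) ->
  (forall i w, 0 <= V i w)%E ->
  (forall t : nat -> R,
    P (E `&` [set w | forall i, (i < n)%N -> ((t i)%:E < V i w)%E]) =
    (c * \prod_(0 <= i < n) g i (t i))%:E) ->
  (forall i s, 0 <= g i s) -> (forall i, measurable_fun setT (g i)) ->
  (forall i s, s < 0 -> g i s = 1) ->
  (forall i, (\int[leb]_s (pdf s * g i s)%:E = (I i)%:E)%E) ->
  (\int[P]_w (\1_E w * \prod_(0 <= i < n) expN (V i w))%:E =
   (c * \prod_(0 <= i < n) (1 - I i))%:E)%E.
Proof.
move=> mE mV V0 tails g0 mg g1 intg.
(* Hybrid statement: the first [k] factors are already exponentials, the others are still indicators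
   of tails. *)
suff h k : (k <= n)%N -> forall t : nat -> R,
    (\int[P]_w (\1_E w * (\prod_(0 <= i < k) expN (V i w) *
       \prod_(k <= i < n) ((t i)%:E < V i w)%E%:R))%:E =
     (c * (\prod_(0 <= i < k) (1 - I i) * \prod_(k <= i < n) g i (t i)))%:E)%E.
  have := h n (leqnn n) (fun=> 0); rewrite (big_geq (leqnn n)) mulr1 => <-.
  by apply: eq_integral => w _; rewrite (big_geq (leqnn n)) mulr1.
elim: k => [_ t|k IH kn t].
  rewrite !big_nil !mul1r -tails.
  have mB : measurable [set w | forall i, (i < n)%N -> ((t i)%:E < V i w)%E].
    rewrite [X in measurable X](_ : _ =
      \bigcap_(i in [set i | (i < n)%N]) [set w | ((t i)%:E < V i w)%E])//.
    apply: bigcap_measurableType => i _.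
    have := emeasurable_fun_o_infty measurableT (mV i) (t i)%:E.
    by rewrite setTI.
  rewrite -[X in P X]setIT -(integral_indic _ measurableT); last exact: measurableI.
  apply: eq_integral => w _; congr EFin; rewrite big_nil mul1r indicI /=.
  congr (_ * _); rewrite prodr_natr_all indicE; congr (_%:R).
  congr nat_of_bool; apply/forallP/idP => [h|/set_mem h [i ilt]] /=.
    by apply/mem_set => i ilt; exact: (h (Ordinal ilt)).
  exact: h.
pose G w := \1_E w * (\prod_(0 <= i < k) expN (V i w) *
       \prod_(k.+1 <= i < n) ((t i)%:E < V i w)%E%:R) : R.
pose C := c * (\prod_(0 <= i < k) (1 - I i) * \prod_(k.+1 <= i < n) g i (t i)).
(* The threshold of coordinate [k] becomes the integration variable [s]. *)
pose upd s i := if i == k then s else t i.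
have updE s (F : nat -> R -> R) :
    \prod_(k <= i < n) F i (upd s i) = F k s * \prod_(k.+1 <= i < n) F i (t i).
  rewrite big_ltn// {1}/upd eqxx; congr (_ * _); apply: eq_big_nat => i /andP[ki _].
  by rewrite /upd gtn_eqF.
have IHs s : (\int[P]_w (G w * (s%:E < V k w)%E%:R)%:E = (C * g k s)%:E)%E.
  rewrite (_ : C * _ = c * (\prod_(0 <= i < k) (1 - I i) *
      \prod_(k <= i < n) g i (upd s i))); last first.
    by rewrite (updE s g) /C -!mulrA [g k s * _]mulrC.
  rewrite -(IH (ltnW kn) (upd s)); apply: eq_integral => w _; congr EFin.
  rewrite (updE s (fun i x => ((x%:E < V i w)%E)%:R)) /G -!mulrA.
  by congr (_ * (_ * _)); exact: mulrC.
have intG : (\int[P]_w (G w)%:E = C%:E)%E.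
  (* As [V k] is nonnegative, the threshold -1 makes its indicator identically 1, which yields the
     integral of [G] itself. *)
  have := IHs (-1); rewrite g1// mulr1 => <-; apply: eq_integral => w _.
  by rewrite (lt_le_trans _ (V0 k w)) ?lte_fin// mulr1.
have G01 w : 0 <= G w <= 1.
  have /andP[e0 e1] : 0 <= \prod_(0 <= i < k) expN (V i w) <= 1.
    by apply: prodr_ge0_le1 => i; rewrite expN_ge0 expN_le1.
  have /andP[f0 f1] : 0 <= \prod_(k.+1 <= i < n) (((t i)%:E < V i w)%E%:R : R) <= 1.
    by apply: prodr_ge0_le1 => i; case: ltP; rewrite ?lexx ler01.
  have /andP[i0 i1] : 0 <= (\1_E w : R) <= 1.
    by rewrite indicE; case: (_ \in _); rewrite ?lexx ler01.
  rewrite /G !mulr_ge0//=.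
  by rewrite mulr_ile1// ?mulr_ge0// mulr_ile1.
have mG : measurable_fun setT G.
  apply: measurable_funM; first exact: measurable_indic.
  apply: measurable_funM; apply: measurable_prodr => i.
    by apply: measurableT_comp => //; exact: measurable_expN.
  by apply: measurable_natr_lte => //; exact: measurable_cst.
have := integral_expN_tail mG G01 (mV k) (V0 k) intG (fun s _ => IHs s)
  (intg k) (g0 k) (mg k).
rewrite big_nat_recr//= => h; transitivity (C * (1 - I k))%:E.
  rewrite -h; apply: eq_integral => w _; congr EFin.
  by rewrite big_nat_recr//= /G -!mulrA; congr (_ * (_ * _)); exact: mulrC.
by rewrite /C -!mulrA; congr (_ * (_ * _))%:E; exact: mulrC.
Qed.

End product_expN.

(** A class closed under products and powers on which integrals are finite, so that real and
    extended integrals can be exchanged freely. *)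
Definition bounded01 (R : realType) d (T : measurableType d) (f : T -> R) : Prop :=
  measurable_fun setT f /\ forall w, 0 <= f w <= 1.

Section bounded01.
Context {R : realType} {d : measure_display} {T : measurableType d}.
Variable P : probability T R.
Implicit Types f g : T -> R.

Lemma bounded01M f g : bounded01 f -> bounded01 g ->
  bounded01 (fun w => f w * g w).
Proof.
move=> [mf f01] [mg g01]; split; first exact: measurable_funM.
move=> w; have /andP[f0 f1] := f01 w; have /andP[g0 g1] := g01 w.
by rewrite mulr_ge0// mulr_ile1.
Qed.

Lemma bounded01X f k : bounded01 f -> bounded01 (fun w => f w ^+ k).
Proof.
move=> [mf f01]; split; first exact: measurable_funX.
by move=> w; have /andP[f0 f1] := f01 w; rewrite exprn_ge0// exprn_ile1.
Qed.

Lemma bounded01_indic (A : set T) : measurable A -> bounded01 (\1_A : T -> R).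
Proof.
move=> mA; split; first exact: measurable_indic.
by move=> w; rewrite indicE; case: (_ \in _); rewrite ?lexx ler01.
Qed.

Lemma bounded01_prod (r : seq nat) (F : nat -> T -> R) :
  (forall i, bounded01 (F i)) -> bounded01 (fun w => \prod_(i <- r) F i w).
Proof.
move=> F01; split; first by apply: measurable_prodr => i; case: (F01 i).
move=> w; rewrite prodr_ge0 ?prodr_ile1// => i _; case: (F01 i) => _ /(_ w)//.
by case/andP.
Qed.

Lemma bounded01_integrable f : bounded01 f -> P.-integrable setT (EFin \o f).
Proof.
move=> [mf f01]; apply: measurable_bounded_integrable => //.
  by rewrite (le_lt_trans (probability_le1 P measurableT))// ltry.
exists 1; split => // x x1 w _ /=; have /andP[f0 f1] := f01 w.
by rewrite ger0_norm// (le_trans f1)// ltW.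
Qed.

Lemma Rintegral_indic (A : set T) : measurable A ->
  (\int[P]_w \1_A w)%R = fine (P A) :> R.
Proof. by move=> mA; rewrite /Rintegral integral_indic// setIT. Qed.

Lemma Rintegral_EFin f : bounded01 f ->
  (\int[P]_w (f w)%:E = ((\int[P]_w f w)%R)%:E)%E.
Proof.
move=> f01; rewrite /Rintegral fineK//.
by apply: integrable_fin_num => //; exact: bounded01_integrable.
Qed.

Lemma Rintegral_bounded01 f : bounded01 f -> 0 <= (\int[P]_w f w)%R <= 1.
Proof.
move=> f01; have [mf f01'] := f01; rewrite -!lee_fin -Rintegral_EFin//.
rewrite integral_ge0 => [|w _]; last by rewrite lee_fin; case/andP: (f01' w).
rewrite -(probability_setT P) -[X in (_ <= X)%E]mul1e -integral_cst//.
apply: ge0_le_integral => //; try exact/measurable_EFinP.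
by move=> w _; rewrite lee_fin; case/andP: (f01' w).
by move=> w _; rewrite lee_fin; case/andP: (f01' w).
Qed.

Lemma Rintegral_sum (I : Type) (r : seq I) (F : I -> T -> R) :
  (forall i, bounded01 (F i)) ->
  (\int[P]_w (\sum_(i <- r) F i w))%R = \sum_(i <- r) (\int[P]_w F i w)%R.
Proof.
move=> F01; rewrite /Rintegral.
under eq_integral do rewrite -sumEFin.
rewrite integral_sum//; last by move=> i; exact: bounded01_integrable.
under eq_bigr do rewrite Rintegral_EFin//.
by rewrite sumEFin.
Qed.

End bounded01.

(** * Uniqueness of a law on the quadrant with given integer Laplace transforms *)

Section laplace_uniqueness.
Context {R : realType}.

(* The polynomial [(1 - X^(n^2))^K], [K ~ exp (n^2 a + n)], evaluated at
   [exp (- x)] tends to the indicator of [a < x], by Bernoulli's inequality if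
   [a < x] and by [1 - y <= exp (- y)] if [x <= a]. *)
Definition threshold_poly (a : R) (n : nat) : {poly R} :=
  (1 - 'X^(n ^ 2)) ^+ Num.truncn (expR (n%:R ^+ 2 * a + n%:R)).

Lemma threshold_polyE (a : R) n (x : R) : (threshold_poly a n).[expR (- x)] =
  (1 - expR (- (n%:R ^+ 2 * x))) ^+ Num.truncn (expR (n%:R ^+ 2 * a + n%:R)).
Proof.
rewrite /threshold_poly horner_exp hornerD hornerN hornerXn hornerC.
by rewrite -expRM_natl natrX mulrN.
Qed.

Lemma threshold_poly01 (a : R) n (x : R) : 0 <= x ->
  0 <= (threshold_poly a n).[expR (- x)] <= 1.
Proof.
move=> x0; rewrite threshold_polyE.
have y0 : 0 <= 1 - expR (- (n%:R ^+ 2 * x)).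
  by rewrite subr_ge0 expR_le1 oppr_le0 mulr_ge0.
by rewrite exprn_ge0// exprn_ile1// lerBlDr lerDl expR_ge0.
Qed.

Lemma bernoulli_ineq (y : R) K : 0 <= y <= 1 -> 1 - K%:R * y <= (1 - y) ^+ K.
Proof.
move=> /andP[y0 y1]; elim: K => [|K IH]; first by rewrite mul0r subr0.
rewrite exprS -natr1.
have h : (1 - y) * (1 - K%:R * y) <= (1 - y) * (1 - y) ^+ K.
  by rewrite ler_wpM2l// subr_ge0.
apply: le_trans h; have : 0 <= K%:R * y ^+ 2 by rewrite mulr_ge0// sqr_ge0.
by rewrite expr2; lra.
Qed.

Lemma cvg_threshold_poly (a x : R) : 0 <= x ->
  (threshold_poly a n).[expR (- x)] @[n --> \oo] --> ((a < x)%R%:R : R).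
Proof.
move=> x0.
have expn n : expR (- n%:R) <= n.+1%:R^-1 :> R.
  by rewrite expRN lef_pV2 ?posrE ?expR_gt0// -natr1 addrC expR_ge1Dx.
have K_ge0 n : 0 <= expR (n%:R ^+ 2 * a + n%:R) by exact: expR_ge0.
have y1 n : expR (- (n%:R ^+ 2 * x)) <= 1 by rewrite expR_le1 oppr_le0 mulr_ge0.
have [ax|xa] := ltP a x.
  have : (1 - n.+1%:R^-1 : R) @[n --> \oo] --> (1 - 0 : R).
    by apply: cvgB; [exact: cvg_cst|exact: cvg_harmonic].
  rewrite subr0 => lim1; apply: (squeeze_cvgr _ lim1 (cvg_cst (1 : R))).
  have d0 : 0 < x - a by rewrite subr_gt0.
  near=> n; apply/andP; split; last by case/andP: (threshold_poly01 a n x0).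
  rewrite threshold_polyE.
  apply: le_trans (bernoulli_ineq _ _); last by rewrite expR_ge0 y1.
  rewrite lerD2l lerN2; apply: le_trans (expn n).
  have /andP[tr _] := truncn_itv (K_ge0 n).
  apply: (le_trans (ler_wpM2r (expR_ge0 _) tr)).
  rewrite -expRD ler_expR.
  (* From this index on, [n^2 (a - x) + n] is at most [- n], so that [K] times exp (- n^2 x) is at
     most exp (- n). *)
  have nd : 2 <= n%:R * (x - a).
    by rewrite -ler_pdivrMr//; near: n; exact: nbhs_infty_ger.
  have : 2 * n%:R <= n%:R * (n%:R * (x - a)) by rewrite [leRHS]mulrC ler_wpM2r.
  by rewrite expr2; lra.
apply: (squeeze_cvgr _ (cvg_cst (0 : R)) cvg_harmonic).
near=> n; apply/andP; split; first by case/andP: (threshold_poly01 a n x0).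
rewrite threshold_polyE; set K := Num.truncn _.
(* With y = exp (- n^2 x), one has (K + 1) y >= exp n >= 1 + n and y <= 1. The summand [n] in the
   exponent of [K] makes this diverge even when [x = a]. *)
have Ky : n%:R <= K%:R * expR (- (n%:R ^+ 2 * x)).
  have /andP[_ tr] := truncn_itv (K_ge0 n).
  have h1 : expR (n%:R ^+ 2 * a + n%:R) * expR (- (n%:R ^+ 2 * x)) <=
      K.+1%:R * expR (- (n%:R ^+ 2 * x)) by rewrite ler_wpM2r ?expR_ge0// ltW.
  have h2 : expR n%:R <= expR (n%:R ^+ 2 * a + n%:R) * expR (- (n%:R ^+ 2 * x)).
    rewrite -expRD ler_expR.
    have : 0 <= n%:R ^+ 2 * (a - x) by rewrite mulr_ge0// subr_ge0.
    by lra.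
  have := expR_ge1Dx (n%:R : R); move: h1; rewrite -natr1 mulrDl mul1r.
  by have := y1 n; lra.
apply: le_trans (expn n).
apply: (@le_trans _ _ (expR (- expR (- (n%:R ^+ 2 * x))) ^+ K)).
  by rewrite lerXn2r ?nnegrE ?expR_ge0 ?subr_ge0 ?y1 ?expR_ge1Dx.
by rewrite -expRM_natl ler_expR mulrN lerN2.
Unshelve. all: by end_near. Qed.

Section moments.
Context d (T : measurableType d).
Variables (P : probability T R) (u v : T -> R).
Hypotheses (u01 : bounded01 u) (v01 : bounded01 v).

Lemma integrable_moment i j :
  P.-integrable setT (EFin \o (fun w => u w ^+ i * v w ^+ j)).
Proof.
by apply: bounded01_integrable; apply: bounded01M; exact: bounded01X.
Qed.

Lemma integral_poly2 (p q : {poly R}) :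
  (\int[P]_w (p.[u w] * q.[v w])%:E =
   \sum_(i < size p) \sum_(j < size q)
     (p`_i * q`_j)%:E * \int[P]_w (u w ^+ i * v w ^+ j)%:E)%E.
Proof.
transitivity (\int[P]_w (\sum_(i < size p) \sum_(j < size q)
    (p`_i * q`_j)%:E * (u w ^+ i * v w ^+ j)%:E))%E.
  apply: eq_integral => w _; rewrite !horner_coef mulr_suml -sumEFin.
  apply: eq_bigr => i _; rewrite mulr_sumr -sumEFin; apply: eq_bigr => j _.
  by rewrite -EFinM; congr EFin; ring.
rewrite integral_sum//; last first.
  move=> i; apply: integrable_sum => // j _; apply: integrableZl => //.
  exact: integrable_moment.
apply: eq_bigr => i _; rewrite integral_sum//; last first.
  by move=> j; apply: integrableZl => //; exact: integrable_moment.
apply: eq_bigr => j _; rewrite integralZl//; exact: integrable_moment.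
Qed.

End moments.

Lemma measure_unique_ray (m1 m2 : {measure set R -> \bar R}) :
  (m1 setT < +oo)%E ->
  (forall a, m1 `]a, +oo[%classic = m2 `]a, +oo[%classic) ->
  forall A, measurable A -> m1 A = m2 A.
Proof.
move=> m1oo m12; apply: (measure_unique (@RGenOInfty.G R)
    (fun n => `](- n%:R)%R, +oo[%classic)).
- exact: RGenOInfty.measurableE.
- move=> _ _ [x ->] [y ->]; exists (Num.max x y); apply/seteqP; split => z /=;
    by rewrite !in_itv/= !andbT gt_max => /andP.
- by move=> n; exists (- n%:R).
- rewrite -subTset => x _; exists (Num.truncn `|x|).+1 => //=.
  rewrite in_itv/= andbT ltrNl; apply: le_lt_trans (truncnS_gt _).
  by rewrite -normrN ler_norm.
- by move=> _ [a ->].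
- move=> n; apply: le_lt_trans m1oo; apply: le_measure; rewrite ?inE//.
Qed.

Lemma measure_unique_rect (m1 m2 : {measure set (R * R) -> \bar R}) :
  (m1 setT < +oo)%E ->
  (forall A B, measurable A -> measurable B -> m1 (A `*` B) = m2 (A `*` B)) ->
  forall C, measurable C -> m1 C = m2 C.
Proof.
move=> m1oo m12; pose G := [set C : set (R * R) | exists A B,
  [/\ measurable A, measurable B & C = A `*` B]].
apply: (measure_unique G (fun=> setT)) => //.
- rewrite measurable_prod_measurableType; congr (<<s _ >>); apply/seteqP; split.
    by move=> _ [A1 mA1 [B1 mB1 <-]]; exists A1, B1.
  by move=> _ [A1 [B1 [mA1 mB1 ->]]]; exists A1 => //; exists B1.
- move=> _ _ [A1 [B1 [mA1 mB1 ->]]] [A2 [B2 [mA2 mB2 ->]]].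
  exists (A1 `&` A2), (B1 `&` B2); split; rewrite ?setXI//; exact: measurableI.
- by move=> _; exists setT, setT; rewrite setXTT.
- by apply/seteqP; split => // x _; exists 0.
- by move=> _ [A1 [B1 [mA1 mB1 ->]]]; exact: m12.
Qed.

Section same_law.
Context d d' (T : measurableType d) (T' : measurableType d').
Variables (P : probability T R) (P' : probability T' R).
Variables (X : T -> R * R) (X' : T' -> R * R).
Hypotheses (mX : measurable_fun setT X) (mX' : measurable_fun setT X').

(** The uniqueness theorem for measures on the line is used on one coordinate at a time, on the law
    restricted to an event fixed by the other coordinate; rectangles then determine the joint
    law. *)
Lemma same_law_rays :
  (forall a b, P (X @^-1` (`]a, +oo[ `*` `]b, +oo[)) =
               P' (X' @^-1` (`]a, +oo[ `*` `]b, +oo[))) ->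
  same_law P P' X X'.
Proof.
move=> rays.
have mX1 : measurable_fun setT (fst \o X) by exact: measurableT_comp.
have mX2 : measurable_fun setT (snd \o X) by exact: measurableT_comp.
have mX1' : measurable_fun setT (fst \o X') by exact: measurableT_comp.
have mX2' : measurable_fun setT (snd \o X') by exact: measurableT_comp.
have mpre (d1 : measure_display) (T1 : measurableType d1) (f : T1 -> R) :
    measurable_fun setT f -> forall A, measurable A -> measurable (f @^-1` A).
  by move=> mf A mA; rewrite -[X in measurable X]setTI; exact: mf.
have le1 (d1 : measure_display) (T1 : measurableType d1) (P1 : probability T1 R)
    (A : set T1) : measurable A -> (P1 A < +oo)%E.
  by move=> mA; rewrite (le_lt_trans (probability_le1 P1 mA))// ltry.
have step1 A b : measurable A -> P (X @^-1` (A `*` `]b, +oo[)) =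
    P' (X' @^-1` (A `*` `]b, +oo[)).
  move=> mA; have mB := mpre _ _ _ mX2 `]b, +oo[%classic (measurable_itv _).
  have mB' := mpre _ _ _ mX2' `]b, +oo[%classic (measurable_itv _).
  apply: (@measure_unique_ray (pushforward (mrestr P mB) (fst \o X))
    (pushforward (mrestr P' mB') (fst \o X'))) => //.
  - by apply: le1; rewrite setTI.
  - by move=> a; exact: rays.
have step2 A B : measurable A -> measurable B -> P (X @^-1` (A `*` B)) =
    P' (X' @^-1` (A `*` B)).
  move=> mA mB; have mXA := mpre _ _ _ mX1 A mA; have mXA' := mpre _ _ _ mX1' A mA.
  have swap (d1 : measure_display) (T1 : measurableType d1) (Y : T1 -> R * R) C :
      Y @^-1` (A `*` C) = (snd \o Y) @^-1` C `&` (fst \o Y) @^-1` A.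
    by apply/seteqP; split => w [].
  rewrite !swap; apply: (@measure_unique_ray
    (pushforward (mrestr P mXA) (snd \o X))
    (pushforward (mrestr P' mXA') (snd \o X'))) => //.
  - by apply: le1; rewrite setTI.
  - by move=> b; have := step1 A b mA; rewrite !swap.
move=> A mA; apply: (@measure_unique_rect (pushforward P X) (pushforward P' X')) => //.
apply: (le1 _ _ P); exact: (mpre _ _ _ mX1 setT measurableT).
Qed.

Definition laplace_integrand (z : R * R) (i j : nat) : R :=
  expR (- z.1) ^+ i * expR (- z.2) ^+ j.

(** A product of threshold polynomials integrates to a finite combination of integer-point
    transforms, and by dominated convergence it tends to the probability of an open quadrant. *)
Lemma laplace_same_law :
  (forall w, 0 <= (X w).1 /\ 0 <= (X w).2) ->
  (forall w, 0 <= (X' w).1 /\ 0 <= (X' w).2) ->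
  (forall i j, \int[P]_w (laplace_integrand (X w) i j)%:E =
               \int[P']_w (laplace_integrand (X' w) i j)%:E)%E ->
  same_law P P' X X'.
Proof.
move=> X0 X'0 lapl; apply: same_law_rays => a b.
have key (d1 : measure_display) (T1 : measurableType d1) (Q : probability T1 R)
    (Y : T1 -> R * R) : measurable_fun setT Y ->
    (forall w, 0 <= (Y w).1 /\ 0 <= (Y w).2) ->
    (\int[Q]_w ((threshold_poly a n).[expR (- (Y w).1)] *
       (threshold_poly b n).[expR (- (Y w).2)])%:E @[n --> \oo] -->
     Q (Y @^-1` (`]a, +oo[ `*` `]b, +oo[)))%E /\
    forall p q : {poly R},
    (\int[Q]_w (p.[expR (- (Y w).1)] * q.[expR (- (Y w).2)])%:E =
     \sum_(i < size p) \sum_(j < size q)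
     (p`_i * q`_j)%:E * \int[Q]_w (laplace_integrand (Y w) i j)%:E)%E.
  move=> mY Y0.
  have m1 : measurable_fun setT (fun w => expR (- (Y w).1)).
    apply: (measurableT_comp (@measurable_expR R)).
    by apply: measurableT_comp => //; exact: measurableT_comp.
  have m2 : measurable_fun setT (fun w => expR (- (Y w).2)).
    apply: (measurableT_comp (@measurable_expR R)).
    by apply: measurableT_comp => //; exact: measurableT_comp.
  have e1 w : 0 <= expR (- (Y w).1) <= 1.
    by rewrite expR_ge0 expR_le1 oppr_le0; case: (Y0 w).
  have e2 w : 0 <= expR (- (Y w).2) <= 1.
    by rewrite expR_ge0 expR_le1 oppr_le0; case: (Y0 w).
  split; last by move=> p q; rewrite integral_poly2.
  have mpoly (p : {poly R}) (f : T1 -> R) : measurable_fun setT f ->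
      measurable_fun setT (fun w => p.[f w]).
    move=> mf; apply: measurableT_comp => //; apply: continuous_measurable_fun.
    exact: continuous_horner.
  have mE : measurable (Y @^-1` (`]a, +oo[ `*` `]b, +oo[)).
    rewrite -[X in measurable X]setTI; apply: mY => //; exact: measurableX.
  rewrite -[X in _ --> Q X]setIT -(integral_indic _ measurableT)//.
  have [] := @dominated_convergence _ T1 R Q setT measurableT (fun n w =>
    ((threshold_poly a n).[expR (- (Y w).1)] *
       (threshold_poly b n).[expR (- (Y w).2)])%:E)
    (fun w => (\1_(Y @^-1` (`]a, +oo[ `*` `]b, +oo[)) w)%:E) (cst 1%E) => //.
  - by move=> n; apply/measurable_EFinP; apply: measurable_funM; exact: mpoly.
  - by apply/measurable_EFinP; exact: measurable_indic.
  - apply: aeW => w _; apply: cvg_EFin; first exact: nearW.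
    rewrite [X in _ --> X](_ : _ = (a < (Y w).1)%R%:R * (b < (Y w).2)%R%:R); last first.
      rewrite indicE -natrM mulnb; congr (_%:R); congr nat_of_bool.
      apply/idP/andP => [/set_mem[]|[? ?]] /=; first by rewrite !in_itv/= !andbT.
      by apply/mem_set; split; rewrite /= in_itv/= andbT.
    by apply: cvgM; apply: cvg_threshold_poly; case: (Y0 w).
  - exact: finite_measure_integrable_cst.
  - apply: aeW => w n _; rewrite /= lee_fin ger0_norm.
      by rewrite mulr_ile1//; case/andP: (threshold_poly01 a n (proj1 (Y0 w))) => //;
        case/andP: (threshold_poly01 b n (proj2 (Y0 w))).
    by rewrite mulr_ge0//; case/andP: (threshold_poly01 a n (proj1 (Y0 w))) => //;
        case/andP: (threshold_poly01 b n (proj2 (Y0 w))).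
have [limX momX] := key _ _ P X mX X0.
have [limX' momX'] := key _ _ P' X' mX' X'0.
have /cvg_lim <- // := limX; have /cvg_lim <- // := limX'.
congr (limn _); apply/funext => n.
rewrite momX momX'; apply: eq_bigr => i _; apply: eq_bigr => j _.
by rewrite lapl.
Qed.

End same_law.

End laplace_uniqueness.

(** * Rewards of a Markov jump process *)

(** Paths are total functions of which an event reads only an initial segment; a constant tail
    spares the bookkeeping of lengths. *)
Definition extend (U : Type) (s : nat -> U) (n : nat) (x : U) : nat -> U :=
  fun i => if (i <= n)%N then s i else x.

Section paths.
Context {R : realType} {d : measure_display} {T : measurableType d}.

Lemma path_event_eq (U : Type) (M : nat -> T -> U) n (s s' : nat -> U) :
  (forall i, (i <= n)%N -> s i = s' i) -> path_event M n s = path_event M n s'.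
Proof.
move=> ss'; apply/seteqP; split => w h i ni; first by rewrite h ?ss'.
by rewrite h// ss'.
Qed.

Lemma path_event_extend (U : Type) (M : nat -> T -> U) n s x :
  path_event M n.+1 (extend s n x) = path_event M n s `&` [set w | M n.+1 w = x].
Proof.
apply/seteqP; split => w /=.
  move=> h; split; last by rewrite h// /extend ltnn.
  by move=> i ni; rewrite h ?(leq_trans ni)// /extend ni.
move=> [h hx] i; rewrite leq_eqVlt ltnS => /predU1P[->|ni].
  by rewrite /extend ltnn.
by rewrite /extend ni h.
Qed.

Lemma path_event0 (U : Type) (M : nat -> T -> U) s :
  path_event M 0 s = [set w | M 0%N w = s 0%N].
Proof.
by apply/seteqP; split => w /= h; [exact: h|move=> i; rewrite leqn0 => /eqP ->].
Qed.

Lemma measurable_path_event (U : Type) (M : nat -> T -> U) n s :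
  measurable_states M -> measurable (path_event M n s).
Proof.
move=> mM; rewrite [X in measurable X](_ : _ =
  \bigcap_(i in [set i | (i <= n)%N]) [set w | M i w = s i])//.
by apply: bigcap_measurableType => i _; exact: mM.
Qed.

Lemma indic_path_split (U : finType) (M : nat -> T -> U) n s w :
  \1_(path_event M n s) w =
  \sum_x \1_(path_event M n.+1 (extend s n x)) w :> R.
Proof.
rewrite (bigD1 (M n.+1 w))//= big1 ?addr0 => [|x xM]; last first.
  rewrite indicE memNset// path_event_extend => -[_ /= Mx].
  by rewrite Mx eqxx in xM.
rewrite !indicE path_event_extend in_setI.
by rewrite [X in _ && X]mem_set// andbT.
Qed.

Lemma Rintegral_path_split (P : probability T R) (U : finType)
    (M : nat -> T -> U) n s (f : T -> R) : measurable_states M -> bounded01 f ->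
  (\int[P]_w (\1_(path_event M n s) w * f w))%R =
  \sum_x (\int[P]_w (\1_(path_event M n.+1 (extend s n x)) w * f w))%R.
Proof.
move=> mM f01; under eq_Rintegral do rewrite indic_path_split mulr_suml.
apply: Rintegral_sum => x; apply: bounded01M => //.
by apply: bounded01_indic; exact: measurable_path_event.
Qed.

(* [H n N s]: the mass of the paths that follow [s] up to time [n], stay alive
   for [N] more steps and then die. *)
Lemma path_recursion (k : nat) (A : 'M[R]_k) (b : 'cV[R]_k)
    (F : nat -> (nat -> option 'I_k) -> R)
    (H : nat -> nat -> (nat -> option 'I_k) -> R) :
  (forall n s i j, s n = Some i ->
     F n.+1 (extend s n (Some j)) = F n s * A i j) ->
  (forall n s i, s n = Some i -> F n.+1 (extend s n None) = F n s * b i 0) ->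
  (forall n s i, s n = Some i -> H n 0%N s = F n.+1 (extend s n None)) ->
  (forall n N s i, s n = Some i ->
     H n N.+1 s = \sum_j H n.+1 N (extend s n (Some j))) ->
  forall N n s i, s n = Some i -> H n N s = F n s * neumann_term A b N i 0.
Proof.
move=> FS FN H0 HS; elim => [|N IH] n s i si; first by rewrite (H0 _ _ i)// (FN _ _ i).
rewrite (HS _ _ _ i)// neumann_termS mxE mulr_sumr; apply: eq_bigr => j _.
rewrite (IH _ _ j) ?(FS _ _ i)//; first by rewrite mulrA.
by rewrite /extend ltnn.
Qed.

(** The state at time [n] is left free: the path event with which this set is intersected already
    fixes it. *)
Definition alive_then_dead (U : Type) (M : nat -> T -> option U) (n N : nat) :
    set T :=
  [set w | (forall i, (n < i <= n + N)%N -> M i w <> None) /\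
           M (n + N).+1 w = None].

Lemma measurable_alive_then_dead (U : Type) (M : nat -> T -> option U) n N :
  measurable_states M -> measurable (alive_then_dead M n N).
Proof.
move=> mM; rewrite [X in measurable X](_ : _ =
  (\bigcap_(i in [set i | (n < i <= n + N)%N]) ~` [set w | M i w = None]) `&`
  [set w | M (n + N).+1 w = None])//.
by apply: measurableI => //; apply: bigcap_measurableType => i _; exact: measurableC.
Qed.

Lemma alive_then_dead0 (U : Type) (M : nat -> T -> option U) n s :
  path_event M n s `&` alive_then_dead M n 0 =
  path_event M n.+1 (extend s n None).
Proof.
rewrite path_event_extend; apply/seteqP; split => w /= [Ms].
  by case; rewrite addn0.
move=> MN; split => //; split; rewrite addn0// => i /andP[ni iltn].
by rewrite ltnNge iltn in ni.
Qed.

Lemma alive_then_deadS (U : Type) (M : nat -> T -> option U) n N s x :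
  path_event M n.+1 (extend s n (Some x)) `&` alive_then_dead M n N.+1 =
  path_event M n.+1 (extend s n (Some x)) `&` alive_then_dead M n.+1 N.
Proof.
rewrite path_event_extend; apply/seteqP; split => w /= [[Ms Mx] [al dead]].
  split => //; split; last by rewrite addSn -addnS.
  move=> i /andP[ni iN]; apply: al; rewrite (ltn_trans _ ni)//=.
  by rewrite addnS -addSn.
split => //; split; last by rewrite addnS -addSn.
move=> i /andP[ni iN]; have [->|] := eqVneq i n.+1; first by rewrite Mx.
move=> nin; apply: al; rewrite ltn_neqAle eq_sym nin ni/=.
by rewrite addSn -addnS.
Qed.

Lemma alive_then_deadN (U : Type) (M : nat -> T -> option U) n N s :
  path_event M n.+1 (extend s n None) `&` alive_then_dead M n N.+1 = set0.
Proof.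
rewrite path_event_extend; apply/seteqP; split => w //= [[_ MN] [al _]].
by apply: (al n.+1) => //; rewrite ltnSn/= addnS ltnS leq_addr.
Qed.

End paths.

Definition reward_of (R : realType) (p : nat) (th : 'rV[R]_p)
    (x : option 'I_p) : R :=
  if x is Some i then th 0 i else 0.

Lemma measurable_state_fun (R : realType) d (T : measurableType d) (U : finType)
    (M : nat -> T -> U) (f : U -> R) n :
  measurable_states M -> measurable_fun setT (fun w => f (M n w)).
Proof.
move=> mM; rewrite [X in measurable_fun _ X](_ : _ =
    fun w => \sum_x f x * \1_[set w | M n w = x] w); last first.
  apply/funext => w; rewrite (bigD1 (M n w))//= big1 => [|x xM].
    by rewrite indicE mem_set// mulr1 addr0.
  by rewrite indicE memNset ?mulr0//= => Mx; rewrite Mx eqxx in xM.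
by apply: measurable_sum => x; apply: measurable_funM => //; exact: measurable_indic.
Qed.

Section terminating_chain.
Context {R : realType} {d : measure_display} {T : measurableType d}.
Variables (P : probability T R) (k : nat) (v : 'rV[R]_k) (A : 'M[R]_k).
Variable M : nat -> T -> option 'I_k.
Hypothesis hM : terminating_chain P v A M.

Let mM : measurable_states M. Proof. by case: hM. Qed.

Lemma measurable_fin_prob (B : set T) : measurable B -> (fine (P B))%:E = P B.
Proof. by move=> mB; rewrite fineK// fin_num_measure. Qed.

Lemma path_prob_extend n s x :
  fine (P (path_event M n.+1 (extend s n x))) =
  fine (P (path_event M n s)) * trans_prob A (s n) x.
Proof.
case: hM => _ _ ->; rewrite -measurable_fin_prob; last exact: measurable_path_event.
rewrite -EFinM/= {2 3}/extend leqnn ltnn; congr (fine (P _) * _).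
by apply: path_event_eq => i ni; rewrite /extend ni.
Qed.

End terminating_chain.

Definition exponential_holdings (R : realType) d (T : measurableType d)
    (P : probability T R) p (S : 'M[R]_p) (Z : nat -> T -> option 'I_p)
    (W : nat -> T -> \bar R) : Prop :=
  forall (n : nat) (s : nat -> option 'I_p) (t : nat -> R), (forall i, 0 <= t i) ->
  P (path_event Z n s `&`
     [set w | forall i, (i <= n)%N -> ((t i)%:E < W i w)%E]) =
  (P (path_event Z n s) *
   (\prod_(0 <= i < n.+1) expR (- (rate S (s i) * t i)))%:E)%E.

Section jump_process.
Context {R : realType} {d : measure_display} {T : measurableType d}.
Variables (P : probability T R) (p : nat) (v : 'rV[R]_p) (S : 'M[R]_p).
Variables (Z : nat -> T -> option 'I_p) (W : nat -> T -> \bar R).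
Hypothesis hS : subintensity S.
Hypothesis hZ : terminating_chain P v (jump_mx S) Z.
Hypotheses (mW : forall i, measurable_fun setT (W i))
  (W0 : forall i w, (0 <= W i w)%E).
Hypothesis hW : exponential_holdings P S Z W.

Let mZ : measurable_states Z. Proof. by case: hZ. Qed.

Lemma rate_ge0 x : 0 <= rate S x.
Proof. by case: x => //= i; rewrite oppr_ge0 subintensity_diag. Qed.

Lemma measurable_holding_tails n (t : nat -> R) :
  measurable [set w | forall i, (i <= n)%N -> ((t i)%:E < W i w)%E].
Proof.
rewrite [X in measurable X](_ : _ =
  \bigcap_(i in [set i | (i <= n)%N]) [set w | ((t i)%:E < W i w)%E])//.
apply: bigcap_measurableType => i _.
have := emeasurable_fun_o_infty measurableT (mW i) (t i)%:E.
by rewrite setTI.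
Qed.

(* The holding times are almost surely positive, so that negative times may be
   truncated at [0]. *)
Lemma holding_tails n s (t : nat -> R) :
  P (path_event Z n s `&`
     [set w | forall i, (i <= n)%N -> ((t i)%:E < W i w)%E]) =
  (P (path_event Z n s) *
   (\prod_(0 <= i < n.+1) expR (- (rate S (s i) * Num.max 0 (t i))))%:E)%E.
Proof.
have mpath := measurable_path_event n s mZ.
rewrite -(@hW n s (fun i => Num.max 0 (t i))); last by move=> i; rewrite le_max lexx.
have pos : P (path_event Z n s `&`
    [set w | forall i, (i <= n)%N -> (0%:E < W i w)%E]) = P (path_event Z n s).
  rewrite (@hW n s (fun=> 0))// big1 ?mule1// => i _.
  by rewrite mulr0 oppr0 expR0.
set B := [set w | forall i, (i <= n)%N -> (0%:E < W i w)%E] in pos.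
set C := [set w | forall i, (i <= n)%N -> ((t i)%:E < W i w)%E].
rewrite (_ : [set w | _] = C `&` B); last first.
  apply/seteqP; split => w /= h.
    split => i ni; apply: le_lt_trans (h i ni); rewrite lee_fin le_max lexx//.
    by rewrite orbT.
  case: h => hC hB i ni; rewrite EFin_max gt_max; apply/andP; split.
    exact: hB.
  exact: hC.
have mB : measurable B by exact: (measurable_holding_tails n (fun=> 0)).
have mC : measurable C by exact: (measurable_holding_tails n t).
have PA : P (path_event Z n s `\` B) = 0%E.
  rewrite measureD//; last first.
    by rewrite (le_lt_trans (probability_le1 P mpath))// ltry.
  by rewrite [X in (_ - X)%E]pos subee// fin_num_measure.
rewrite (measureDI P (A := path_event Z n s `&` C) (B := B))//; last exact: measurableI.
rewrite [X in (X + _)%E](_ : _ = 0%E) ?add0e -?setIA//.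
apply: subset_measure0 PA; [|exact: measurableD|by move=> w [[]]].
by apply: measurableD => //; exact: measurableI.
Qed.

Variable th : 'rV[R]_p.
Hypothesis th0 : nneg_mx th.

Lemma reward_of_ge0 x : 0 <= reward_of th x.
Proof. by case: x => //= i; exact: th0. Qed.

Definition discounted_reward (m : nat) (w : T) : R :=
  \prod_(0 <= i < m) expN ((reward_of th (Z i w))%:E * W i w)%E.

Lemma bounded01_discounted_reward m : bounded01 (discounted_reward m).
Proof.
apply: bounded01_prod => i; split; last first.
  by move=> w; rewrite expN_ge0 expN_le1// mule_ge0// lee_fin reward_of_ge0.
apply: measurableT_comp; first exact: measurable_expN.
apply: emeasurable_funM => //; apply/measurable_EFinP.
exact: measurable_state_fun.
Qed.

Definition discount_of (x : option 'I_p) : R :=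
  1 - reward_of th x / (rate S x + reward_of th x).

(** Along a fixed path with positive rewards, the variable r W is exponential with parameter l / r,
    and the mean of exp (- r W) is l / (l + r), the discount. Vanishing rewards and rates are
    absorbed in the choice of the tail functions. *)
Lemma Rintegral_path_discounted n s :
  (\int[P]_w (\1_(path_event Z n s) w * discounted_reward n.+1 w))%R =
  fine (P (path_event Z n s)) * \prod_(0 <= i < n.+1) discount_of (s i).
Proof.
have mpath := measurable_path_event n s mZ.
pose r i := reward_of th (s i); pose l i := rate S (s i).
have r0 i : 0 <= r i by exact: reward_of_ge0.
have l0 i : 0 <= l i by exact: rate_ge0.
(* If the reward rate is 0, the variable is 0 and its tail is the indicator of negative
   thresholds. *)
pose g i t : R := if r i == 0 then (t < 0)%R%:R
  else expR (- (l i / r i * Num.max 0 t)).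
pose I i : R := r i / (l i + r i).
apply: EFin_inj; rewrite -Rintegral_EFin; last first.
  by apply: bounded01M; [exact: bounded01_indic|exact: bounded01_discounted_reward].
transitivity (\int[P]_w (\1_(path_event Z n s) w *
    \prod_(0 <= i < n.+1) expN ((r i)%:E * W i w))%:E)%E.
  apply: eq_integral => w _; congr EFin; rewrite indicE.
  have [/set_mem h|_] := boolP (_ \in _); last by rewrite !mul0r.
  rewrite !mul1r; apply: eq_big_nat => i /andP[_ ni].
  by rewrite h.
rewrite (@integral_prod_expN _ _ _ P (path_event Z n s) n.+1
  (fun i w => ((r i)%:E * W i w)%E) (fine (P (path_event Z n s))) g I)//.
- move=> i; apply: emeasurable_funM => //; exact: measurable_cst.
- by move=> i w; rewrite mule_ge0// lee_fin.
- move=> t; rewrite EFinM measurable_fin_prob//.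
  (* A zero reward facing a nonnegative threshold empties the event and annihilates the product. *)
  have [/existsP[i /andP[/eqP ri ti]]|none] :=
      boolP [exists i : 'I_n.+1, (r i == 0) && (0 <= t i)].
    rewrite (bigD1_seq (i : nat)) ?mem_index_iota ?iota_uniq ?ltn_ord//=.
    rewrite {1}/g ri eqxx ltNge ti mul0r mule0.
    rewrite [X in P X](_ : _ = set0) ?measure0//.
    apply/seteqP; split => w //= [_ /(_ i (ltn_ord i))].
    by rewrite ri mul0e lte_fin ltNge ti.
  have none' i : (i <= n)%N -> r i = 0 -> t i < 0.
    move=> ni ri; rewrite ltNge; apply/negP => ti; move/negP: none; apply.
    by apply/existsP; exists (Ordinal (ni : (i < n.+1)%N)); rewrite /= ri eqxx.
  (* Dividing by the reward moves the thresholds to the holding times themselves; -1 is a threshold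
     that a holding time always exceeds. *)
  pose t' i := if r i == 0 then -1 else t i / r i.
  rewrite [X in P (_ `&` X)](_ : _ =
      [set w | forall i, (i <= n)%N -> ((t' i)%:E < W i w)%E]); last first.
    apply/seteqP; split => w /= h i ni; have := h i ni; rewrite /t';
        have [ri|ri] := eqVneq (r i) 0.
    - by rewrite (lt_le_trans _ (W0 i w))// lte_fin ltrN10.
    - have rp : 0 < r i by rewrite lt_neqAle eq_sym ri r0.
      case: (W i w) => [x| |].
      + by rewrite -EFinM !lte_fin ltr_pdivrMr// mulrC.
      + by rewrite ltry.
      + by rewrite gt0_muleNy.
    - by rewrite ri mul0e lte_fin none'.
    - have rp : 0 < r i by rewrite lt_neqAle eq_sym ri r0.
      case: (W i w) => [x| |].
      + by rewrite -EFinM !lte_fin ltr_pdivrMr// mulrC.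
      + by rewrite gt0_muley ?ltry ?lte_fin.
      + by [].
  rewrite holding_tails; congr (_ * _%:E)%E; apply: eq_big_nat => i /andP[_ ni].
  rewrite /g /t' -/(l i); have [ri|ri] := eqVneq (r i) 0.
    by rewrite none'// max_l ?mulr0 ?oppr0 ?expR0// lerN10.
  congr (expR (- _)); rewrite -mulrA; congr (_ * _).
  by rewrite [RHS]mulrC maxr_pMl ?invr_ge0// mul0r.
- by move=> i t; rewrite /g; case: ifP => _; [exact: ler0n|exact: expR_ge0].
- move=> i; rewrite /g; case: (r i == 0).
    rewrite [X in measurable_fun _ X](_ : _ =
      fun t : R => if t < 0 then 1 else 0); last by apply/funext => t; case: ifP.
    by apply: measurable_fun_ifT => //; exact: measurable_fun_ltr.
  apply: measurableT_comp; first exact: measurable_expR.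
  apply: measurableT_comp => //; apply: measurable_funM => //.
  exact: measurable_maxr.
- move=> i t t0; rewrite /g t0; case: ifP => // _.
  by rewrite max_l ?mulr0 ?oppr0 ?expR0// ltW.
- move=> i; rewrite /g /I; have [ri|ri] := eqVneq (r i) 0.
    rewrite ri mul0r integral0_eq// => t _; have [t0|t0] := ltP t 0.
      by rewrite lt0_exponential_pdf// mul0r.
    by rewrite mulr0.
  rewrite integral_pdf_expR ?divr_ge0//; congr EFin.
  by rewrite -[X in (X + _)^-1](divff ri) -mulrDl invf_div addrC.
Qed.

End jump_process.

Lemma sumr_option (V : nmodType) (I : finType) (F : option I -> V) :
  \sum_x F x = F None + \sum_i F (Some i).
Proof.
rewrite (bigD1 None)//=; congr (_ + _).
rewrite (reindex_omap Some id)/=; last by case.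
by apply: eq_bigl => i; rewrite eqxx.
Qed.

Lemma indicM (R : realType) (T : Type) (A B : set T) w :
  \1_A w * \1_B w = \1_(A `&` B) w :> R.
Proof. by rewrite indicI. Qed.

Lemma Rintegral0_eq (R : realType) d (T : measurableType d)
    (P : probability T R) (f : T -> R) :
  (forall w, f w = 0) -> (\int[P]_w f w)%R = 0.
Proof.
by move=> f0; rewrite /Rintegral integral0_eq// => w _; rewrite f0.
Qed.

(** * Discounted rewards up to the death of the jump chain *)

Section hitting.
Context {R : realType} {d : measure_display} {T : measurableType d}.
Variables (P : probability T R) (p : nat) (v : 'rV[R]_p) (S : 'M[R]_p).
Variables (Z : nat -> T -> option 'I_p) (W : nat -> T -> \bar R).
Hypothesis hS : subintensity S.
Hypothesis hZ : terminating_chain P v (jump_mx S) Z.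
Hypotheses (mW : forall i, measurable_fun setT (W i))
  (W0 : forall i w, (0 <= W i w)%E).
Hypothesis hW : exponential_holdings P S Z W.
Variable th : 'rV[R]_p.
Hypothesis th0 : nneg_mx th.

Let mZ : measurable_states Z. Proof. by case: hZ. Qed.
Local Notation disc := (discounted_reward Z W th).

Let bdisc m : bounded01 (disc m).
Proof. exact: (bounded01_discounted_reward hZ). Qed.

Let weight n s : R :=
  fine (P (path_event Z n s)) * \prod_(0 <= i < n.+1) discount_of S th (s i).

Let weight_extend n s x : weight n.+1 (extend s n x) =
  weight n s * (trans_prob (jump_mx S) (s n) x * discount_of S th x).
Proof.
rewrite /weight (path_prob_extend hZ) big_nat_recr//= {2}/extend ltnn.
rewrite [X in _ * _ * (X * _)](_ : _ =
    \prod_(0 <= i < n.+1) discount_of S th (s i)); last first.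
  by apply: eq_big_nat => i /andP[_ ni]; rewrite /extend -ltnS ni.
by rewrite -!mulrA; congr (_ * _); rewrite mulrCA.
Qed.

Let discount_of_none : discount_of S th None = 1.
Proof. by rewrite /discount_of mul0r subr0. Qed.

(** The weight of the path already contains the discount of its last state, so the next steps charge
    the state being entered: the discount multiplies columns here, not rows as in [laplace_mx]. *)
Lemma hit_discounted_from N n s i : s n = Some i ->
  (\int[P]_w (\1_(path_event Z n s) w *
     (\1_(alive_then_dead Z n N) w * disc (n + N).+1 w)))%R =
  weight n s * neumann_term
    (\matrix_(i, j) (jump_mx S i j * discount S th j)) (exit_vec (jump_mx S)) N i 0.
Proof.
pose H n N s := (\int[P]_w (\1_(path_event Z n s) w *
     (\1_(alive_then_dead Z n N) w * disc (n + N).+1 w)))%R.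
apply: (path_recursion (F := weight) (H := H)) => {n N s i}.
- by move=> n s i j si; rewrite weight_extend si mxE.
- move=> n s i si; rewrite weight_extend si discount_of_none mulr1.
  by rewrite exit_vecE.
- move=> n s i si; rewrite /H /weight -(Rintegral_path_discounted hS hZ mW W0 hW th0).
  apply: eq_Rintegral => w _; rewrite mulrA indicM.
  rewrite alive_then_dead0 indicE.
  have [/set_mem h|_] := boolP (_ \in _); last by rewrite !mul0r.
  (* The time spent in the cemetery earns no reward, so the additional factor is 1. *)
  rewrite !mul1r addn0 /discounted_reward [in RHS]big_nat_recr//= (h n.+1)//.
  by rewrite /extend ltnn /= mul0e /= oppr0 expR0 mulr1.
- move=> n N s i si; rewrite /H Rintegral_path_split//; last first.
    by apply: bounded01M => //; apply: bounded01_indic; exact: measurable_alive_then_dead.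
  rewrite sumr_option [X in X + _](_ : _ = 0) ?add0r; last first.
    apply: Rintegral0_eq => w; rewrite mulrA indicM.
    by rewrite alive_then_deadN indic0 mul0r.
  apply: eq_bigr => j _; apply: eq_Rintegral => w _.
  by rewrite !mulrA !indicM alive_then_deadS addSn addnS.
Qed.

(** The chain visits [N + 1] living states, so the matching discounted reward has [N.+1] factors. *)
Definition hit (N : nat) : set T :=
  [set w | (forall i, (i <= N)%N -> Z i w <> None) /\ Z N.+1 w = None].

Definition survive (N : nat) : set T :=
  [set w | forall i, (i <= N)%N -> Z i w <> None].

Lemma measurable_survive N : measurable (survive N).
Proof.
rewrite [X in measurable X](_ : _ =
  \bigcap_(i in [set i | (i <= N)%N]) ~` [set w | Z i w = None])//.
by apply: bigcap_measurableType => i _; exact: measurableC.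
Qed.

Lemma measurable_hit N : measurable (hit N).
Proof.
rewrite [X in measurable X](_ : _ = survive N `&` [set w | Z N.+1 w = None])//.
by apply: measurableI => //; exact: measurable_survive.
Qed.

Lemma indic_hit N w : \1_(hit N) w = \sum_j
  \1_(path_event Z 0 (fun=> Some j)) w * \1_(alive_then_dead Z 0 N) w :> R.
Proof.
rewrite indicE; case Z0 : (Z 0%N w) => [j|]; last first.
  rewrite memNset /= => [|[/(_ 0%N isT)]]; last by rewrite Z0.
  rewrite big1// => j _; rewrite path_event0 indicE memNset ?mul0r//= Z0//.
rewrite (bigD1 j)//= big1 ?addr0 => [|j' jj']; last first.
  rewrite path_event0 indicE memNset ?mul0r//= Z0 => -[jE].
  by rewrite jE eqxx in jj'.
rewrite !indicE path_event0 [X in (nat_of_bool X)%:R * _]mem_set// mul1r.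
congr (_%:R); congr nat_of_bool; apply/idP/idP => /set_mem[al dead]; apply/mem_set.
  by split => // i /andP[_]; exact: al.
split => // -[_|i iN]; first by rewrite Z0.
by apply: al; rewrite add0n iN.
Qed.

Let weight0 j : weight 0 (fun=> Some j) = v 0 j * discount S th j.
Proof.
rewrite /weight big_nat1 path_event0; case: hZ => _ -> _ /=; congr (_ * _).
Qed.

Lemma hit_discounted N :
  (\int[P]_w (\1_(hit N) w * disc N.+1 w))%R =
  (v *m neumann_term (laplace_mx S th) (laplace_exit S th) N) 0 0.
Proof.
under eq_Rintegral do rewrite indic_hit mulr_suml.
rewrite Rintegral_sum => [|j]; last first.
  apply: bounded01M => //; apply: bounded01M; apply: bounded01_indic.
    exact: measurable_path_event.
  exact: measurable_alive_then_dead.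
rewrite mxE; apply: eq_bigr => j _.
under eq_Rintegral do rewrite -mulrA.
rewrite -[in LHS](add0n N) (@hit_discounted_from N 0%N (fun=> Some j) j)//.
rewrite weight0 -mulrA; congr (_ * _).
(* With D the diagonal matrix of discounts, J the jump matrix and e its exit vector, this is D (J
   D)^N e = (D J)^N D e. *)
elim: N j => [|N IH] j; first by rewrite /= [laplace_exit _ _ _ _]mxE.
rewrite !neumann_termS [in LHS]mxE [in RHS]mxE mulr_sumr; apply: eq_bigr => k _.
by rewrite -IH !mxE; ring.
Qed.

(** Every visited state costs a factor at most [delta] and the jump matrix is substochastic. The
    geometric decay serves to exclude explosion. *)
Lemma survive_discounted (delta : R) N : (forall i, discount S th i <= delta) ->
  0 <= delta -> (forall i, 0 <= v 0 i) -> \sum_i v 0 i = 1 ->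
  (\int[P]_w (\1_(survive N) w * disc N.+1 w))%R <= delta ^+ N.+1.
Proof.
move=> disc_le delta0 v0 v1.
pose K n N s := (\int[P]_w (\1_(path_event Z n s) w *
     (\1_[set w | forall i, (n < i <= n + N)%N -> Z i w <> None] w *
      disc (n + N).+1 w)))%R.
have mal n N' : measurable [set w | forall i, (n < i <= n + N')%N -> Z i w <> None].
  rewrite [X in measurable X](_ : _ = \bigcap_(i in [set i | (n < i <= n + N')%N])
    ~` [set w | Z i w = None])//.
  by apply: bigcap_measurableType => i _; exact: measurableC.
have w0 n s : 0 <= weight n s.
  rewrite mulr_ge0// ?fine_ge0// prodr_ge0// => i _; rewrite /discount_of.
  case: (s i) => [j|] /=; first exact: discount_ge0.
  by rewrite mul0r subr0.
have K_le : forall N n s i, s n = Some i -> K n N s <= weight n s * delta ^+ N.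
  elim => [|N' IH] n s i si.
    rewrite expr0 mulr1 /weight -(Rintegral_path_discounted hS hZ mW W0 hW th0).
    rewrite /K le_eqVlt; apply/orP; left; apply/eqP; apply: eq_Rintegral => w _.
    rewrite addn0 [X in _ * (X * _)]indicE mem_set ?mul1r//= => k /andP[nk kn].
    by rewrite ltnNge kn in nk.
  rewrite /K Rintegral_path_split//; last first.
    by apply: bounded01M => //; exact: bounded01_indic.
  rewrite sumr_option [X in X + _](_ : _ = 0) ?add0r; last first.
    apply: Rintegral0_eq => w; rewrite mulrA indicM indicE memNset ?mul0r//.
    rewrite path_event_extend => -[[_ /= ZN] /(_ n.+1)]; apply => //.
    by rewrite ltnSn/= addnS ltnS leq_addr.
  apply: (@le_trans _ _ (\sum_j weight n s * (jump_mx S i j * delta ^+ N'.+1))).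
    apply: ler_sum => j _; apply: (@le_trans _ _ (K n.+1 N' (extend s n (Some j)))).
      rewrite /K le_eqVlt; apply/orP; left; apply/eqP; apply: eq_Rintegral => w _.
      rewrite !mulrA addSn addnS; congr (_ * _).
      rewrite !indicE path_event_extend.
      have [/set_mem[_ /= Zj]|_] := boolP (w \in _ `&` _); last by rewrite !mul0r.
      rewrite !mul1r; congr (_%:R); congr nat_of_bool.
      apply/idP/idP => /set_mem al; apply/mem_set => k /andP[nk kn].
        by apply: al; rewrite (ltn_trans _ nk).
      have [->|nin] := eqVneq k n.+1; first by rewrite Zj.
      by apply: al; rewrite ltn_neqAle eq_sym nin nk.
    apply: le_trans (IH n.+1 _ j _) _; first by rewrite /extend ltnn.
    rewrite weight_extend si -mulrA ler_wpM2l//= -mulrA ler_wpM2l ?jump_mx_ge0//.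
    by rewrite exprS ler_wpM2r ?exprn_ge0//; exact: disc_le.
  rewrite -mulr_sumr ler_wpM2l// -mulr_suml ler_piMl ?exprn_ge0//.
  by case: (jump_mx_subprobability hS).
rewrite (_ : (\int[P]_w _)%R = \sum_j K 0%N N (fun=> Some j)); last first.
  rewrite -Rintegral_sum => [|j]; last first.
    apply: bounded01M; first by apply: bounded01_indic; exact: measurable_path_event.
    by apply: bounded01M => //; exact: bounded01_indic.
  apply: eq_Rintegral => w _; under eq_bigr do rewrite mulrA.
  rewrite -mulr_suml; congr (_ * _); rewrite indicE.
  case Z0 : (Z 0%N w) => [j|]; last first.
    rewrite memNset /= => [|/(_ 0%N isT)]; last by rewrite Z0.
    rewrite big1// => j _; rewrite path_event0 indicE memNset ?mul0r//= Z0//.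
  rewrite (bigD1 j)//= big1 ?addr0 => [|j' jj']; last first.
    rewrite path_event0 indicE memNset ?mul0r//= Z0 => -[jE].
    by rewrite jE eqxx in jj'.
  rewrite !indicE path_event0 [X in (nat_of_bool X)%:R * _]mem_set// mul1r.
  congr (_%:R); congr nat_of_bool; apply/idP/idP => /set_mem al; apply/mem_set.
    by move=> i /andP[_]; exact: al.
  by move=> -[_|i iN]; [rewrite Z0|apply: al].
apply: (@le_trans _ _ (\sum_j v 0 j * delta ^+ N.+1)).
  apply: ler_sum => j _; apply: le_trans (K_le _ _ _ j _) _ => //.
  by rewrite weight0 -mulrA ler_wpM2l// exprS ler_wpM2r ?exprn_ge0.
by rewrite -mulr_suml v1 mul1r.
Qed.

End hitting.

(** * Rewards along a single trajectory *)

Section step_path.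
Context {R : realType} {p : nat}.

(** Steps of length zero are allowed. The times before [t N] are covered by the intervals of living
    states, so [t N] is the first time at which the path is dead, and the integrand is a finite
    combination of indicators of intervals. *)
Lemma total_reward_step (r : 'rV[R]_p) (Js : R -> option 'I_p) (N : nat)
    (t : nat -> R) (z : nat -> option 'I_p) :
  (forall c, 0 <= r 0 c) -> t 0%N = 0 -> (forall i, (i < N)%N -> t i <= t i.+1) ->
  (forall i, (i < N)%N -> z i <> None) ->
  (forall i s, (i < N)%N -> t i <= s < t i.+1 -> Js s = z i) ->
  Js (t N) = None ->
  termination_time Js = (t N)%:E /\
  total_reward r Js = \sum_(0 <= i < N) reward_of r (z i) * (t i.+1 - t i).
Proof.
move=> r0 t0 tS zN Jz JN.
have t_ge0 i : (i <= N)%N -> 0 <= t i.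
  elim: i => [|i IH iN]; first by rewrite t0.
  by rewrite (le_trans (IH (ltnW iN)))// tS.
have find s : 0 <= s -> s < t N -> exists2 i, (i < N)%N & t i <= s < t i.+1.
  move=> s0; clear -s0 t0; elim: N => [|N IH]; first by rewrite t0 ltNge s0.
  have [sN _|Ns sN] := ltP s (t N).
    by have [i iN h] := IH sN; exists i => //; rewrite ltnW.
  by exists N => //; rewrite Ns.
have term : termination_time Js = (t N)%:E.
  apply/eqP; rewrite eq_le; apply/andP; split.
    by apply: ereal_inf_lbound; exists (t N) => //; split => //; exact: t_ge0.
  apply: le_ereal_inf_tmp => _ [s [s0 Js0] <-]; rewrite lee_fin leNgt.
  apply/negP => /(find _ s0)[i iN ts]; apply: (zN _ iN).
  by rewrite -(Jz i s iN ts).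
split => //; rewrite /total_reward term.
have mono i j : (i <= j)%N -> (j <= N)%N -> t i <= t j.
  elim: j => [|j IH]; first by rewrite leqn0 => /eqP ->.
  rewrite leq_eqVlt => /predU1P[->//|ij] jN.
  by rewrite (le_trans (IH ij (ltnW jN)))// tS.
have rew0 x : 0 <= reward_of r x by case: x => /=.
rewrite /Rintegral integral_mkcond.
transitivity (fine (\int[lebesgue_measure]_s (\sum_(0 <= i < N)
    (reward_of r (z i))%:E * (\1_(`[t i, t i.+1[%classic) s)%:E)))%E.
  congr fine; apply: eq_integral => s _; rewrite patchE.
  rewrite -[RHS]/(\sum_(0 <= i < N) (reward_of r (z i) *
    \1_(`[t i, t i.+1[%classic) s)%:E)%E sumEFin.
  case: ifPn => [/set_mem[s0]|/negP sN].
    rewrite lte_fin => /(find _ s0)[i iN ts]; congr EFin.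
    rewrite (bigD1_seq i) ?mem_index_iota ?iota_uniq//=.
    rewrite (Jz i s iN ts) indicE mem_set/= ?in_itv//= mulr1.
    rewrite big_seq_cond big1 ?addr0//.
    move=> j; rewrite mem_index_iota => /andP[/andP[_ jN] ji].
    rewrite indicE memNset ?mulr0//= in_itv/= => /andP[tj jt].
    case/andP: ts => ti it; move: ji; rewrite neq_ltn => /orP[ji|ij].
      by have := mono _ _ ji (ltnW iN); rewrite leNgt (le_lt_trans ti).
    by have := mono _ _ ij (ltnW jN); rewrite leNgt (le_lt_trans tj).
  rewrite big1_seq// => i /andP[_]; rewrite mem_index_iota => /andP[_ iN].
  rewrite indicE memNset ?mulr0//= in_itv/= => /andP[ti it]; apply: sN.
  apply/mem_set; split; first by rewrite (le_trans _ ti)// t_ge0// ltnW.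
  by rewrite lte_fin (lt_le_trans it)// mono.
rewrite ge0_integral_sum//.
- rewrite (_ : (\sum_(0 <= i < N) _)%E =
      (\sum_(0 <= i < N) (reward_of r (z i) * (t i.+1 - t i))%:E)%E).
    by rewrite sumEFin.
  apply: eq_big_nat => i /andP[_ iN]; rewrite ge0_integralZl_EFin//.
  + rewrite integral_indic//= setIT lebesgue_measure_itv/= lte_fin.
    have := tS i iN; rewrite le_eqVlt => /predU1P[->|->].
      by rewrite ltxx subrr mulr0 mule0.
    by rewrite EFinM EFinB.
  + by apply/measurable_EFinP; exact: measurable_indic.
- move=> i; by apply/measurable_EFinP; apply: measurable_funM => //; exact: measurable_indic.
- by move=> i s _; rewrite mule_ge0// lee_fin// indicE.
Qed.

End step_path.

Section jump_path.
Context {R : realType} {p : nat} {T : Type}.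
Variables (Z : nat -> T -> option 'I_p) (W : nat -> T -> \bar R)
  (J : R -> T -> option 'I_p).
Local Notation jump_time i w := (\sum_(0 <= j < i) W j w)%E.
Hypothesis W0 : forall i w, (0 <= W i w)%E.
Hypothesis J_jump : forall w (t : R) (i : nat), 0 <= t ->
  (jump_time i w <= t%:E < jump_time i.+1 w)%E -> J t w = Z i w.
Hypothesis J_explosion : forall w (t : R), 0 <= t ->
  (forall i, jump_time i w <= t%:E)%E -> J t w = None.

Lemma jump_cases w (t : R) : 0 <= t ->
  (exists i, (jump_time i w <= t%:E < jump_time i.+1 w)%E) \/
  (forall i, (jump_time i w <= t%:E)%E).
Proof.
move=> t0; have [h|] := pselect (forall i, (jump_time i w <= t%:E)%E); first by right.
move=> /existsNP[i /negP]; rewrite -ltNge => ti; left.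
elim: i ti => [|i IH ti]; first by rewrite big_geq// lte_fin ltNge t0.
have [/IH//|it] := ltP t%:E (jump_time i w).
by exists i; rewrite it ti.
Qed.

Lemma discounted_path (r : 'rV[R]_p) (N : nat) w :
  (forall c, 0 <= r 0 c) ->
  (forall i, (i < N)%N -> Z i w <> None) -> Z N w = None ->
  (forall i, (i < N)%N -> W i w \is a fin_num) -> (0 < W N w)%E ->
  (termination_time (J ^~ w) < +oo)%E /\
  total_reward r (J ^~ w) =
  \sum_(0 <= i < N) reward_of r (Z i w) * fine (W i w).
Proof.
move=> r0 ZN ZNN WN WNN.
pose t i := \sum_(0 <= j < i) fine (W j w).
have tE i : (i <= N)%N -> jump_time i w = (t i)%:E.
  move=> iN; rewrite /t -sumEFin; apply: eq_big_nat => j /andP[_ ji].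
  by rewrite fineK// WN// (leq_trans ji).
have tS i : t i.+1 = t i + fine (W i w) by rewrite /t big_nat_recr.
have t0 i : 0 <= t i by rewrite sumr_ge0// => j _; rewrite fine_ge0.
have [] := @total_reward_step R p r (J ^~ w) N t (Z ^~ w) r0.
- by rewrite /t big_geq.
- by move=> i _; rewrite tS lerDl fine_ge0.
- exact: ZN.
- move=> i s iN /andP[ts st]; apply: J_jump; first by rewrite (le_trans _ ts).
  by rewrite !tE ?lee_fin ?lte_fin ?ts//; rewrite ltnW.
(* Positivity of the holding time at [N] puts the time [t N] inside the interval on which [J] equals
   [Z N], that is, the cemetery. *)
- rewrite -ZNN; apply: J_jump => //; rewrite big_nat_recr//= tE// lexx/=.
  by case: (W N w) WNN => [x|_|//]; rewrite ?ltry// -EFinD !lte_fin ltrDl.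
move=> -> ->; split; first exact: ltry.
by apply: eq_bigr => i _; rewrite tS addrAC subrr add0r.
Qed.

End jump_path.

(** * Measurability of the termination time and of the rewards *)

Section measurable_reward.
Context {R : realType} {p : nat} {d : measure_display} {T : measurableType d}.
Variables (Z : nat -> T -> option 'I_p) (W : nat -> T -> \bar R)
  (J : R -> T -> option 'I_p).
Local Notation jump_time i w := (\sum_(0 <= j < i) W j w)%E.
Hypothesis mZ : measurable_states Z.
Hypothesis mW : forall i, measurable_fun setT (W i).
Hypothesis W0 : forall i w, (0 <= W i w)%E.
Hypothesis J_jump : forall w (t : R) (i : nat), 0 <= t ->
  (jump_time i w <= t%:E < jump_time i.+1 w)%E -> J t w = Z i w.
Hypothesis J_explosion : forall w (t : R), 0 <= t ->
  (forall i, jump_time i w <= t%:E)%E -> J t w = None.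

Lemma measurable_jump_time i : measurable_fun setT (fun w => jump_time i w).
Proof. exact: emeasurable_sum. Qed.

(** A visit of the chain to the cemetery counts only if its time interval is nonempty, since
    otherwise the process need not show it. *)
Let death i w : \bar R :=
  if (Z i w == None) && (jump_time i w < jump_time i.+1 w)%E then jump_time i w
  else +oo%E.

Let measurable_death i : measurable_fun setT (death i).
Proof.
apply: measurable_fun_ifT => //; last exact: measurable_jump_time.
apply: measurable_and; last by apply: measurable_fun_lte; exact: measurable_jump_time.
apply: (measurable_fun_bool true); rewrite setTI.
rewrite [X in measurable X](_ : _ = [set w | Z i w = None])//.
by apply/seteqP; split => w /eqP.
Qed.

(** The process is dead at [t] either because the chain sits in the cemetery or because all jump
    times are at most [t]. This turns an infimum over real times into countable operations, hence
    into a measurable function. *)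
Lemma termination_timeE w : termination_time (J ^~ w) =
  Order.min (einfs (death ^~ w) 0%N) (esups (fun i => jump_time i w) 0%N).
Proof.
apply/eqP; rewrite eq_le; apply/andP; split.
  rewrite le_min; apply/andP; split.
    apply: le_ereal_inf_tmp => _ [i _ <-]; rewrite /death.
    case: ifPn => [/andP[/eqP Zi ti]|_]; last by rewrite leey.
    have tfin : jump_time i w \is a fin_num.
      by rewrite ge0_fin_numE ?sume_ge0// (lt_le_trans ti)// leey.
    rewrite -(fineK tfin); apply: ereal_inf_lbound; exists (fine (jump_time i w)) => //.
    split; first by rewrite fine_ge0// sume_ge0.
    by rewrite -Zi; apply: J_jump; rewrite ?fineK ?lexx// fine_ge0// sume_ge0.
  have [->|supoo] := eqVneq (esups (fun i => jump_time i w) 0%N) +oo%E.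
    by rewrite leey.
  have sup_ge i : (jump_time i w <= esups (fun i => jump_time i w) 0%N)%E.
    by apply: ereal_sup_ubound; exists i.
  have sup0 : (0 <= esups (fun i => jump_time i w) 0%N)%E.
    by apply: le_trans (sup_ge 0%N); rewrite big_geq.
  have supfin : esups (fun i => jump_time i w) 0%N \is a fin_num.
    by rewrite ge0_fin_numE// ltey.
  rewrite -(fineK supfin); apply: ereal_inf_lbound.
  exists (fine (esups (fun i => jump_time i w) 0%N)) => //; split.
    by rewrite fine_ge0.
  apply: J_explosion; first by rewrite fine_ge0.
  by move=> i; rewrite fineK.
apply: le_ereal_inf_tmp => _ [t [t0 Jt] <-]; rewrite ge_min.
have [[i tt]|expl] := jump_cases W w t0; apply/orP; [left|right].
  apply: (@le_trans _ _ (death i w)); first by apply: ereal_inf_lbound; exists i.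
  rewrite /death -(J_jump t0 tt) Jt eqxx/=; case/andP: tt => ti it.
  by rewrite (le_lt_trans ti it).
by apply: ge_ereal_sup => _ [i _ <-].
Qed.

Lemma measurable_termination_time :
  measurable_fun setT (fun w => termination_time (J ^~ w)).
Proof.
under eq_fun do rewrite termination_timeE.
apply: measurable_mine; first exact: measurable_fun_einfs.
by apply: measurable_fun_esups; exact: measurable_jump_time.
Qed.

(** The set of pairs (time, outcome) at which [J] is alive in a given state is a countable union
    over jump intervals, hence jointly measurable; the integral over time is then measurable in the
    outcome. *)
Lemma measurable_total_reward (r : 'rV[R]_p) : (forall c, 0 <= r 0 c) ->
  measurable_fun setT (fun w => total_reward r (J ^~ w)).
Proof.
move=> r0.
pose B x := [set y : R * T | [/\ 0 <= y.1,
  (y.1%:E < termination_time (J ^~ y.2))%E & J y.1 y.2 = Some x]].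
have mfst : measurable_fun setT (fun y : R * T => y.1%:E : \bar R).
  by apply/measurable_EFinP; exact: measurable_fst.
have mlt (f g : R * T -> \bar R) : measurable_fun setT f -> measurable_fun setT g ->
    measurable [set y | (f y < g y)%E].
  by move=> mf mg; rewrite -[X in measurable X]setTI; exact: measurable_lte.
have mle (f g : R * T -> \bar R) : measurable_fun setT f -> measurable_fun setT g ->
    measurable [set y | (f y <= g y)%E].
  by move=> mf mg; rewrite -[X in measurable X]setTI; exact: measurable_lee.
have mjt i : measurable_fun setT (fun y : R * T => jump_time i y.2).
  exact: (measurableT_comp (measurable_jump_time i) measurable_snd).
have mB x : measurable (B x).
  rewrite (_ : B x = [set y | (0%:E <= y.1%:E)%E] `&`
    [set y | (y.1%:E < termination_time (J ^~ y.2))%E] `&`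
    \bigcup_i ([set y | (jump_time i y.2 <= y.1%:E)%E] `&`
      [set y | (y.1%:E < jump_time i.+1 y.2)%E] `&`
      snd @^-1` [set w | Z i w = Some x])); last first.
    apply/seteqP; split => -[s w] /=.
      move=> [s0 st Js]; split; first by split.
      have [[i ts]|ex] := jump_cases W w s0; last first.
        by rewrite (J_explosion s0 ex) in Js.
      by exists i => //=; rewrite -(J_jump s0 ts); case/andP: ts.
    move=> [[s0 st] [i _ [[ti it] Zi]]]; split => //.
    by rewrite -Zi; apply: J_jump => //; apply/andP.
  apply: measurableI; first apply: measurableI.
  - by apply: mle => //; exact: measurable_cst.
  - by apply: mlt => //; exact: (measurableT_comp measurable_termination_time measurable_snd).
  - apply: bigcupT_measurable => i; apply: measurableI.
      by apply: measurableI; [exact: mle|exact: mlt].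
    by rewrite -[X in measurable X]setTI; apply: measurable_snd => //; exact: mZ.
pose f (y : R * T) : \bar R := (\sum_x r 0 x * \1_(B x) y)%:E.
rewrite [X in measurable_fun _ X](_ : _ =
    fine \o (fun w => \int[lebesgue_measure]_s f (s, w)))%E; last first.
  apply/funext => w; rewrite /total_reward /Rintegral integral_mkcond/=.
  congr fine; apply: eq_integral => s _; rewrite patchE /f.
  have fE x : \1_(B x) (s, w) = ((s \in [set s : R | 0 <= s /\
      (s%:E < termination_time (J ^~ w))%E]) && (J s w == Some x))%:R :> R.
    rewrite indicE; congr (_%:R); congr nat_of_bool.
    apply/idP/andP => [/set_mem[s0 st Js]|[/set_mem[s0 st] /eqP Js]].
      by split; [exact/mem_set|rewrite Js].
    exact/mem_set.
  under eq_bigr do rewrite fE.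
  case: ifPn => _ /=; last by rewrite big1// => x _; rewrite mulr0.
  case: (J s w) => [x|]; last by rewrite big1// => x _; rewrite mulr0.
  rewrite (bigD1 x)//= eqxx mulr1 big1 ?addr0// => y yx.
  rewrite [X in (nat_of_bool X)%:R](_ : _ = false) ?mulr0//.
  by apply/eqP => -[xy]; rewrite xy eqxx in yx.
apply: (measurableT_comp (fine_measurable measurableT)).
apply: measurable_fun_fubini_tonelli_G.
  apply/measurable_EFinP; apply: measurable_sum => x.
  by apply: measurable_funM => //; apply: measurable_indic; exact: mB.
by move=> y; rewrite lee_fin sumr_ge0// => x _; rewrite mulr_ge0// indicE.
Qed.

Lemma total_reward_ge0 (r : 'rV[R]_p) (Js : R -> option 'I_p) :
  (forall c, 0 <= r 0 c) -> 0 <= total_reward r Js.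
Proof.
by move=> r0; apply: Rintegral_ge0 => s _; case: (Js s) => /=.
Qed.

End measurable_reward.

(** * Almost sure regularity of trajectories *)

Section null_paths.
Context {R : realType} {d : measure_display} {T : measurableType d}.
Variables (P : probability T R) (U : finType) (M : nat -> T -> U).
Hypothesis mM : measurable_states M.

Lemma prob_path_split n s (B : set T) : measurable B ->
  fine (P (path_event M n s `&` B)) =
  \sum_x fine (P (path_event M n.+1 (extend s n x) `&` B)).
Proof.
move=> mB; have mI n' s' : measurable (path_event M n' s' `&` B).
  by apply: measurableI => //; exact: measurable_path_event.
rewrite -Rintegral_indic//; under eq_Rintegral do rewrite -indicM.
rewrite Rintegral_path_split//; last exact: bounded01_indic.
by apply: eq_bigr => x _; under eq_Rintegral do rewrite indicM; rewrite Rintegral_indic.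
Qed.

Lemma prob_start_split (B : set T) : measurable B ->
  fine (P B) = \sum_x fine (P (path_event M 0 (fun=> x) `&` B)).
Proof.
move=> mB; have mI x : measurable (path_event M 0 (fun=> x) `&` B).
  by apply: measurableI => //; exact: measurable_path_event.
rewrite -Rintegral_indic//.
have ind w : \1_B w = \sum_x \1_(path_event M 0 (fun=> x) `&` B) w :> R.
  rewrite (bigD1 (M 0%N w))//= big1 ?addr0 => [|x xM].
    by rewrite !indicE in_setI [X in X && _]mem_set// path_event0.
  by rewrite indicE path_event0 memNset// => -[/= Mx]; rewrite Mx eqxx in xM.
under eq_Rintegral do rewrite ind.
rewrite Rintegral_sum => [|x]; last exact: bounded01_indic.
by apply: eq_bigr => x _; rewrite Rintegral_indic.
Qed.

(** Reduces an almost sure claim to one computation for each path of length [n], on which the laws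
    of the chain and of the holding times are explicit. *)
Lemma null_of_paths n (B : set T) : measurable B ->
  (forall s, P (path_event M n s `&` B) = 0%E) -> P B = 0%E.
Proof.
move=> mB; elim: n => [|n IH] B0; last first.
  apply: IH => s; rewrite -measurable_fin_prob; last first.
    by apply: measurableI => //; exact: measurable_path_event.
  by rewrite prob_path_split// big1// => x _; rewrite B0.
rewrite -measurable_fin_prob// prob_start_split// big1// => x _.
by rewrite B0.
Qed.

End null_paths.

Section jump_process_ae.
Context {R : realType} {d : measure_display} {T : measurableType d}.
Variables (P : probability T R) (p : nat) (v : 'rV[R]_p) (S : 'M[R]_p).
Variables (Z : nat -> T -> option 'I_p) (W : nat -> T -> \bar R).
Hypothesis hS : subintensity S.
Hypothesis hv : probability_vector v.
Hypothesis hZ : terminating_chain P v (jump_mx S) Z.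
Hypotheses (mW : forall i, measurable_fun setT (W i))
  (W0 : forall i w, (0 <= W i w)%E).
Hypothesis hW : exponential_holdings P S Z W.
Local Notation jump_time i w := (\sum_(0 <= j < i) W j w)%E.

Let mZ : measurable_states Z. Proof. by case: hZ. Qed.

Let mZP n (Q : option 'I_p -> bool) : measurable [set w | Q (Z n w)].
Proof.
rewrite [X in measurable X](_ : _ = \bigcup_(x in [set x | Q x]) [set w | Z n w = x]).
  by apply: fin_bigcup_measurable => // x _; exact: mZ.
by apply/seteqP; split => w /=; [move=> h; exists (Z n w)|move=> [x Qx ->]].
Qed.

Let mW1 k x : measurable [set w | W k w = x].
Proof.
rewrite [X in measurable X](_ : _ = setT `&` W k @^-1` [set x]); last by rewrite setTI.
exact: mW.
Qed.

(** An infinite holding time exceeds every threshold [t], so at a positive rate its probability is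
    below an exponential in [t]. The bound exp y >= 1 + y makes a single well-chosen [t]
    sufficient. *)
Lemma ae_holding_infinite k : {ae P, forall w, W k w = +oo%E -> rate S (Z k w) = 0}.
Proof.
pose B := [set w | W k w = +oo%E] `&` [set w | rate S (Z k w) != 0].
have mB : measurable B by apply: measurableI => //; exact: (mZP k (fun x => rate S x != 0)).
exists B; split => //; last first.
  by move=> w /=; move/not_implyP => [Wk /eqP rk].
apply: (null_of_paths mZ (n := k) mB) => s.
have [sk|sk] := eqVneq (rate S (s k)) 0.
  rewrite (_ : _ `&` B = set0) ?measure0//; apply/seteqP; split => w //= [h [_]].
  by rewrite /= h// sk eqxx.
have rk : 0 < rate S (s k) by rewrite lt_neqAle eq_sym sk rate_ge0.
have mpB : measurable (path_event Z k s `&` B).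
  by apply: measurableI => //; exact: measurable_path_event.
have bound t : 0 <= t ->
    fine (P (path_event Z k s `&` B)) * (1 + rate S (s k) * t) <= 1.
  move=> t0; have e0 : 0 < 1 + rate S (s k) * t.
    by rewrite ltr_wpDr// mulr_ge0// ltW.
  rewrite -ler_pdivlMr// mul1r.
  (* The threshold -1 imposes nothing on the other holding times. *)
  pose u i : R := if i == k then t else -1.
  have mt := measurable_holding_tails mW k u.
  apply: (@le_trans _ _ (fine (P (path_event Z k s `&`
      [set w | forall i, (i <= k)%N -> ((u i)%:E < W i w)%E])))).
    rewrite -lee_fin !measurable_fin_prob//; last first.
      by apply: measurableI => //; exact: measurable_path_event.
    apply: le_measure; rewrite ?inE//.
      by apply: measurableI => //; exact: measurable_path_event.
    move=> w [hp [Wk _]]; split => // i ik; rewrite /u; case: eqP => [->|_].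
      by rewrite Wk ltry.
    by rewrite (lt_le_trans _ (W0 i w))// lte_fin ltrN10.
  rewrite (holding_tails hZ mW hW) -measurable_fin_prob; last first.
    exact: measurable_path_event.
  rewrite -EFinM/= big_nat_recr//= big_nat big1 ?mul1r; last first.
    move=> i /andP[_ ik]; rewrite /u ltn_eqF// max_l ?lerN10// mulr0 oppr0.
    exact: expR0.
  rewrite /u eqxx max_r// expRN.
  apply: (@le_trans _ _ (1 * (expR (rate S (s k) * t))^-1)).
    rewrite ler_wpM2r ?invr_ge0 ?expR_ge0//.
    rewrite -lee_fin measurable_fin_prob; last exact: measurable_path_event.
    by apply: probability_le1; exact: measurable_path_event.
  by rewrite mul1r lef_pV2 ?posrE ?expR_gt0// expR_ge1Dx.
rewrite -measurable_fin_prob//; congr EFin.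
set x := fine _ in bound *.
have x0 : 0 <= x by rewrite fine_ge0.
apply/eqP; rewrite eq_le x0 andbT leNgt; apply/negP => xp.
(* At t = 1 / (x * rate) the bound reads x + 1 <= 1. *)
have := bound (x * rate S (s k))^-1; rewrite invr_ge0 mulr_ge0 ?(ltW rk)// => /(_ isT).
rewrite mulrDr mulr1 mulrA divff ?gt_eqF ?mulr_gt0//.
by lra.
Qed.

Lemma ae_rate0_absorbing k :
  {ae P, forall w, rate S (Z k w) = 0 -> Z k.+1 w = Z k w}.
Proof.
pose B := [set w | rate S (Z k w) = 0 /\ Z k.+1 w <> Z k w].
have mB : measurable B.
  rewrite [X in measurable X](_ : _ = \bigcup_(x in [set x | rate S x == 0])
      ([set w | Z k w = x] `\` [set w | Z k.+1 w = x])).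
    by apply: fin_bigcup_measurable => // x _; apply: measurableD; exact: mZ.
  apply/seteqP; split => w /=.
    by move=> [rk Zk]; exists (Z k w) => //=; rewrite rk.
  by move=> [x /eqP rx [Zx Zkx]]; rewrite /B /= Zx.
exists B; split => //; last by move=> w /=; move/not_implyP.
apply: (null_of_paths mZ (n := k.+1) mB) => s.
have mp : measurable (path_event Z k.+1 s) by exact: measurable_path_event.
have [rk|rk] := eqVneq (rate S (s k)) 0; last first.
  rewrite (_ : _ `&` B = set0) ?measure0//; apply/seteqP; split => w //= [h [rk0 _]].
  by rewrite h// in rk0; rewrite rk0 eqxx in rk.
have [sk|sk] := eqVneq (s k.+1) (s k).
  rewrite (_ : _ `&` B = set0) ?measure0//; apply/seteqP; split => w //= [h [_]].
  by rewrite !h// sk.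
apply: (@subset_measure0 _ _ _ P _ (path_event Z k.+1 s)) => //.
  exact: measurableI.
have [_ _ hZS] := hZ; rewrite [LHS]hZS [X in (_ * X%:E)%E](_ : _ = 0) ?mule0//.
case: (s k) (s k.+1) rk sk => [i|] [j|]//= /eqP; rewrite ?oppr_eq0 => /eqP Sii.
- move=> ji; rewrite mxE Sii eqxx; case: eqP => // ij.
  by rewrite ij eqxx in ji.
- by rewrite jump_mx_row_absorbing// subrr.
Qed.

Lemma ae_holding_positive k : {ae P, forall w, (0 < W k w)%E}.
Proof.
pose B := [set w | W k w = 0%E].
have mB : measurable B by exact: mW1.
exists B; split => //; last first.
  by move=> w /=; move/negP; rewrite -leNgt => Wk; apply/eqP; rewrite eq_le Wk W0.
apply: (null_of_paths mZ (n := k) mB) => s.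
have mp : measurable (path_event Z k s) by exact: measurable_path_event.
have mC := measurable_holding_tails mW k (fun=> 0).
apply: (@subset_measure0 _ _ _ P _ (path_event Z k s `\`
  [set w | forall i, (i <= k)%N -> (0%:E < W i w)%E])).
- exact: measurableI.
- exact: measurableD.
- by move=> w [hp Bw]; split => // /(_ k (leqnn k)); rewrite Bw ltxx.
rewrite measureD//; last by rewrite (le_lt_trans (probability_le1 P mp))// ltry.
rewrite [X in (_ - X)%E](@hW k s (fun=> 0))//.
rewrite big1 ?mule1; last by move=> i _; rewrite mulr0 oppr0 expR0.
by rewrite subee// fin_num_measure.
Qed.

Lemma ae_start_alive : {ae P, forall w, Z 0%N w <> None}.
Proof.
exists [set w | Z 0%N w = None]; split; first exact: mZ.
  by case: hZ => _ ->.
by move=> w /= /contrapT.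
Qed.

(* Until the explosion time the discounted reward at rate 1 stays away from 0,
   whereas its mean on survival decreases geometrically. *)
Lemma ae_no_explosion (m : nat) : {ae P, forall w,
  ~ (forall i, Z i w <> None /\ (jump_time i w <= m%:R%:E)%E)}.
Proof.
pose B := [set w | forall i, Z i w <> None /\ (jump_time i w <= m%:R%:E)%E].
have mB : measurable B.
  rewrite [X in measurable X](_ : _ = \bigcap_i (~` [set w | Z i w = None] `&`
      [set w | (jump_time i w <= m%:R%:E)%E])).
    apply: bigcapT_measurable => i; apply: measurableI; first exact: measurableC.
    rewrite -[X in measurable X]setTI; apply: measurable_lee => //.
    exact: emeasurable_sum.
  by apply/seteqP; split => w /= h i; [move=> _|]; apply: h.
exists B; split => //; last by move=> w /= /contrapT.
pose th : 'rV[R]_p := const_mx 1.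
have th0 : nneg_mx th by move=> i j; rewrite mxE.
(* [L] dominates every rate, and the discount at reward rate 1 increases with the rate, so [delta]
   bounds all discounts and is below 1. *)
pose L := \sum_i - S i i; pose delta := 1 - (L + 1)^-1.
have Sii0 i : 0 <= - S i i by rewrite oppr_ge0 subintensity_diag.
have L0 : 0 <= L by rewrite sumr_ge0.
have disc_le i : discount S th i <= delta.
  rewrite /discount /delta mxE div1r lerD2l lerN2 lef_pV2 ?posrE ?ltr_wpDl//.
  by rewrite lerD2r /L (bigD1 i)//= lerDl sumr_ge0.
have delta0 : 0 <= delta.
  by rewrite subr_ge0 invf_le1 ?lerDr// ltr_wpDl.
have delta1 : `|delta| < 1.
  by rewrite ger0_norm// /delta ltrBlDr ltrDl invr_gt0 ltr_wpDl.
have [v0 v1] := hv.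
(* On [B] the holding times up to [N] add up to at most [m], and [B] is contained in [survive N]. *)
have bound N : expR (- m%:R) * fine (P B) <= delta ^+ N.+1.
  apply: le_trans (survive_discounted hS hZ mW W0 hW th0 N disc_le delta0 v0 v1).
  have bd : bounded01 (discounted_reward Z W th N.+1).
    exact: (bounded01_discounted_reward hZ).
  have msurv := measurable_survive hZ N.
  rewrite -Rintegral_indic// -RintegralZl//; last first.
    by apply: bounded01_integrable; exact: bounded01_indic.
  apply: le_Rintegral => //.
  - have := bounded01_integrable P (bounded01_indic mB).
    by move=> /(integrableZl measurableT (expR (- m%:R))).
  - by apply: bounded01_integrable; apply: bounded01M => //; exact: bounded01_indic.
  move=> w _; rewrite indicE; have [/set_mem Bw|_] := boolP (w \in B); last first.
    rewrite mulr0 mulr_ge0//.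
    by have /andP[] := bd.2 w.
  rewrite mulr1 indicE mem_set ?mul1r; last by move=> i _; case: (Bw i).
  have Wfin i : W i w \is a fin_num.
    rewrite ge0_fin_numE//; apply: le_lt_trans (ltry m%:R).
    have [_] := Bw i.+1; rewrite big_nat_recr//=; apply: le_trans.
    by rewrite leeDr// sume_ge0.
  rewrite /discounted_reward (eq_big_nat _ _ (F2 := fun i => expR (- fine (W i w)))).
    rewrite -expR_sum ler_expR sumrN lerN2 -lee_fin -sumEFin.
    under eq_bigr do rewrite fineK//.
    by have [_] := Bw N.+1.
  move=> i _; have [Zi _] := Bw i; case: (Z i w) Zi => // j _.
  by rewrite /= mxE mul1e -{1}(fineK (Wfin i)).
rewrite -measurable_fin_prob//; congr EFin; apply/eqP; rewrite eq_le fine_ge0// andbT.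
rewrite -(pmulr_rle0 _ (expR_gt0 (- m%:R))).
have := cvg_expr delta1; rewrite -cvg_shiftS => lim0.
have <- := cvg_lim (@Rhausdorff R) lim0.
by apply: limr_ge; [apply: cvgP; exact: lim0|exact: nearW].
Qed.

End jump_process_ae.

Lemma nneseries_single (R : realType) (f : nat -> \bar R) (N : nat) :
  (forall k, k != N -> f k = 0%E) -> (\sum_(0 <= k <oo) f k = f N)%E.
Proof.
move=> f0; apply/cvg_lim => //; apply: cvg_near_cst; near=> n.
have Nn : (N < n)%N by near: n; exact: nbhs_infty_gt.
rewrite (bigD1_seq N) ?mem_index_iota ?iota_uniq//= big1_seq ?adde0// => k.
by case/andP => /f0.
Unshelve. all: by end_near. Qed.

(** * Transform of the total rewards *)

Section jump_process_laplace.
Context {R : realType} {d : measure_display} {T : measurableType d}.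
Variables (P : probability T R) (p : nat) (v : 'rV[R]_p) (S : 'M[R]_p).
Variables (Z : nat -> T -> option 'I_p) (W : nat -> T -> \bar R)
  (J : R -> T -> option 'I_p).
Local Notation jump_time i w := (\sum_(0 <= j < i) W j w)%E.
Hypothesis hS : subintensity S.
Hypothesis hv : probability_vector v.
Hypothesis hZ : terminating_chain P v (jump_mx S) Z.
Hypotheses (mW : forall i, measurable_fun setT (W i))
  (W0 : forall i w, (0 <= W i w)%E).
Hypothesis hW : exponential_holdings P S Z W.
Hypothesis J_jump : forall w (t : R) (i : nat), 0 <= t ->
  (jump_time i w <= t%:E < jump_time i.+1 w)%E -> J t w = Z i w.
Hypothesis J_explosion : forall w (t : R), 0 <= t ->
  (forall i, jump_time i w <= t%:E)%E -> J t w = None.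

Let mZ : measurable_states Z. Proof. by case: hZ. Qed.

(** The almost sure properties of the holding times gathered in one event, on which the remaining
    arguments are pathwise. *)
Definition regular w := forall k, [/\ W k w = +oo%E -> rate S (Z k w) = 0,
  rate S (Z k w) = 0 -> Z k.+1 w = Z k w & (0 < W k w)%E].

Lemma ae_regular : {ae P, forall w, regular w}.
Proof.
apply/ae_foralln => k.
have h1 := ae_holding_infinite hS hZ mW W0 hW k.
have h2 := ae_rate0_absorbing hZ k.
have h3 := ae_holding_positive hZ mW W0 hW k.
by apply: filterS3 h1 h2 h3 => w.
Qed.

(** An infinite holding time forces rate 0, and from a state of rate 0 a regular chain never moves,
    which contradicts its later death. *)
Lemma hit_holding_fin N w : regular w -> hit Z N w ->
  forall i, (i < N.+1)%N -> W i w \is a fin_num.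
Proof.
move=> reg [al dead] i iN; rewrite ge0_fin_numE// ltey; apply/eqP => Wi.
have [/(_ Wi) ri _ _] := reg i.
have stuck j : Z (i + j)%N w = Z i w.
  elim: j => [|j IH]; first by rewrite addn0.
  have [_ h _] := reg (i + j)%N.
  by rewrite addnS h// IH.
by apply: (al i iN); rewrite -(stuck (N.+1 - i)%N) subnKC// ltnW.
Qed.

Lemma hit_unique N N' w : hit Z N w -> hit Z N' w -> N = N'.
Proof.
wlog NN' : N N' / (N <= N')%N => [h|[_ dead] [al' _]].
  by have [/h//|/ltnW/h h1 h2 h3] := leqP N N'; rewrite (h1 h3 h2).
apply/eqP; rewrite eqn_leq NN' leqNgt; apply/negP => lt.
exact: (al' _ lt).
Qed.

(** A dead process either has its chain in the cemetery or has exploded; explosion with a living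
    chain is null. The chain starts alive, so its first visit to the cemetery is at a positive
    index. *)
Lemma ae_hit : {ae P, forall w, (termination_time (J ^~ w) < +oo)%E} ->
  {ae P, forall w, exists N, hit Z N w}.
Proof.
move=> term; have expl : {ae P, forall w, forall m,
    ~ (forall i, Z i w <> None /\ (jump_time i w <= m%:R%:E)%E)}.
  by apply/ae_foralln => m; exact: (ae_no_explosion hS hv hZ mW W0 hW).
have start := ae_start_alive hZ.
apply: filterS3 term expl start => w termw explw startw.
suff [i Zi] : exists i, Z i w = None.
  have ex : exists i, Z i w == None by exists i; rewrite Zi.
  case: (ex_minnP ex) => n /eqP Zn minN; case: n Zn minN => [//|N] ZN minN.
  exists N; split; last exact: ZN.
  move=> j jN Zj.
  by have := minN j (introT eqP Zj); rewrite leqNgt ltnS jN.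
have [t [t0 Jt]] : exists t, 0 <= t /\ J t w = None.
  apply: contrapT => /forallNP none; move: termw; rewrite /termination_time.
  rewrite [X in ereal_inf X](_ : _ = set0) ?ereal_inf0 ?ltxx//.
  by apply/seteqP; split => // x [s sP _]; case: (none s).
have [[i ti]|ti] := jump_cases W w t0; first by exists i; rewrite -(J_jump t0 ti).
(* Explosion before [t] is explosion before an integer, which keeps the exceptional sets countably
   many. *)
apply: contrapT => /forallNP alive; apply: (explw (Num.truncn t).+1) => i.
split; first exact: alive.
by rewrite (le_trans (ti i))// lee_fin ltW// truncnS_gt.
Qed.

Lemma ae_hit_termination : {ae P, forall w, exists N, hit Z N w} ->
  {ae P, forall w, (termination_time (J ^~ w) < +oo)%E}.
Proof.
move=> hits; apply: filterS2 hits ae_regular => w [N hN] reg.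
have [_ _ WN] := reg N.+1.
have r0 c : 0 <= (0 : 'rV[R]_p) 0 c by rewrite mxE.
by have [] := discounted_path W0 J_jump (N := N.+1) r0 hN.1 hN.2
  (hit_holding_fin reg hN) WN.
Qed.

Section laplace.
Variables (r1 r2 : 'rV[R]_p).
Hypotheses (r10 : nneg_mx r1) (r20 : nneg_mx r2).
Let th i j : 'rV[R]_p := i%:R *: r1 + j%:R *: r2.

Let th0 i j : nneg_mx (th i j).
Proof. by move=> k l; rewrite !mxE addr_ge0// mulr_ge0. Qed.

Lemma hit_discounted_reward i j N w : regular w -> hit Z N w ->
  laplace_integrand (total_reward r1 (J ^~ w), total_reward r2 (J ^~ w)) i j =
  discounted_reward Z W (th i j) N.+1 w.
Proof.
move=> reg hN; have Wfin := hit_holding_fin reg hN.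
have [_ _ WN] := reg N.+1.
have [_ E1] := discounted_path W0 J_jump (N := N.+1) (r10 0) hN.1 hN.2 Wfin WN.
have [_ E2] := discounted_path W0 J_jump (N := N.+1) (r20 0) hN.1 hN.2 Wfin WN.
rewrite /laplace_integrand/= E1 E2 -!expRM_natl -expRD /discounted_reward.
rewrite [RHS](eq_big_nat _ _
  (F2 := fun k => expR (- (reward_of (th i j) (Z k w) * fine (W k w))))).
  rewrite -expR_sum; congr expR; rewrite !mulrN -opprD sumrN; congr (- _).
  rewrite !mulr_sumr -big_split/=; apply: eq_bigr => k _.
  by case: (Z k w) => [c|] /=; rewrite ?mxE; ring.
by move=> k kN; rewrite -{1}(fineK (Wfin k kN)).
Qed.

(** The events [hit N] are disjoint and cover almost every outcome, so the mean is the sum of the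
    means on them, and each of these is a Neumann term. *)
Lemma laplace_total_reward i j : {ae P, forall w, exists N, hit Z N w} ->
  (\int[P]_w (laplace_integrand
     (total_reward r1 (J ^~ w), total_reward r2 (J ^~ w)) i j)%:E =
   ((v *m laplace_vec S (th i j)) 0 0)%:E)%E.
Proof.
move=> hits; have [v0 _] := hv.
have v0' : nneg_mx v by move=> k l; rewrite ord1.
rewrite -(nneseries_laplace hS (th0 i j) v0').
under eq_eseriesr do rewrite -(hit_discounted hS hZ mW W0 hW (th0 i j)).
have bd N : bounded01 (fun w => \1_(hit Z N) w *
    discounted_reward Z W (th i j) N.+1 w).
  apply: bounded01M; last exact: (bounded01_discounted_reward hZ).
  by apply: bounded01_indic; exact: (measurable_hit hZ).
under eq_eseriesr do rewrite -Rintegral_EFin//.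
rewrite -integral_nneseries//; last 2 first.
- by move=> N; apply/measurable_EFinP; case: (bd N).
- by move=> N w _; rewrite lee_fin; case: (bd N) => _ /(_ w)/andP[].
have mtr (r : 'rV[R]_p) : nneg_mx r ->
    measurable_fun setT (fun w => total_reward r (J ^~ w)).
  move=> r0; exact: (measurable_total_reward mZ mW W0 J_jump J_explosion (r0 0)).
apply: ge0_ae_eq_integral => //.
- apply/measurable_EFinP; apply: measurable_funM; apply: measurable_funX;
    apply: (measurableT_comp (@measurable_expR R)); apply: measurableT_comp => //;
    exact: mtr.
- apply: ge0_emeasurable_sum => [N w _ _|N _].
    by rewrite lee_fin; case: (bd N) => _ /(_ w)/andP[].
  by apply/measurable_EFinP; case: (bd N).
- by move=> w _; rewrite lee_fin mulr_ge0// exprn_ge0// expR_ge0.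
- move=> w _; apply: nneseries_ge0 => N _ _.
  by rewrite lee_fin; case: (bd N) => _ /(_ w)/andP[].
apply: filterS2 hits ae_regular => w [N hN] reg _.
rewrite (nneseries_single (N := N)) => [|k kN].
  by rewrite indicE mem_set// mul1r (hit_discounted_reward _ _ reg hN).
rewrite indicE memNset ?mul0r// => hk.
by rewrite (hit_unique hk hN) eqxx in kN.
Qed.

End laplace.

(** Without rewards every discount is 1 and the [N]-th Neumann term is the probability of [hit N];
    the value 1 says that these events exhaust the space up to a null set. *)
Lemma ae_hit_laplace0 : (v *m laplace_vec S 0) 0 0 = 1 ->
  {ae P, forall w, exists N, hit Z N w}.
Proof.
move=> L1; have [v0 _] := hv.
have v0' : nneg_mx v by move=> k l; rewrite ord1.
have mU : measurable (\bigcup_N hit Z N).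
  by apply: bigcupT_measurable => N; exact: (measurable_hit hZ).
have th0 : nneg_mx (0 : 'rV[R]_p) by move=> k l; rewrite mxE.
have PU : P (\bigcup_N hit Z N) = 1%E.
  rewrite measure_semi_bigcup//; last 2 first.
  - by move=> N; exact: (measurable_hit hZ).
  - apply/trivIsetP => N N' _ _ NN'; apply/seteqP; split => // w [hN hN'].
    by rewrite (hit_unique hN hN') eqxx in NN'.
  rewrite -[1%E]/(1%:E) -L1 -(nneseries_laplace hS th0 v0').
  apply: eq_eseriesr => N _; rewrite -(hit_discounted hS hZ mW W0 hW th0).
  rewrite /= -measurable_fin_prob; last exact: (measurable_hit hZ).
  rewrite -Rintegral_indic; last exact: (measurable_hit hZ).
  congr EFin; apply: eq_Rintegral => w _; rewrite /discounted_reward.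
  rewrite big1 ?mulr1// => k _; rewrite [reward_of _ _](_ : _ = 0).
    by rewrite mul0e /= oppr0 expR0.
  by case: (Z k w) => //= c; rewrite mxE.
exists (~` \bigcup_N hit Z N); split; first exact: measurableC.
  by rewrite probability_setC// PU subee.
by move=> w /= h [N _ hN]; apply: h; exists N.
Qed.

End jump_process_laplace.

(** * Construction of a Markov jump process *)

(** Only the tail is exported: it is all that the construction reads off the exponential law. *)
Lemma unit_exponential (R : realType) : exists E : probability (measurableTypeR R) R,
  forall a, 0 <= a -> E [set s | a < s] = (expR (- a))%:E.
Proof.
have [E EE] : exists E : probability (measurableTypeR R) R,
    (E : set R -> \bar R) = exponential_prob 1.
  by exists (exponential_distribution_exponential_prob__canonical__probability_measure_Probability
    (@ltr01 R)).
exists E => a a0; have mle : measurable [set s : R | s <= a].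
  by rewrite [X in measurable X](_ : _ = `]-oo, a]%classic).
rewrite (_ : [set s | a < s] = ~` [set s | s <= a]); last first.
  by apply/seteqP; split => s /=; rewrite ltNge => /negP.
rewrite probability_setC//.
have -> : E [set s | s <= a] = (1 - (expR (- a))%:E)%E.
  rewrite EE /exponential_prob.
  transitivity (\int[lebesgue_measure]_(s in `[0%R, a]) (exponential_pdf 1 s)%:E)%E.
    rewrite integral_mkcond [RHS]integral_mkcond; apply: eq_integral => s _.
    have ma : (s \in [set s | s <= a]) = (s <= a).
      by apply/idP/idP => [/set_mem//|h]; exact/mem_set.
    have mi : (s \in `[0%R, a]%classic) = (0 <= s <= a).
      by rewrite mem_setE in_itv.
    rewrite !patchE ma mi; have [//|s0] := leP 0 s.
    by rewrite lt0_exponential_pdf//= if_same.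
  move: a0; rewrite le_eqVlt => /predU1P[<-|a0].
    by rewrite set_itv1 integral_set1 oppr0 expR0 -EFinB subrr.
  by have := exponential_prob_itv0c 1 a0; rewrite /exponential_prob /= mulN1r => ->.
by rewrite -!EFinB; congr EFin; ring.
Qed.

Section sequence_space.
Context {R : realType} {p : nat}.

Definition path_cylinders : set (set (nat -> option 'I_p * measurableTypeR R)) :=
  [set B | exists i x A, measurable A /\
    B = [set om | (om i).1 = x /\ A (om i).2]].

Definition path_space := g_sigma_algebraType path_cylinders.

Definition path_cons (x : option 'I_p) (y : measurableTypeR R * path_space) : path_space :=
  fun i => if i is j.+1 then y.2 j else (x, y.1).

Lemma measurable_cylinder i x (A : set (measurableTypeR R)) : measurable A ->
  measurable [set om : path_space | (om i).1 = x /\ A (om i).2].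
Proof. by move=> mA; apply: sub_sigma_algebra; exists i, x, A. Qed.

Lemma measurable_path_cons x : measurable_fun setT (path_cons x).
Proof.
apply: (@measurability _ _ _ path_space setT (path_cons x) path_cylinders) => //.
move=> _ [_ [i [z [A [mA ->]]]] <-]; rewrite setTI; case: i => [|i].
  have [<-|xz] := eqVneq x z; last first.
    rewrite (_ : _ @^-1` _ = set0)//; apply/seteqP; split => // y [/= xz'].
    by rewrite xz' eqxx in xz.
  rewrite (_ : _ @^-1` _ = A `*` setT); first exact: measurableX.
  by apply/seteqP; split => y /= [].
rewrite (_ : _ @^-1` _ =
  setT `*` [set om : path_space | (om i).1 = z /\ A (om i).2]).
  by apply: measurableX => //; exact: measurable_cylinder.
by apply/seteqP; split => y /= => [|[]].
Qed.

End sequence_space.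
Arguments path_space : clear implicits.

Section path_measures.
Context {R : realType} {p : nat}.
Local Notation Om := (path_space R p).
Variables (E : probability (measurableTypeR R) R)
  (m : option 'I_p -> {finite_measure set Om -> \bar R}).

(** The absolute value makes this a measure for every [c]; it disappears on the nonnegative weights
    used below. *)
Definition mixture (c : option 'I_p -> R) (A : set Om) : \bar R :=
  (\sum_x `|c x|%:E * m x A)%E.

Section mixture.
Variable c : option 'I_p -> R.
Let mixture0 : mixture c set0 = 0%E.
Proof. by rewrite /mixture big1// => x _; rewrite measure0 mule0. Qed.

Let mixture_ge0 A : (0 <= mixture c A)%E.
Proof. by apply: sume_ge0 => x _; rewrite mule_ge0// lee_fin. Qed.

Let mixture_sigma_additive : semi_sigma_additive (mixture c).
Proof.
move=> F mF tF mUF; rewrite [X in _ --> X](_ : _ =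
    (\sum_(0 <= k <oo) mixture c (F k))%E).
  by apply: is_cvg_ereal_nneg_natsum => k _; exact: mixture_ge0.
rewrite /mixture nneseries_sum; last by move=> *; rewrite mule_ge0// lee_fin.
apply: eq_bigr => x _; rewrite nneseriesZl//; congr (_ * _)%E.
exact: measure_semi_bigcup.
Qed.

HB.instance Definition _ := isMeasure.Build _ _ _ (mixture c)
  mixture0 mixture_ge0 mixture_sigma_additive.

Let mixture_fin : fin_num_fun (mixture c).
Proof.
move=> A mA; apply/sum_fin_numP => x _ _.
by rewrite fin_numM// fin_num_measure.
Qed.

HB.instance Definition _ := Measure_isFinite.Build _ _ _ (mixture c) mixture_fin.

Variable x : option 'I_p.

(** With [c] the transition row of [x]: a holding variable drawn from [E] is attached to [x], and
    the remaining trajectory is drawn from [m y] with weight [c y]. *)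
Definition prepend (A : set Om) : \bar R :=
  (E \x mixture c)%E (path_cons x @^-1` A).

Let mcons (A : set Om) : measurable A -> measurable (path_cons x @^-1` A).
Proof.
by move=> mA; rewrite -[X in measurable X]setTI; exact: measurable_path_cons.
Qed.

Let prepend0 : prepend set0 = 0%E.
Proof. by rewrite /prepend preimage_set0 measure0. Qed.

Let prepend_ge0 A : (0 <= prepend A)%E.
Proof. exact: measure_ge0. Qed.

Let prepend_sigma_additive : semi_sigma_additive prepend.
Proof.
move=> F mF tF mUF; rewrite /prepend preimage_bigcup.
apply: measure_semi_sigma_additive.
- by move=> n; exact: mcons.
- apply/trivIsetP => /= i j _ _ ij; rewrite -preimage_setI.
  by move/trivIsetP : tF => /(_ _ _ _ _ ij) ->//; rewrite preimage_set0.
- by rewrite -preimage_bigcup; exact: mcons.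
Qed.

HB.instance Definition _ := isMeasure.Build _ _ _ prepend
  prepend0 prepend_ge0 prepend_sigma_additive.

Lemma prependE (A : set Om) B C : measurable B -> measurable C ->
  path_cons x @^-1` A = B `*` C ->
  prepend A = (E B * mixture c C)%E.
Proof. by move=> mB mC AE; rewrite /prepend AE product_measure1E. Qed.

Let prepend_fin : fin_num_fun prepend.
Proof.
apply: lty_fin_num_fun; rewrite [X in (X < _)%E](@prependE setT setT setT)//.
  by rewrite probability_setT mul1e; have := fin_num_measure (mixture c) setT;
     rewrite ge0_fin_numE// => /(_ measurableT).
by rewrite setXTT preimage_setT.
Qed.

HB.instance Definition _ := Measure_isFinite.Build _ _ _ prepend prepend_fin.

End mixture.
End path_measures.

Lemma nneseries_shift (R : realType) (f : nat -> \bar R) :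
  (forall k, (0 <= f k)%E) -> f 0%N = 0%E ->
  (\sum_(0 <= k <oo) f k = \sum_(0 <= k <oo) f k.+1)%E.
Proof.
move=> f0 f00; apply/cvg_lim => //; rewrite -cvg_shiftS.
under eq_fun do rewrite big_nat_recl// f00 add0e.
by apply: is_cvg_nneseries => k _ _.
Qed.

(** * Measures on trajectories *)

Section path_law.
Context {R : realType} {p : nat}.
Local Notation Om := (path_space R p).
Variables (S : 'M[R]_p) (E : probability (measurableTypeR R) R).
Hypothesis hS : subintensity S.
Hypothesis hE : forall a, 0 <= a -> E [set s | a < s] = (expR (- a))%:E.

Definition dead_path : Om := fun=> (None, 0).

(* [terminating_law N x]: the law of the path from [x], restricted to the event
   that it dies at step [N]. *)
Fixpoint terminating_law (N : nat) : option 'I_p ->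
    {finite_measure set Om -> \bar R} :=
  if N is N'.+1 then fun x =>
    if x is Some i
    then prepend E (terminating_law N') (trans_prob (jump_mx S) x) x
    else mzero
  else fun x => if x is Some _ then mzero else dirac dead_path.

(** Summing over the step of death gives the law of the trajectories that eventually die. Its mass
    is the probability of dying, and may be less than 1 for some starting states. *)
Definition total_law (x : option 'I_p) (A : set Om) : \bar R :=
  (\sum_(0 <= N <oo) terminating_law N x A)%E.

Lemma total_law_ge0 x A : (0 <= total_law x A)%E.
Proof. by apply: nneseries_ge0 => N _ _; exact: measure_ge0. Qed.

Lemma total_law_none A : total_law None A = \d_dead_path A.
Proof. by rewrite /total_law (nneseries_split 0 1)//= big_nat1 eseries0 ?adde0// => -[]. Qed.

Lemma trans_jump_ge0 x y : 0 <= trans_prob (jump_mx S) x y.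
Proof.
case: x y => [i|] [j|] //=; first exact: jump_mx_ge0.
by rewrite subr_ge0; case: (jump_mx_subprobability hS).
Qed.

Lemma total_law_some i (A : set Om) B C : measurable B -> measurable C ->
  path_cons (Some i) @^-1` A = B `*` C ->
  total_law (Some i) A =
  (E B * \sum_y (trans_prob (jump_mx S) (Some i) y)%:E * total_law y C)%E.
Proof.
move=> mB mC AE; rewrite /total_law nneseries_shift => [|N|//]; last exact: measure_ge0.
under eq_eseriesr => N _ do
  rewrite /= (prependE _ _ _ mB mC AE) -(measurable_fin_prob E mB).
rewrite nneseriesZl; last by move=> N _; exact: measure_ge0.
rewrite measurable_fin_prob//; congr (_ * _)%E; rewrite /mixture nneseries_sum; last first.
  by move=> *; rewrite mule_ge0// lee_fin.
apply: eq_bigr => y _; rewrite nneseriesZl; last by move=> N _; exact: measure_ge0.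
by rewrite ger0_norm// trans_jump_ge0.
Qed.

(** The stored number is a rate-one exponential, rescaled by the state it accompanies. The
    truncation makes holding times nonnegative at every outcome, as the definition of a jump process
    demands. *)
Definition holding (x : option 'I_p) (r : R) : \bar R :=
  if rate S x == 0 then +oo%E else (Num.max 0 r / rate S x)%:E.

Definition Zc (i : nat) (om : Om) : option 'I_p := (om i).1.
Definition Wc (i : nat) (om : Om) : \bar R := holding (om i).1 (om i).2.

Definition tail_prob (x : option 'I_p) (t : R) : R :=
  if t < 0 then 1 else expR (- (rate S x * t)).

Let rate_ge0' x : 0 <= rate S x.
Proof. by case: x => //= i; rewrite oppr_ge0 subintensity_diag. Qed.

Lemma measurable_holding x : measurable_fun setT (holding x : measurableTypeR R -> \bar R).
Proof.
rewrite /holding; case: (rate S x == 0); first exact: measurable_cst.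
apply/measurable_EFinP; apply: measurable_funM => //; exact: measurable_maxr.
Qed.

Let tail_set x t := [set r : measurableTypeR R | (t%:E < holding x r)%E].

Let measurable_tail_set x t : measurable (tail_set x t).
Proof.
have := emeasurable_fun_o_infty measurableT (measurable_holding x) t%:E.
by rewrite setTI.
Qed.

Lemma tail_setE x t : E (tail_set x t) = (tail_prob x t)%:E.
Proof.
rewrite /tail_set /tail_prob /holding; have [rx|rx] := eqVneq (rate S x) 0.
  rewrite (_ : [set _ | _] = setT) ?probability_setT ?rx ?mul0r ?oppr0 ?expR0 ?if_same//.
  by apply/seteqP; split => // r _ /=; rewrite ltry.
have rp : 0 < rate S x by rewrite lt_neqAle eq_sym rx rate_ge0'.
have [t0|t0] := ltP t 0.
  rewrite (_ : [set _ | _] = setT) ?probability_setT//.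
  apply/seteqP; split => // r _ /=; rewrite lte_fin (lt_le_trans t0)//.
  by rewrite divr_ge0 ?rate_ge0'// le_max lexx.
have key (r : R) : (t%:E < (Num.max 0 r / rate S x)%:E)%E = (rate S x * t < r).
  rewrite lte_fin (ltr_pdivlMr _ _ rp) lt_max mulrC ltNge.
  by rewrite mulr_ge0// rate_ge0'.
rewrite -hE ?mulr_ge0 ?rate_ge0'//; congr (E _); apply/funext => r; congr is_true.
exact: key.
Qed.

Definition cyl n (s : nat -> option 'I_p) (t : nat -> R) : set Om :=
  path_event Zc n s `&` [set om | forall i, (i <= n)%N -> ((t i)%:E < Wc i om)%E].

Lemma measurable_Zc : measurable_states Zc.
Proof.
move=> i x; rewrite [X in measurable X](_ : _ =
  [set om : Om | (om i).1 = x /\ setT (om i).2]); first exact: measurable_cylinder.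
by apply/seteqP; split => om // [].
Qed.

Lemma measurable_Wc i : measurable_fun setT (Wc i).
Proof.
move=> _ A mA; rewrite setTI (_ : _ @^-1` _ = \bigcup_(x in [set: option 'I_p])
    [set om : Om | (om i).1 = x /\ (holding x @^-1` A) (om i).2]).
  apply: fin_bigcup_measurable => // x _; apply: measurable_cylinder.
  by rewrite -[X in measurable X]setTI; exact: measurable_holding.
apply/seteqP; split => om /=; first by move=> h; exists (om i).1.
by move=> [x _ [<-]].
Qed.

Lemma Wc_ge0 i om : (0 <= Wc i om)%E.
Proof.
rewrite /Wc /holding; case: ifP => // _.
by rewrite lee_fin divr_ge0 ?rate_ge0'// le_max lexx.
Qed.

Lemma measurable_cyl n s t : measurable (cyl n s t).
Proof.
apply: measurableI; first by apply: measurable_path_event; exact: measurable_Zc.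
exact: (measurable_holding_tails measurable_Wc).
Qed.

Lemma cons_cyl0 s t : path_cons (s 0%N) @^-1` cyl 0 s t =
  tail_set (s 0%N) (t 0%N) `*` setT.
Proof.
apply/seteqP; split => -[r om] /=; first by move=> [_ /(_ 0%N isT)].
by move=> [h _]; split => i; rewrite leqn0 => /eqP ->.
Qed.

Lemma cons_cylS n s t : path_cons (s 0%N) @^-1` cyl n.+1 s t =
  tail_set (s 0%N) (t 0%N) `*` cyl n (s \o succn) (t \o succn).
Proof.
apply/seteqP; split => -[r om] /=.
  move=> [hs ht]; split; first exact: (ht 0%N isT).
  by split => i ni; [exact: (hs i.+1 ni)|exact: (ht i.+1 ni)].
by move=> [h [hs ht]]; split => -[|i] ni //; [exact: hs|exact: ht].
Qed.

(** The empty set is written as a product so that [total_law_some] applies to it. *)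
Lemma cons_cyl_neq n x s t : x != s 0%N -> path_cons x @^-1` cyl n s t = set0 `*` setT.
Proof.
move=> xs; rewrite set0X; apply/seteqP; split => // y [/(_ 0%N isT)].
by rewrite /Zc /= => xs0; rewrite xs0 eqxx in xs.
Qed.

Definition path_weight n (s : nat -> option 'I_p) : R :=
  \prod_(0 <= i < n) trans_prob (jump_mx S) (s i) (s i.+1).

Lemma total_law_setT i : total_law (Some i) setT =
  (\sum_y (trans_prob (jump_mx S) (Some i) y)%:E * total_law y setT)%E.
Proof.
rewrite (@total_law_some i setT setT setT)// ?probability_setT ?mul1e//.
by rewrite setXTT preimage_setT.
Qed.

(** Induction by stripping off the first coordinate. The Markov weight and the exponential tails
    come with the mass of the last state as a further factor, because only dying trajectories are
    counted. *)
Lemma total_law_cyl n : forall x s t, total_law x (cyl n s t) =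
  (((x == s 0%N)%:R * path_weight n s * \prod_(0 <= i < n.+1) tail_prob (s i) (t i))%:E *
   total_law (s n) setT)%E.
Proof.
have rec0 x s t : total_law x (cyl 0 s t) =
    (((x == s 0%N)%:R * tail_prob (s 0%N) (t 0%N))%:E * total_law (s 0%N) setT)%E.
  have [->|xs] := eqVneq x (s 0%N); last first.
    rewrite mul0r mul0e; case: x xs => [i|] xs.
      by rewrite (total_law_some measurable0 measurableT (cons_cyl_neq _ _ xs)) measure0 mul0e.
    rewrite total_law_none diracE memNset// => -[/(_ 0%N isT)].
    by rewrite /Zc /= => xs0; rewrite xs0 eqxx in xs.
  rewrite mul1r; case s0 : (s 0%N) => [i|].
    have := cons_cyl0 s t; rewrite s0 => E0.
    rewrite (total_law_some (measurable_tail_set _ _) measurableT E0) tail_setE.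
    by rewrite -total_law_setT.
  rewrite !total_law_none !diracE in_setT mule1 /tail_prob mul0r oppr0 expR0 if_same.
  rewrite mem_set//; split => i; rewrite leqn0 => /eqP ->; first by rewrite s0.
  by rewrite /Wc /holding eqxx ltry.
elim: n => [|n IH] x s t; first by rewrite rec0 /path_weight big_geq// mulr1 big_nat1.
have recS : total_law x (cyl n.+1 s t) = (((x == s 0%N)%:R * tail_prob (s 0%N) (t 0%N))%:E *
    \sum_y (trans_prob (jump_mx S) (s 0%N) y)%:E *
      total_law y (cyl n (s \o succn) (t \o succn)))%E.
  have [->|xs] := eqVneq x (s 0%N); last first.
    rewrite mul0r mul0e; case: x xs => [i|] xs.
      by rewrite (total_law_some measurable0 measurableT (cons_cyl_neq _ _ xs)) measure0 mul0e.
    rewrite total_law_none diracE memNset// => -[/(_ 0%N isT)].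
    by rewrite /Zc /= => xs0; rewrite xs0 eqxx in xs.
  rewrite mul1r; case s0 : (s 0%N) => [i|].
    have := cons_cylS n s t; rewrite s0 => E0.
    by rewrite (total_law_some (measurable_tail_set _ _) (measurable_cyl _ _ _) E0) tail_setE.
  rewrite (bigD1 None)//= big1 ?adde0; last first.
    by move=> [j|] //= _; rewrite mul0e.
  rewrite mul1e /tail_prob mul0r oppr0 expR0 if_same mul1e !total_law_none !diracE.
  congr (_%:R%:E); congr nat_of_bool; apply/idP/idP => /set_mem[hs ht]; apply/mem_set.
    by split => i ni; [exact: (hs i.+1 ni)|exact: (ht i.+1 ni)].
  by split => -[|i] ni;
    [rewrite s0|exact: (hs i ni)|rewrite /Wc /holding eqxx ltry|exact: (ht i ni)].
rewrite recS (bigD1 (s 1%N))//= big1 ?adde0; last first.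
  by move=> y ys; rewrite IH/= (negbTE ys) !mul0r mul0e mule0.
rewrite IH /= eqxx mul1r !muleA -!EFinM; congr (_%:E * _)%E.
rewrite /path_weight [in RHS]big_nat_recl//= [X in _ = _ * X]big_nat_recl//=.
by rewrite -!mulrA; congr (_ * _); rewrite mulrCA; congr (_ * _); exact: mulrCA.
Qed.

End path_law.

(** * From trajectories to the jump process *)

Section holding_path.
Context {R : realType} {U T : Type}.
Variables (Z : nat -> T -> option U) (W : nat -> T -> \bar R).
Local Notation jump_time i w := (\sum_(0 <= j < i) W j w)%E.

Definition piecewise_constant (t : R) (w : T) : option U :=
  if pselect (exists i, (jump_time i w <= t%:E < jump_time i.+1 w)%E) is left h
  then Z (sval (cid h)) w else None.

Hypothesis W0 : forall i w, (0 <= W i w)%E.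

Lemma jump_time_le i j w : (i <= j)%N -> (jump_time i w <= jump_time j w)%E.
Proof.
move=> ij; rewrite [leRHS](big_cat_nat _ ij)//= leeDl//.
by apply: sume_ge0.
Qed.

Lemma piecewise_constantE w t i :
  (jump_time i w <= t%:E < jump_time i.+1 w)%E -> piecewise_constant t w = Z i w.
Proof.
move=> ti; rewrite /piecewise_constant; case: pselect => [h|]; last by case; exists i.
case: (cid h) => /= j tj.
suff h' a b : (jump_time a w <= t%:E < jump_time a.+1 w)%E ->
    (jump_time b w <= t%:E < jump_time b.+1 w)%E -> (a <= b)%N.
  by congr (Z _ w); apply/eqP; rewrite eqn_leq !h'.
move=> /andP[at_ _] /andP[_ tb]; rewrite leqNgt; apply/negP => ba.
by have := jump_time_le w ba; rewrite leNgt (le_lt_trans at_ tb).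
Qed.

Lemma piecewise_constant_explosion w t :
  (forall i, jump_time i w <= t%:E)%E -> piecewise_constant t w = None.
Proof.
move=> h; rewrite /piecewise_constant; case: pselect => [ex|//].
by exfalso; case: ex => i /andP[_]; rewrite ltNge h.
Qed.

End holding_path.

Section jump_process_existence.
Context {R : realType} {p : nat}.
Local Notation Om := (path_space R p).
Variables (v : 'rV[R]_p) (S : 'M[R]_p) (E : probability (measurableTypeR R) R).
Hypothesis hS : subintensity S.
Hypothesis hv : probability_vector v.
Hypothesis hE : forall a, 0 <= a -> E [set s | a < s] = (expR (- a))%:E.
Hypothesis hL : (v *m laplace_vec S 0) 0 0 = 1.

Let zero_ge0 : nneg_mx (0 : 'rV[R]_p). Proof. by move=> i j; rewrite mxE. Qed.

Let discount0 i : discount S 0 i = 1.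
Proof. by rewrite /discount mxE mul0r subr0. Qed.

(** At zero reward [laplace_mx] is the jump matrix. A living start dies at step 1 at the earliest,
    hence the shift between the step of death and the index of the Neumann term. *)
Lemma terminating_law_mass N i : terminating_law S E N.+1 (Some i) setT =
  (neumann_term (laplace_mx S 0) (laplace_exit S 0) N i 0)%:E.
Proof.
have rec n j : terminating_law S E n.+1 (Some j) setT =
    (\sum_y (trans_prob (jump_mx S) (Some j) y)%:E * terminating_law S E n y setT)%E.
  rewrite /= (@prependE _ _ _ _ _ _ setT setT setT)//; last by rewrite setXTT preimage_setT.
  rewrite probability_setT mul1e; apply: eq_bigr => y _.
  by rewrite ger0_norm// trans_jump_ge0.
elim: N i => [|N IH] i; rewrite rec sumr_option.
  rewrite [X in (_ + X)%E]big1 => [|j _]; last by rewrite /= /mzero mule0.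
  rewrite [terminating_law _ _ _ _ _]/= diracT adde0 mule1 [RHS]/=.
  by rewrite [laplace_exit _ _ _ _]mxE discount0 mul1r exit_vecE.
rewrite [terminating_law _ _ _ None _]/= /mzero mule0 add0e neumann_termS mxE -sumEFin.
apply: eq_bigr => j _; rewrite IH -EFinM [laplace_mx _ _ _ _]mxE discount0 mul1r//.
Qed.

Lemma total_law_mass i : total_law S E (Some i) setT = (laplace_vec S 0 i 0)%:E.
Proof.
rewrite /total_law nneseries_shift => [|N|//]; last exact: measure_ge0.
under eq_eseriesr do rewrite terminating_law_mass.
have d0 : nneg_mx (delta_mx 0 i : 'rV[R]_p) by move=> k l; rewrite mxE ler0n.
have := nneseries_laplace hS zero_ge0 d0; rewrite -rowE mxE => <-.
by apply: eq_eseriesr => N _; rewrite -rowE mxE.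
Qed.

Lemma total_law_mass_le1 x : (total_law S E x setT <= 1)%E.
Proof.
case: x => [i|]; last by rewrite total_law_none diracT.
rewrite total_law_mass lee_fin; have := laplace_vec_le1 hS zero_ge0 i 0.
by rewrite [ones p i 0]mxE.
Qed.

Let P0 := mseries (fun N => mixture (terminating_law S E N) (init_prob v)) 0.

Lemma init_prob_ge0 x : 0 <= init_prob v x.
Proof. by case: x => //= i; case: hv. Qed.

Let P0E A : P0 A = (\sum_x (init_prob v x)%:E * total_law S E x A)%E.
Proof.
rewrite /P0 /mseries nneseries_sum; last by move=> *; rewrite mule_ge0// lee_fin.
apply: eq_bigr => x _; rewrite nneseriesZl; last by move=> N _; exact: measure_ge0.
by rewrite ger0_norm// init_prob_ge0.
Qed.

Let P0T : P0 setT = 1%E.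
Proof.
rewrite P0E sumr_option /= mul0e add0e -[RHS]/(1%:E) -hL mxE -sumEFin.
by apply: eq_bigr => i _; rewrite total_law_mass -EFinM.
Qed.

(** The measure [P0] has mass 1 already, by the hypothesis on the transform at 0; normalising only
    packages it as a probability. *)
Definition path_probability : probability Om R :=
  mnormalize P0 (dirac (dead_path : Om)).

Let PE A : path_probability A = (\sum_x (init_prob v x)%:E * total_law S E x A)%E.
Proof.
transitivity (mnormalize P0 (dirac (dead_path : Om)) A) => //.
rewrite /mnormalize; case: ifPn => [/orP[/eqP h|/eqP h]|_].
- by have /eqP := etrans (esym P0T) h; rewrite onee_eq0.
- by have := etrans (esym P0T) h.
- transitivity (P0 A * (fine (1%E : \bar R))^-1%:E)%E.
    by congr (_ * (fine _)^-1%:E)%E; exact: P0T.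
  by rewrite /= invr1 mule1 P0E.
Qed.

Let mass x := fine (total_law S E x setT).

Let massE x : total_law S E x setT = (mass x)%:E.
Proof.
rewrite /mass fineK// ge0_fin_numE ?total_law_ge0//.
by rewrite (le_lt_trans (total_law_mass_le1 x))// ltry.
Qed.

Let P_cyl n s t : path_probability (cyl S n s t) =
  (init_prob v (s 0%N) * path_weight S n s *
   (\prod_(0 <= i < n.+1) tail_prob S (s i) (t i)) * mass (s n))%:E.
Proof.
rewrite PE (bigD1 (s 0%N))//= big1 ?adde0 => [|x xs]; last first.
  by rewrite (total_law_cyl hS hE) (negbTE xs) !mul0r mul0e mule0.
rewrite (total_law_cyl hS hE) eqxx mul1r massE -!EFinM.
by rewrite !mulrA.
Qed.

Let path_cyl n s : path_event (@Zc R p) n s = cyl S n s (fun=> -1).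
Proof.
apply/seteqP; split => om; last by case.
by move=> h; split => // i _; rewrite (lt_le_trans _ (Wc_ge0 hS i om))//.
Qed.

Let P_path n s : path_probability (path_event (@Zc R p) n s) =
  (init_prob v (s 0%N) * path_weight S n s * mass (s n))%:E.
Proof.
by rewrite path_cyl P_cyl big1 ?mulr1// => i _; rewrite /tail_prob ltrN10.
Qed.

Let trans_sum1 x : \sum_y trans_prob (jump_mx S) x y = 1.
Proof.
rewrite sumr_option; case: x => [i|] /=; first by rewrite subrK.
by rewrite big1 ?addr0.
Qed.

Let mass_rec x : mass x = \sum_y trans_prob (jump_mx S) x y * mass y.
Proof.
apply: EFin_inj; rewrite -massE -sumEFin; case: x => [i|].
  by rewrite (total_law_setT _ hS); apply: eq_bigr => y _; rewrite massE EFinM.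
rewrite (bigD1 None)//= big1 ?adde0 ?mul1r ?massE// => -[j|]//= _.
by rewrite mul0r.
Qed.

(* States reached with positive probability die almost surely. *)
Let reached_mass n (s : nat -> option 'I_p) :
  init_prob v (s 0%N) * path_weight S n s * (1 - mass (s n)) = 0.
Proof.
have mass1 x : 0 <= 1 - mass x.
  by rewrite subr_ge0 -lee_fin -massE total_law_mass_le1.
elim: n s => [|n IH] s.
  rewrite /path_weight big_geq// mulr1; apply/eqP; move: (s 0%N).
  (* A sum of nonnegative terms equal to 0, because both the initial vector and [P0] have total mass
     1. *)
  have sum0 : \sum_x init_prob v x * (1 - mass x) = 0.
    under eq_bigr do rewrite mulrBr mulr1.
    rewrite sumrB; have -> : \sum_x init_prob v x = 1.
      by rewrite sumr_option /= add0r; case: hv.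
    apply/eqP; rewrite subr_eq0 eq_sym; apply/eqP; apply: EFin_inj.
    rewrite -P0T P0E -sumEFin; apply: eq_bigr => x _.
    by rewrite massE EFinM.
  move=> x; move/eqP: sum0; rewrite psumr_eq0 => [/allP/(_ x)|y _].
    by rewrite mem_index_enum => /(_ isT).
  by rewrite mulr_ge0 ?init_prob_ge0.
(* The defect [1 - mass] is harmonic for the jump chain, so if it vanishes at a reached state it
   vanishes at each successor of positive probability. *)
have : \sum_y trans_prob (jump_mx S) (s n) y * (1 - mass y) = 1 - mass (s n).
  under eq_bigr do rewrite mulrBr mulr1.
  by rewrite sumrB trans_sum1 -mass_rec.
move=> sumE; have := IH s; rewrite -sumE mulr_sumr => /eqP.
rewrite psumr_eq0 => [/allP/(_ (s n.+1))|y _].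
  rewrite mem_index_enum => /(_ isT) /eqP; rewrite /path_weight big_nat_recr//=.
  by rewrite !mulrA.
rewrite mulr_ge0// ?mulr_ge0 ?init_prob_ge0 ?trans_jump_ge0//.
by apply: prodr_ge0 => i _; exact: trans_jump_ge0.
Qed.

Lemma path_chain : terminating_chain path_probability v (jump_mx S) (@Zc R p).
Proof.
have reached n s : init_prob v (s 0%N) * path_weight S n s * mass (s n) =
    init_prob v (s 0%N) * path_weight S n s.
  by apply/eqP; rewrite eq_sym -subr_eq0 -{1}[X in X - _]mulr1 -mulrBr reached_mass.
split; first exact: measurable_Zc.
  move=> x; rewrite -(path_event0 (@Zc R p) (fun=> x)) P_path reached.
  by rewrite /path_weight big_geq// mulr1.
move=> n s; rewrite !P_path !reached -EFinM; congr EFin.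
by rewrite /path_weight big_nat_recr//= mulrA.
Qed.

Lemma path_holding n (s : nat -> option 'I_p) (t : nat -> R) :
  (forall i, 0 <= t i) ->
  path_probability (path_event (@Zc R p) n s `&`
     [set w | forall i, (i <= n)%N -> ((t i)%:E < Wc S i w)%E]) =
  (path_probability (path_event (@Zc R p) n s) *
   (\prod_(0 <= i < n.+1) expR (- (rate S (s i) * t i)))%:E)%E.
Proof.
move=> t0; rewrite -/(cyl S n s t) P_cyl P_path -EFinM; congr EFin.
rewrite mulrAC; congr (_ * _ * _); apply: eq_bigr => i _.
by rewrite /tail_prob ltNge t0.
Qed.

Lemma exists_jump_process : exists J : R -> Om -> option 'I_p,
  markov_jump_process path_probability v S J /\
  {ae path_probability, forall w, (termination_time (J ^~ w) < +oo)%E}.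
Proof.
have W0 := @Wc_ge0 R p S hS.
have mW := @measurable_Wc R p S.
exists (piecewise_constant (@Zc R p) (Wc S)).
have J1 w (t : R) i : 0 <= t ->
    (\sum_(0 <= j < i) Wc S j w <= t%:E < \sum_(0 <= j < i.+1) Wc S j w)%E ->
    piecewise_constant (@Zc R p) (Wc S) t w = Zc i w.
  by move=> _; exact: piecewise_constantE.
split.
  exists (@Zc R p), (Wc S); split => //.
  - exact: path_chain.
  - exact: path_holding.
  - by move=> w t _; exact: piecewise_constant_explosion.
apply: (ae_hit_termination hS path_chain mW W0 path_holding J1).
exact: (ae_hit_laplace0 hS hv path_chain mW W0 path_holding hL).
Qed.

End jump_process_existence.

(** * The pair of terminating chains *)

Section pair_chain.
Context {R : realType} {m n : nat}.
Variables (Pm : 'M[R]_m) (U : 'M[R]_(m, n)) (Q1 Q2 : 'M[R]_n).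

Definition stE (i : 'I_m) : 'I_(nblocks m n) := lshift _ i.
Definition stSS (j1 j2 : 'I_n) : 'I_(nblocks m n) :=
  rshift m (lshift _ (mxtens_index (j1, j2))).
Definition stD1 (j : 'I_n) : 'I_(nblocks m n) :=
  rshift m (rshift (n * n) (lshift _ (mxtens_index (0 : 'I_1, j)))).
Definition stD2 (j : 'I_n) : 'I_(nblocks m n) :=
  rshift m (rshift (n * n) (rshift (1 * n) (mxtens_index (j, 0 : 'I_1)))).

Lemma sum_mxtens (V : nmodType) (k l : nat) (F : 'I_(k * l) -> V) :
  \sum_x F x = \sum_i \sum_j F (mxtens_index (i, j)).
Proof.
rewrite pair_big/= (reindex (@mxtens_index k l)); last first.
  exists (@mxtens_unindex k l) => x _; [exact: mxtens_indexK|exact: mxtens_unindexK].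
by apply: eq_bigr => -[i j].
Qed.

Lemma sum_nblocks (V : nmodType) (F : 'I_(nblocks m n) -> V) :
  \sum_x F x = \sum_i F (stE i) + (\sum_j1 \sum_j2 F (stSS j1 j2) +
    (\sum_j F (stD1 j) + \sum_j F (stD2 j))).
Proof.
rewrite (@big_split_ord _ _ _ m) (@big_split_ord _ _ _ (n * n))
  (@big_split_ord _ _ _ (1 * n)) /= !sum_mxtens; congr (_ + (_ + (_ + _))).
  by rewrite big_ord1.
by apply: eq_bigr => j _; rewrite big_ord1.
Qed.

Lemma nblocks_ind (Q : 'I_(nblocks m n) -> Prop) :
  (forall i, Q (stE i)) -> (forall j1 j2, Q (stSS j1 j2)) ->
  (forall j, Q (stD1 j)) -> (forall j, Q (stD2 j)) -> forall x, Q x.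
Proof.
move=> QE QSS Q1' Q2' x; case: (split_ordP x) => [i ->|y ->]; first exact: QE.
case: (split_ordP y) => [k ->|z ->].
  by case: (mxtens_indexP k) => j1 j2; exact: QSS.
case: (split_ordP z) => [k ->|k ->]; case: (mxtens_indexP k) => i j.
  by rewrite ord1; exact: Q1'.
by rewrite [j]ord1; exact: Q2'.
Qed.

Local Notation PM := (pair_mx Pm U Q1 Q2).
Let q1 := exit_vec Q1.
Let q2 := exit_vec Q2.

Ltac entry := rewrite /pair_mx /stE /stSS /stD1 /stD2
  ?(block_mxEul, block_mxEur, block_mxEdl, block_mxEdr) ?row_mxEl ?row_mxEr
  ?(block_mxEul, block_mxEur, block_mxEdl, block_mxEdr) ?row_mxEl ?row_mxEr
  ?(block_mxEul, block_mxEur, block_mxEdl, block_mxEdr) ?row_mxEl ?row_mxEr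
  ?tensmxE.
Ltac zero_entry := by entry; rewrite mxE.

Lemma pair_mx_sumE i (F : 'I_(nblocks m n) -> R) : \sum_y PM (stE i) y * F y =
  \sum_k Pm i k * F (stE k) + \sum_j U i j * F (stSS j j).
Proof.
rewrite sum_nblocks [X in _ + (_ + X)](_ : _ = 0) ?addr0; last first.
  by rewrite !big1 ?addr0// => j _; rewrite [PM _ _](_ : _ = 0) ?mul0r//; zero_entry.
congr (_ + _).
  by apply: eq_bigr => k _; congr (_ * _); entry.
apply: eq_bigr => j _; rewrite (bigD1 j)//= big1 ?addr0 => [|k kj].
  by congr (_ * _); entry; rewrite mxE mxtens_indexK eqxx mulr1.
rewrite [PM _ _](_ : _ = 0) ?mul0r//; entry.
by rewrite mxE mxtens_indexK /= eq_sym (negbTE kj) mulr0.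
Qed.

Lemma pair_mx_sumSS j1 j2 (F : 'I_(nblocks m n) -> R) :
  \sum_y PM (stSS j1 j2) y * F y =
  \sum_k1 \sum_k2 Q1 j1 k1 * Q2 j2 k2 * F (stSS k1 k2) +
  (q1 j1 0 * (\sum_k Q2 j2 k * F (stD1 k)) + (\sum_k Q1 j1 k * F (stD2 k)) * q2 j2 0).
Proof.
rewrite sum_nblocks [X in X + _](_ : _ = 0) ?add0r; last first.
  by rewrite big1// => j _; rewrite [PM _ _](_ : _ = 0) ?mul0r//; zero_entry.
congr (_ + (_ + _)).
- by apply: eq_bigr => k1 _; apply: eq_bigr => k2 _; congr (_ * _); entry.
- by rewrite mulr_sumr; apply: eq_bigr => k _; rewrite mulrA; congr (_ * _); entry.
- by rewrite mulr_suml; apply: eq_bigr => k _; rewrite mulrAC; congr (_ * _); entry.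
Qed.

Lemma pair_mx_sumD1 j (F : 'I_(nblocks m n) -> R) :
  \sum_y PM (stD1 j) y * F y = \sum_k Q2 j k * F (stD1 k).
Proof.
rewrite sum_nblocks big1 ?add0r => [|k _]; last first.
  by rewrite [PM _ _](_ : _ = 0) ?mul0r//; zero_entry.
rewrite big1 ?add0r => [|k1 _]; last first.
  by rewrite big1// => k2 _; rewrite [PM _ _](_ : _ = 0) ?mul0r//; zero_entry.
rewrite [X in _ + X]big1 ?addr0 => [|k _]; last first.
  by rewrite [PM _ _](_ : _ = 0) ?mul0r//; zero_entry.
by apply: eq_bigr => k _; congr (_ * _); entry; rewrite mxE mul1r.
Qed.

Lemma pair_mx_sumD2 j (F : 'I_(nblocks m n) -> R) :
  \sum_y PM (stD2 j) y * F y = \sum_k Q1 j k * F (stD2 k).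
Proof.
rewrite sum_nblocks big1 ?add0r => [|k _]; last first.
  by rewrite [PM _ _](_ : _ = 0) ?mul0r//; zero_entry.
rewrite big1 ?add0r => [|k1 _]; last first.
  by rewrite big1// => k2 _; rewrite [PM _ _](_ : _ = 0) ?mul0r//; zero_entry.
rewrite big1 ?add0r => [|k _]; last first.
  by rewrite [PM _ _](_ : _ = 0) ?mul0r//; zero_entry.
by apply: eq_bigr => k _; congr (_ * _); entry; rewrite [X in _ * X]mxE mulr1.
Qed.

Lemma pair_mx_ge0 : nneg_mx Pm -> nneg_mx U -> nneg_mx Q1 -> nneg_mx Q2 ->
  nneg_mx q1 -> nneg_mx q2 -> nneg_mx PM.
Proof.
move=> P0 U0 Q10 Q20 q10 q20; apply: nblocks_ind => [i|j1 j2|j|j];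
  apply: nblocks_ind => [i'|k1 k2|k|k]; entry; rewrite ?mulr_ge0//;
  by rewrite !mxE ?mulr_ge0.
Qed.

Lemma sumr_mul1 (I : finType) (F : I -> R) : \sum_i F i * 1 = \sum_i F i.
Proof. by apply: eq_bigr => i _; rewrite mulr1. Qed.

Lemma row_sum_exit q (A : 'M[R]_q) i : \sum_j A i j = 1 - exit_vec A i 0.
Proof. by rewrite exit_vecE opprB addrC subrK. Qed.

Hypothesis PU1 : row_mx Pm U *m ones (m + n) = ones m.

Lemma pair_exitE i : exit_vec PM (stE i) 0 = 0.
Proof.
rewrite exit_vecE; have := pair_mx_sumE i (fun=> 1); rewrite !sumr_mul1 => ->.
move/matrixP: PU1 => /(_ i 0); rewrite mulmx_onesE big_split_ord/= [ones m i 0]mxE.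
under eq_bigr do rewrite row_mxEl; under [X in _ + X]eq_bigr do rewrite row_mxEr.
by move=> ->; rewrite subrr.
Qed.

(** The pair dies at once only if both components do: the three other outcomes, both survive or
    exactly one does, are the three nonzero blocks of this row. *)
Lemma pair_exitSS j1 j2 : exit_vec PM (stSS j1 j2) 0 = q1 j1 0 * q2 j2 0.
Proof.
rewrite exit_vecE; have := pair_mx_sumSS j1 j2 (fun=> 1).
rewrite !sumr_mul1 => ->; rewrite !row_sum_exit -/q1 -/q2.
rewrite [X in 1 - (X + _)](_ : _ = (1 - q1 j1 0) * (1 - q2 j2 0)); first by ring.
rewrite -!row_sum_exit mulr_suml; apply: eq_bigr => k1 _.
by rewrite mulr_sumr; apply: eq_bigr => k2 _; rewrite mulr1.
Qed.

Lemma pair_exitD1 j : exit_vec PM (stD1 j) 0 = q2 j 0.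
Proof.
rewrite exit_vecE; have := pair_mx_sumD1 j (fun=> 1).
by rewrite !sumr_mul1 => ->; rewrite row_sum_exit opprB addrC subrK.
Qed.

Lemma pair_exitD2 j : exit_vec PM (stD2 j) 0 = q1 j 0.
Proof.
rewrite exit_vecE; have := pair_mx_sumD2 j (fun=> 1).
by rewrite !sumr_mul1 => ->; rewrite row_sum_exit opprB addrC subrK.
Qed.

(* Both components run on E and S x S, only the second one on {partial_1} x S and
   only the first one on S x {partial_2}. *)
Definition block_fun (x12 x1 x2 : R) : 'cV[R]_(nblocks m n) :=
  col_mx (const_mx x12) (col_mx (const_mx x12) (col_mx (const_mx x2) (const_mx x1))).

Lemma block_funE x12 x1 x2 i : block_fun x12 x1 x2 (stE i) 0 = x12.
Proof. by rewrite /block_fun /stE col_mxEu mxE. Qed.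

Lemma block_funSS x12 x1 x2 j1 j2 : block_fun x12 x1 x2 (stSS j1 j2) 0 = x12.
Proof. by rewrite /block_fun /stSS col_mxEd col_mxEu mxE. Qed.

Lemma block_funD1 x12 x1 x2 j : block_fun x12 x1 x2 (stD1 j) 0 = x2.
Proof. by rewrite /block_fun /stD1 !col_mxEd col_mxEu mxE. Qed.

Lemma block_funD2 x12 x1 x2 j : block_fun x12 x1 x2 (stD2 j) 0 = x1.
Proof. by rewrite /block_fun /stD2 !col_mxEd mxE. Qed.

Variables (x12 x1 x2 : R).

(* Sum over the pairs [(a, b)] with [maxn a b = N]. *)
Definition sum_max (N : nat) (c : nat -> nat -> R) : R :=
  c N N + (\sum_(a < N) c a N + \sum_(b < N) c N b).

(** Lowers both coordinates by one; the pairs for which this is impossible are those with a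
    coordinate 0. *)
Lemma sum_maxS N c : sum_max N.+1 c =
  sum_max N (fun a b => c a.+1 b.+1) + (c 0%N N.+1 + c N.+1 0%N).
Proof. by rewrite /sum_max !big_ord_recl/= /bump/=; under eq_bigr do rewrite add1n;
  under [X in _ + (_ + (_ + X))]eq_bigr do rewrite add1n; ring. Qed.

Lemma eq_sum_max N c c' : (forall a b, c a b = c' a b) -> sum_max N c = sum_max N c'.
Proof.
by move=> cc'; rewrite /sum_max cc'; congr (_ + (_ + _)); apply: eq_bigr => a _.
Qed.

Lemma sum_maxZ N x c : x * sum_max N c = sum_max N (fun a b => x * c a b).
Proof. by rewrite /sum_max !mulrDr !mulr_sumr. Qed.

Lemma sum_max_sum N (I : finType) (c : I -> nat -> nat -> R) :
  \sum_i sum_max N (c i) = sum_max N (fun a b => \sum_i c i a b).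
Proof.
by rewrite /sum_max !big_split/=; congr (_ + (_ + _)); rewrite exchange_big.
Qed.

Lemma sum_maxD N c c' : sum_max N c + sum_max N c' =
  sum_max N (fun a b => c a b + c' a b).
Proof. by rewrite /sum_max !big_split/=; ring. Qed.

(** Cost of two lifetimes [a] and [b]: [x12] for each step at which both run, [x1] or [x2] for each
    step of the survivor. *)
Definition pair_weight (a b : nat) : R :=
  x12 ^+ minn a b * x1 ^+ (a - b) * x2 ^+ (b - a).

Lemma pair_weightS a b : pair_weight a.+1 b.+1 = x12 * pair_weight a b.
Proof. by rewrite /pair_weight minnSS !subSS exprS !mulrA. Qed.

Lemma pair_weight0r N : pair_weight N 0 = x1 ^+ N.
Proof. by rewrite /pair_weight minn0 subn0 sub0n mul1r mulr1. Qed.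

Lemma pair_weight0l N : pair_weight 0 N = x2 ^+ N.
Proof. by rewrite /pair_weight min0n subn0 sub0n !mul1r. Qed.

Definition weighted_mx : 'M[R]_(nblocks m n) :=
  scaled_mx (fun x => block_fun x12 x1 x2 x 0) PM.
Definition weighted_exit : 'cV[R]_(nblocks m n) :=
  scaled_exit (fun x => block_fun x12 x1 x2 x 0) PM.
Local Notation h := (neumann_term weighted_mx weighted_exit).
Local Notation F1 := (neumann_term Q1 q1).
Local Notation F2 := (neumann_term Q2 q2).

Let h0 x : h 0 x 0 = block_fun x12 x1 x2 x 0 * exit_vec PM x 0.
Proof. by rewrite /= [weighted_exit _ _]mxE. Qed.

Let hS N x : h N.+1 x 0 = block_fun x12 x1 x2 x 0 * \sum_y PM x y * h N y 0.
Proof.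
rewrite neumann_termS mxE mulr_sumr; apply: eq_bigr => y _.
by rewrite [weighted_mx _ _]mxE mulrA.
Qed.

Lemma pair_termD1 N j : h N (stD1 j) 0 = x2 ^+ N.+1 * F2 N j 0.
Proof.
elim: N j => [|N IH] j; first by rewrite h0 block_funD1 pair_exitD1 expr1.
rewrite hS block_funD1 pair_mx_sumD1 exprS -mulrA; congr (_ * _).
rewrite neumann_termS mxE mulr_sumr; apply: eq_bigr => k _.
by rewrite IH mulrCA.
Qed.

Lemma pair_termD2 N j : h N (stD2 j) 0 = x1 ^+ N.+1 * F1 N j 0.
Proof.
elim: N j => [|N IH] j; first by rewrite h0 block_funD2 pair_exitD2 expr1.
rewrite hS block_funD2 pair_mx_sumD2 exprS -mulrA; congr (_ * _).
rewrite neumann_termS mxE mulr_sumr; apply: eq_bigr => k _.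
by rewrite IH mulrCA.
Qed.

(** [F1 a j] is the probability that the chain of matrix [Q1] started at [j] dies at step [a + 1],
    and likewise for [F2]. Two independent chains are both dead for the first time at step [N + 1]
    when the larger of the two indices is [N]. *)
Lemma pair_termSS N j1 j2 : h N (stSS j1 j2) 0 =
  x12 * sum_max N (fun a b => pair_weight a b * (F1 a j1 0 * F2 b j2 0)).
Proof.
elim: N j1 j2 => [|N IH] j1 j2.
  rewrite h0 block_funSS pair_exitSS /sum_max !big_ord0 !addr0.
  by rewrite pair_weight0r expr0 mul1r.
rewrite hS block_funSS pair_mx_sumSS; congr (_ * _); rewrite sum_maxS; congr (_ + (_ + _)).
- under eq_bigr do under eq_bigr do rewrite IH mulrCA sum_maxZ sum_maxZ.
  under eq_bigr do rewrite sum_max_sum; rewrite sum_max_sum.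
  apply: eq_sum_max => a b; rewrite pair_weightS !neumann_termS mxE [(Q2 *m _) _ _]mxE.
  rewrite mulr_suml mulr_sumr; apply: eq_bigr => k1 _.
  by rewrite !mulr_sumr; apply: eq_bigr => k2 _; ring.
- rewrite pair_weight0l; under eq_bigr do rewrite pair_termD1 mulrCA.
  rewrite -mulr_sumr [F2 N.+1 _ _](_ : _ = \sum_k Q2 j2 k * F2 N k 0); last first.
    by rewrite neumann_termS mxE.
  by rewrite /=; ring.
- rewrite pair_weight0r; under eq_bigr do rewrite pair_termD2 mulrCA.
  rewrite -mulr_sumr [F1 N.+1 _ _](_ : _ = \sum_k Q1 j1 k * F1 N k 0); last first.
    by rewrite neumann_termS mxE.
  by rewrite /=; ring.
Qed.

Lemma pair_termE0 i : h 0 (stE i) 0 = 0.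
Proof. by rewrite h0 pair_exitE mulr0. Qed.

Lemma pair_termES N i : h N.+1 (stE i) 0 =
  x12 * (\sum_k Pm i k * h N (stE k) 0 + \sum_j U i j * h N (stSS j j) 0).
Proof. by rewrite hS block_funE pair_mx_sumE. Qed.

End pair_chain.

(** * Exit times and the joint law of the two deaths *)

Section exit_time.
Context {R : realType} {U : Type}.
Variables (A : set U) (x : nat -> U).

Lemma exit_timeP (t : nat) : exit_time R A x = (t%:R : R)%:E <->
  [/\ (0 < t)%N, ~ A (x t) & forall i, (0 < i < t)%N -> A (x i)].
Proof.
split=> [xt|[t0 At Ai]]; last first.
  apply/eqP; rewrite eq_le; apply/andP; split.
    by apply: ereal_inf_lbound; exists t.
  apply: le_ereal_inf_tmp => _ [k /= [k0 Ak] <-]; rewrite lee_fin ler_nat leqNgt.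
  by apply/negP => kt; apply: Ak; apply: Ai; rewrite k0.
have [ex|none] := pselect (exists n, `[< (0 < n)%N /\ ~ A (x n) >]); last first.
  move: xt; rewrite /exit_time [X in ereal_inf X](_ : _ = set0) ?ereal_inf0//.
  apply/seteqP; split => // _ [k /= hk _]; apply: none; exists k; exact/asboolP.
case: (ex_minnP ex) => k /asboolP[k0 Ak] mink.
have xk : exit_time R A x = (k%:R : R)%:E.
  apply/eqP; rewrite eq_le; apply/andP; split.
    by apply: ereal_inf_lbound; exists k.
  apply: le_ereal_inf_tmp => _ [l /= hl <-]; rewrite lee_fin ler_nat.
  by apply: mink; apply/asboolP.
have kt : k = t by move: xk; rewrite xt => -[/eqP]; rewrite eqr_nat => /eqP.
rewrite -kt; split => // i /andP[i0 ik]; apply: contrapT => Ai.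
have := mink i (asboolT (conj i0 Ai)).
by rewrite leqNgt ik.
Qed.

End exit_time.

Section chain_death.
Context {R : realType} {d : measure_display} {T : measurableType d}.
Variables (P : probability T R) (k : nat) (A : 'M[R]_k) (C : set T).
Variable M : nat -> T -> option 'I_k.
Hypothesis mC : measurable C.
Hypothesis mM : measurable_states M.
Hypothesis markov : forall n s x, fine (P (C `&` path_event M n.+1 (extend s n x))) =
  fine (P (C `&` path_event M n s)) * trans_prob A (s n) x.

(** The Markov property is only required relative to [C], so that [C] may carry information on the
    other chain. *)
Lemma chain_death N n s i : s n = Some i ->
  fine (P (C `&` (path_event M n s `&` alive_then_dead M n N))) =
  fine (P (C `&` path_event M n s)) * neumann_term A (exit_vec A) N i 0.
Proof.
apply: (path_recursion (F := fun n s => fine (P (C `&` path_event M n s)))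
  (H := fun n N s => fine (P (C `&` (path_event M n s `&` alive_then_dead M n N))))).
- by move=> {}n {}s {}i j si; rewrite markov si.
- by move=> {}n {}s {}i si; rewrite markov si /= exit_vecE.
- by move=> {}n {}s {}i si; rewrite alive_then_dead0.
move=> {}n {}N {}s {}i si.
rewrite setICA prob_path_split//; last first.
  by apply: measurableI => //; exact: measurable_alive_then_dead.
rewrite sumr_option [X in X + _](_ : _ = 0) ?add0r.
  apply: eq_bigr => j _; congr (fine (P _)).
  by rewrite setICA alive_then_deadS.
by rewrite setICA alive_then_deadN setI0 measure0.
Qed.

End chain_death.

Definition shift (T U : Type) (M : nat -> T -> U) (t i : nat) : T -> U :=
  M (t + i)%N.

Section cdph.
Context {R : realType} {m n : nat} {d : measure_display} {T : measurableType d}.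
Variables (P : probability T R) (alpha : 'rV[R]_m) (Pm : 'M[R]_m)
  (U : 'M[R]_(m, n)) (Q1 Q2 : 'M[R]_n) (M1 M2 : nat -> T -> option 'I_(m + n)).
Hypothesis hpar : CDPH_parameters alpha Pm U Q1 Q2.
Hypothesis hch : CDPH_chains P alpha Pm U Q1 Q2 M1 M2.

Local Notation B := (block_mx Pm U 0 Q1).
Local Notation F1 := (neumann_term Q1 (exit_vec Q1)).
Local Notation F2 := (neumann_term Q2 (exit_vec Q2)).
Local Notation inE := (E_states m n).

Let hM1 : terminating_chain P (row_mx alpha 0) B M1. Proof. by case: hch. Qed.
Let mM1 : measurable_states M1. Proof. by case: hM1. Qed.
Let mM2 : measurable_states M2. Proof. by case: hch. Qed.

Let mshift (M : nat -> T -> option 'I_(m + n)) t :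
  measurable_states M -> measurable_states (shift M t).
Proof. by move=> mM i x; exact: mM. Qed.

Let fine_le (X Y : set T) : measurable X -> measurable Y -> X `<=` Y ->
  fine (P X) <= fine (P Y).
Proof.
move=> mX mY XY; rewrite fine_le ?fin_num_measure//.
by apply: le_measure; rewrite ?inE//; exact/mem_set.
Qed.

Let fine_ge0' (X : set T) : 0 <= fine (P X).
Proof. exact: fine_ge0. Qed.

Section branch.
Variables (t : nat) (s : nat -> option 'I_(m + n)) (j : 'I_n).
Hypothesis st : s t = Some (rshift m j).
Hypothesis exit_s : exit_time R inE s = (t%:R : R)%:E.

Let past := path_event M1 t s.
Let mpast : measurable past. Proof. exact: measurable_path_event. Qed.

Lemma past_exit w : past w -> exit_time R inE (M1 ^~ w) = (t%:R : R)%:E.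
Proof.
move=> pw; move/exit_timeP: exit_s => [t0 At Ai]; apply/exit_timeP; split => //.
  by rewrite pw.
by move=> i /andP[i0 it]; rewrite pw ?(ltnW it)//; apply: Ai; rewrite i0.
Qed.

Lemma past_agree w i : past w -> (i <= t)%N -> M2 i w = s i.
Proof.
move=> pw it; case: hch => _ _ agree _; rewrite agree ?pw//.
by rewrite (past_exit pw) lee_fin ler_nat.
Qed.

(** A past and a compatible future concatenate into one path of the first chain, to which its Markov
    property applies; an incompatible future gives the empty event. *)
Lemma past_future1 i c x :
  fine (P (past `&` path_event (shift M1 t) i.+1 (extend c i x))) =
  fine (P (past `&` path_event (shift M1 t) i c)) * trans_prob B (c i) x.
Proof.
have [c0|c0] := pselect (c 0%N = s t); last first.
  have empty l c' : c' 0%N = c 0%N -> past `&` path_event (shift M1 t) l c' = set0.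
    move=> c'c; apply/seteqP; split => // w [pw /(_ 0%N (leq0n _))].
    by rewrite /shift addn0 pw// c'c => /esym.
  by rewrite !empty// measure0 mul0r.
pose cc l := if (l <= t)%N then s l else c (l - t)%N.
have ccE l c' : c' 0%N = c 0%N -> past `&` path_event (shift M1 t) l c' =
    path_event M1 (t + l) (fun l => if (l <= t)%N then s l else c' (l - t)%N).
  move=> c'c; apply/seteqP; split => w.
    move=> [pw fw] a al; case: leqP => ta; first exact: pw.
    rewrite -[in LHS](subnKC (ltnW ta)); apply: (fw (a - t)%N).
    by rewrite leq_subLR.
  move=> h; split => [a ta|a al]; first by rewrite h ?ta// (leq_trans ta)// leq_addr.
  rewrite /shift h ?leq_add2l//; case: leqP => [|_]; last by rewrite addKn.
  rewrite -{2}[t]addn0 leq_add2l leqn0 => /eqP ->.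
  by rewrite addn0 c'c.
rewrite !ccE//; have -> : path_event M1 (t + i.+1)
      (fun l => if (l <= t)%N then s l else extend c i x (l - t)%N) =
    path_event M1 (t + i).+1 (extend cc (t + i) x).
  rewrite addnS; apply: path_event_eq => a al; rewrite /extend /cc.
  case: leqP => ta; first by rewrite (leq_trans ta)// leq_addr.
  by rewrite leq_subLR.
rewrite (path_prob_extend hM1); congr (_ * trans_prob _ _ _); rewrite /cc.
case: leqP => [|_]; last by rewrite addKn.
rewrite -{2}[t]addn0 leq_add2l leqn0 => /eqP ->.
by rewrite addn0 c0.
Qed.

Let S_path_extend b l x :
  S_path m (extend b l x) = extend (S_path m b) l (omap (@rshift m n) x).
Proof. by apply/funext => i; rewrite /S_path /extend; case: ifP. Qed.

(** The definition describes the second chain only along paths in S and the cemetery. The recursion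
    over all states therefore needs that an entrance into E is null. *)
Lemma branch_death2 i c N :
  fine (P (past `&` path_event (shift M1 t) i c `&` alive_then_dead (shift M2 t) 0 N)) =
  fine (P (past `&` path_event (shift M1 t) i c)) * F2 N j 0.
Proof.
have msh2 := mshift t mM2; have msh1 := mshift t mM1.
set C := past `&` _.
have mC : measurable C by apply: measurableI => //; exact: measurable_path_event.
have matd l N' : measurable (alive_then_dead (shift M2 t) l N').
  exact: measurable_alive_then_dead.
(* A null past is treated apart, because the independence clause is multiplied by the probability of
   the past, which has to be cancelled. *)
have [P0|P0] := eqVneq (fine (P past)) 0.
  have C0 (X : set T) : measurable X -> X `<=` past -> fine (P X) = 0.
    move=> mX Xp; apply/eqP; rewrite eq_le fine_ge0' andbT -P0.
    exact: fine_le.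
  rewrite !C0 ?mul0r//; first by move=> w [].
    exact: measurableI.
  by move=> w [[]].
case: hch => _ _ _ /(_ t s exit_s)[indep markov2].
pose F l b := fine (P (C `&` path_event (shift M2 t) l (S_path m b))).
have mpath l b : measurable (path_event (shift M2 t) l b).
  exact: measurable_path_event.
have FE l b : F l b * fine (P past) = fine (P C) *
    fine (P (past `&` path_event (shift M2 t) l (S_path m b))).
  have mI := measurableI _ _ mpast (mpath l (S_path m b)).
  have mCI := measurableI _ _ mC (mpath l (S_path m b)).
  have /(congr1 fine) := indep i c l b; rewrite -/past -/C.
  by rewrite !fineM ?fin_num_measure.
(* Independence transfers the transition rule of the second chain from [past] to [C], which also
   fixes a piece of the first chain. *)
have Fext l b x : F l.+1 (extend b l x) = F l b * trans_prob Q2 (b l) x.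
  apply: (mulIf P0); rewrite FE [RHS]mulrAC FE -mulrA; congr (_ * _).
  have mI l' b' := measurableI _ _ mpast (mpath l' (S_path m b')).
  have /(congr1 fine) := markov2 l (extend b l x); rewrite -/past.
  rewrite fineM ?fin_num_measure// => ->; rewrite {2 3}/extend leqnn ltnn.
  congr (fine (P (_ `&` _)) * _).
  by apply: path_event_eq => a al; rewrite /S_path /extend al.
have trans1 x : \sum_y trans_prob Q2 x y = 1.
  rewrite sumr_option; case: x => [y|] /=; first by rewrite subrK.
  by rewrite big1 ?addr0.
pose H l N b := fine (P (C `&` path_event (shift M2 t) l (S_path m b) `&`
  alive_then_dead (shift M2 t) l N)).
have start : C `<=` path_event (shift M2 t) 0 (S_path m (fun=> Some j)).
  move=> w [pw _]; rewrite path_event0 /shift addn0 /= (past_agree pw)//.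
have HF : H 0%N N (fun=> Some j) = F 0%N (fun=> Some j) * F2 N j 0.
  apply: path_recursion => // [l b y z by_|l b y by_|l b y _|l N' b y by_].
  - by rewrite Fext by_.
  - by rewrite Fext by_ /= exit_vecE.
  - by rewrite /H /F -setIA alive_then_dead0 S_path_extend.
  rewrite /H -setIA setICA prob_path_split//; last by apply: measurableI.
  rewrite sumr_option [X in X + _](_ : _ = 0) ?add0r; last first.
    by rewrite setICA alive_then_deadN setI0 measure0.
  (* The transitions towards S and the cemetery already sum to one, so no mass is left for a state
     of E. *)
  have zero e : fine (P (C `&` path_event (shift M2 t) l.+1
      (extend (S_path m b) l (Some (lshift n e))))) = 0.
    pose g x := fine (P (C `&` path_event (shift M2 t) l.+1 (extend (S_path m b) l x))).
    have sumF : F l b = \sum_x g x.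
      by rewrite /F setIC prob_path_split//; apply: eq_bigr => x _; rewrite setIC.
    have sumS : F l b = \sum_x g (omap (@rshift m n) x).
      transitivity (\sum_x F l.+1 (extend b l x)).
        by under eq_bigr do rewrite Fext; rewrite -mulr_sumr trans1 mulr1.
      by apply: eq_bigr => x _; rewrite /F S_path_extend.
    have : \sum_e' g (Some (lshift n e')) = 0.
      by move: sumF; rewrite sumS !sumr_option big_split_ord/=; lra.
    move/eqP; rewrite psumr_eq0 => [/allP/(_ e)|e' _]; last exact: fine_ge0'.
    by rewrite mem_index_enum => /(_ isT)/eqP.
  rewrite big_split_ord/= [X in X + _]big1 ?add0r => [|e _]; last first.
    apply/eqP; rewrite eq_le fine_ge0' andbT -(zero e); apply: fine_le.
    - by apply: measurableI => //; apply: measurableI.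
    - by apply: measurableI.
    - by move=> w [pw [Cw _]].
  apply: eq_bigr => z _; rewrite S_path_extend/=; congr (fine (P _)).
  by rewrite setICA alive_then_deadS setIA.
move: HF; rewrite /H /F (setIidl start); apply: etrans.
congr (fine (P _)).
Qed.

(** The death of the second chain is put into [C]. By the preceding lemma it multiplies every future
    of the first chain by the same factor, so the first chain is still Markov relative to [C]. *)
Lemma branch_death a b :
  fine (P (past `&` alive_then_dead (shift M1 t) 0 a `&`
     alive_then_dead (shift M2 t) 0 b)) =
  fine (P past) * (F1 a j 0 * F2 b j 0).
Proof.
have msh2 := mshift t mM2; have msh1 := mshift t mM1.
pose C := past `&` alive_then_dead (shift M2 t) 0 b.
have mC : measurable C.
  by apply: measurableI => //; exact: measurable_alive_then_dead.
have CE i c : fine (P (C `&` path_event (shift M1 t) i c)) =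
    fine (P (past `&` path_event (shift M1 t) i c)) * F2 b j 0.
  by rewrite -branch_death2 /C setIAC.
have := @chain_death R d T P _ B C (shift M1 t) mC msh1 _ a 0%N (fun=> s t) _ st.
rewrite -/(C `&` _).
have start : past `<=` path_event (shift M1 t) 0 (fun=> s t).
  by move=> w pw; rewrite path_event0 /shift addn0 /= pw.
have startC : C `<=` path_event (shift M1 t) 0 (fun=> s t).
  by move=> w [pw _]; exact: start.
(* Seen from S the block matrix acts as [Q1], since E is never entered again. *)
have blockF N y : neumann_term B (exit_vec B) N (rshift m y) 0 = F1 N y 0.
  elim: N y => [|N IH] y.
    rewrite /= !exit_vecE big_split_ord/=; congr (1 - _).
    rewrite big1 ?add0r => [|e _]; last by rewrite block_mxEdl mxE.
    by apply: eq_bigr => z _; rewrite block_mxEdr.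
  rewrite !neumann_termS !mxE big_split_ord/= big1 ?add0r => [|e _]; last first.
    by rewrite block_mxEdl mxE mul0r.
  by apply: eq_bigr => z _; rewrite block_mxEdr IH.
rewrite setIA (setIidl startC) blockF => h.
transitivity (fine (P (C `&` alive_then_dead (shift M1 t) 0 a))).
  by congr (fine (P _)); rewrite /C setIAC.
rewrite h => [|i c x]; last by rewrite !CE past_future1 mulrAC.
rewrite -(setIidl startC) CE (setIidl start) -mulrA; congr (_ * _); exact: mulrC.
Qed.

End branch.
End cdph.

Lemma exit_time0 (R : realType) (U : Type) (A : set U) (x : nat -> U) :
  exit_time R A x <> (0%:R : R)%:E.
Proof. by move=> /exit_timeP[]. Qed.

Lemma exit_timeS (R : realType) d (T : measurableType d) k (M : nat -> T -> option 'I_k) t w :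
  exit_time R [set~ None] (M ^~ w) = (t.+1%:R : R)%:E <-> alive_then_dead M 0 t w.
Proof.
split=> [/exit_timeP[_ Mt Mi]|[al dead]].
  by split; [move=> i ilt; exact: Mi|exact: contrapT].
by apply/exit_timeP; split => // i ilt; exact: al.
Qed.

Section cdph_total.
Context {R : realType} {m n : nat} {d : measure_display} {T : measurableType d}.
Variables (P : probability T R) (alpha : 'rV[R]_m) (Pm : 'M[R]_m)
  (U : 'M[R]_(m, n)) (Q1 Q2 : 'M[R]_n) (M1 M2 : nat -> T -> option 'I_(m + n)).
Hypothesis hpar : CDPH_parameters alpha Pm U Q1 Q2.
Hypothesis hch : CDPH_chains P alpha Pm U Q1 Q2 M1 M2.
Variables (x12 x1 x2 : R).

Local Notation B := (block_mx Pm U 0 Q1).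
Local Notation F1 := (neumann_term Q1 (exit_vec Q1)).
Local Notation F2 := (neumann_term Q2 (exit_vec Q2)).
Local Notation h := (neumann_term (weighted_mx Pm U Q1 Q2 x12 x1 x2)
  (weighted_exit Pm U Q1 Q2 x12 x1 x2)).
Local Notation w12 := (pair_weight x12 x1 x2).

Let hM1 : terminating_chain P (row_mx alpha 0) B M1. Proof. by case: hch. Qed.
Let mM1 : measurable_states M1. Proof. by case: hM1. Qed.
Let mM2 : measurable_states M2. Proof. by case: hch. Qed.
Let PU1 : row_mx Pm U *m ones (m + n) = ones m. Proof. by case: hpar. Qed.

Definition in_E k (s : nat -> option 'I_(m + n)) : Prop :=
  forall i, (i <= k)%N -> E_states m n (s i).

Let both a b : set T := alive_then_dead M1 0 a `&` alive_then_dead M2 0 b.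

Let mboth a b : measurable (both a b).
Proof. by apply: measurableI; exact: measurable_alive_then_dead. Qed.

Let mpath k s : measurable (path_event M1 k s). Proof. exact: measurable_path_event. Qed.

Let p k s a b : R := fine (P (path_event M1 k s `&` both (k + a) (k + b))).

(** A path in E up to [k] puts the separation time at [k + 1] or later, and the chains coincide up
    to and including that time. *)
Lemma agree_next k s w i : in_E k s -> path_event M1 k s w -> (i <= k.+1)%N ->
  M2 i w = M1 i w.
Proof.
move=> sE pw ik; case: hch => _ _ agree _; apply: agree.
apply: le_ereal_inf_tmp => _ [l /= [l0 lE] <-]; rewrite lee_fin ler_nat.
apply: (leq_trans ik); rewrite ltnNge; apply/negP => lk; apply: lE.
by rewrite pw//; exact: sE.
Qed.

(** The rows of (P U) sum to one: there is no death directly from E. *)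
Lemma next_none k s i : s k = Some (lshift n i) ->
  fine (P (path_event M1 k.+1 (extend s k None))) = 0.
Proof.
move=> sk; rewrite (path_prob_extend hM1) sk /= [X in 1 - X](_ : _ = 1) ?subrr ?mulr0//.
move/matrixP: PU1 => /(_ i 0); rewrite mulmx_onesE [ones m i 0]mxE => <-.
rewrite !big_split_ord/=; congr (_ + _); apply: eq_bigr => l _.
  by rewrite block_mxEul row_mxEl.
by rewrite block_mxEur row_mxEr.
Qed.

Let subset_null (X Y : set T) : measurable X -> measurable Y -> X `<=` Y ->
  fine (P Y) = 0 -> fine (P X) = 0.
Proof.
move=> mX mY XY Y0; apply/eqP; rewrite eq_le fine_ge0// andbT -Y0.
rewrite fine_le ?fin_num_measure//.
by apply: le_measure; rewrite ?inE//; exact/mem_set.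
Qed.

Let p0 k s i a b : in_E k s -> s k = Some (lshift n i) -> (a == 0%N) || (b == 0%N) ->
  p k s a b = 0.
Proof.
move=> sE sk ab; apply: subset_null (next_none sk) => //.
  exact: measurableI.
move=> w [pw [[_ d1] [_ d2]]]; rewrite path_event_extend; split => //=.
case/orP: ab => /eqP ab; first by move: d1; rewrite ab addn0.
by rewrite -(agree_next sE pw (leqnn _)); move: d2; rewrite ab addn0.
Qed.

Let extend_E k s i : in_E k s -> in_E k.+1 (extend s k (Some (lshift n i))).
Proof.
move=> sE l lk; rewrite /extend; case: leqP => [/sE//|_].
by exists i.
Qed.

(** Splits on the next state of the first chain: in E the situation repeats with a longer path, in S
    the separation takes place and [branch_death] gives the product form, and the cemetery is
    null. *)
Let pS k s i a b : in_E k s -> s k = Some (lshift n i) ->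
  p k s a.+1 b.+1 =
  \sum_i' p k.+1 (extend s k (Some (lshift n i'))) a b +
  \sum_j fine (P (path_event M1 k s)) * U i j * (F1 a j 0 * F2 b j 0).
Proof.
move=> sE sk; rewrite /p prob_path_split// sumr_option [X in X + _](_ : _ = 0).
  rewrite add0r big_split_ord/=; congr (_ + _).
    by apply: eq_bigr => i' _; rewrite !addSn !addnS.
  apply: eq_bigr => j _; set s' := extend s k _.
  have s't : s' k.+1 = Some (rshift m j) by rewrite /s' /extend ltnn.
  have s'E l : (l <= k)%N -> E_states m n (s' l).
    by move=> lk; rewrite /s' /extend lk; exact: sE.
  have s'N l : (l <= k.+1)%N -> s' l <> None.
    rewrite leq_eqVlt ltnS => /predU1P[->|/s'E[e _ <-]//]; by rewrite s't.
  have exit_s : exit_time R (E_states m n) s' = (k.+1%:R : R)%:E.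
    apply/exit_timeP; split => // [|l /andP[_ lk]]; last exact: s'E.
    by rewrite s't => -[e _ [/= em]]; have := ltn_ord e; rewrite em ltnNge leq_addr.
  (* Resets the clock of [M] at the separation time: the path is alive up to [k.+1], so the death at
     [(k + N.+1).+1] becomes a death of the shifted chain at [N.+1]. *)
  have atdE (M : nat -> T -> option 'I_(m + n)) N :
      (forall w, path_event M1 k.+1 s' w -> forall l, (l <= k.+1)%N -> M l w = s' l) ->
      path_event M1 k.+1 s' `&` alive_then_dead M 0 (k + N.+1) =
      path_event M1 k.+1 s' `&` alive_then_dead (shift M k.+1) 0 N.
    move=> Ms; apply/seteqP; split => w [pw [al dead]]; split => //; split.
    - move=> l /andP[l0 lN]; apply: al; rewrite addSn ltn0Sn /=.
      by rewrite add0n addnS ltnS leq_add2l.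
    - by move: dead; rewrite /shift !add0n addSn.
    - move=> l /andP[l0 lN]; have [lk|kl] := leqP l k.+1.
        by rewrite (Ms _ pw)//; exact: s'N.
      rewrite -(subnKC (ltnW kl)); apply: (al (l - k.+1)%N).
      by rewrite subn_gt0 kl leq_subLR addSnnS.
    - by move: dead; rewrite /shift !add0n addSn.
  rewrite setIA atdE => [|w pw l lk]; last exact: pw.
  rewrite setIAC atdE => [|w pw l lk]; last exact: (past_agree hch exit_s pw lk).
  rewrite setIAC (branch_death hch s't exit_s); congr (_ * _).
  by rewrite (path_prob_extend hM1) sk /= block_mxEur.
apply: subset_null (next_none sk) => //; exact: measurableI.
Qed.

(** Both sides obey the same recursion in [N]: one step from E costs [x12], then leads to E with
    [Pm] or to the diagonal of S x S with [U]. The path is universally quantified because it grows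
    along the induction. *)
Lemma path_to_death N : forall k s i, in_E k s -> s k = Some (lshift n i) ->
  x12 * sum_max N (fun a b => w12 a b * p k s a b) =
  fine (P (path_event M1 k s)) * h N (stE i) 0.
Proof.
elim: N => [|N IH] k s i sE sk.
  by rewrite pair_termE0// mulr0 /sum_max !big_ord0 (p0 sE sk)// mulr0 !addr0 mulr0.
rewrite sum_maxS !(p0 sE sk)// !mulr0 !addr0 pair_termES// mulrCA; congr (_ * _).
rewrite (@eq_sum_max R N _ (fun a b =>
    \sum_i' x12 * (w12 a b * p k.+1 (extend s k (Some (lshift n i'))) a b) +
    \sum_j fine (P (path_event M1 k s)) * U i j *
      (x12 * (w12 a b * (F1 a j 0 * F2 b j 0))))); last first.
  move=> a b; rewrite pair_weightS (pS _ _ sE sk) mulrDr !mulr_sumr; congr (_ + _);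
    by apply: eq_bigr => l _; ring.
rewrite -sum_maxD -!sum_max_sum mulrDr !mulr_sumr; congr (_ + _).
  apply: eq_bigr => i' _; rewrite -sum_maxZ (IH _ _ i').
  - by rewrite (path_prob_extend hM1) sk /= block_mxEul mulrA.
  - exact: extend_E.
  - by rewrite /extend ltnn.
by apply: eq_bigr => j _; rewrite -sum_maxZ -sum_maxZ pair_termSS// -[LHS]mulrA.
Qed.

Lemma cdph_exit_law N :
  x12 * sum_max N (fun a b => w12 a b *
    fine (P (alive_then_dead M1 0 a `&` alive_then_dead M2 0 b))) =
  \sum_i alpha 0 i * h N (stE i) 0.
Proof.
have init x : fine (P (path_event M1 0 (fun=> x))) = init_prob (row_mx alpha 0) x.
  by rewrite path_event0; case: hM1 => _ ->.
have splitB a b : fine (P (both a b)) = \sum_i p 0 (fun=> Some (lshift n i)) a b.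
  rewrite (prob_start_split P mM1)//.
  have mI x : measurable (path_event M1 0 (fun=> x) `&` both a b) by exact: measurableI.
  have zero x : init_prob (row_mx alpha 0) x = 0 ->
      fine (P (path_event M1 0 (fun=> x) `&` both a b)) = 0.
    by move=> x0; apply: (@subset_null _ (path_event M1 0 (fun=> x))) => //; rewrite init.
  rewrite sumr_option zero// add0r big_split_ord/= [X in _ + X]big1 ?addr0// => j _.
  by rewrite zero//= row_mxEr mxE.
rewrite (@eq_sum_max R N _ (fun a b => \sum_i w12 a b * p 0 (fun=> Some (lshift n i)) a b)).
  rewrite -sum_max_sum mulr_sumr; apply: eq_bigr => i _.
  rewrite (@path_to_death _ _ _ i)//; last by move=> l _; exists i.
  by rewrite init /= row_mxEl.
by move=> a b; rewrite -/(both a b) splitB mulr_sumr.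
Qed.

End cdph_total.

(** * Random sums *)

Section same_law_integral.
Context {R : realType} {d d' du : measure_display} {T : measurableType d}
  {T' : measurableType d'} {U : measurableType du}.
Variables (P : probability T R) (P' : probability T' R) (X : T -> U) (X' : T' -> U).
Hypotheses (mX : measurable_fun setT X) (mX' : measurable_fun setT X').

Lemma same_law_integral (f : U -> \bar R) : same_law P P' X X' ->
  measurable_fun setT f -> (forall u, 0 <= f u)%E ->
  (\int[P]_w f (X w) = \int[P']_w f (X' w))%E.
Proof.
move=> XX' mf f0.
have := ge0_integral_pushforward mX P measurableT mf (fun u _ => f0 u).
rewrite preimage_setT => <-.
have := ge0_integral_pushforward mX' P' measurableT mf (fun u _ => f0 u).
rewrite preimage_setT => <-.
by apply: eq_measure_integral => A mA _; exact: XX'.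
Qed.

End same_law_integral.

(** The summands are positive only almost surely. Truncation makes them nonnegative at every
    outcome, hence their transforms bounded by 1; [MPHstar_ae_eq] undoes it at the end. *)
Definition pos_part (R : realType) (z : R * R) : R * R :=
  (Num.max z.1 0, Num.max z.2 0).

(** * MPH* laws through their transforms *)

Section mph.
Context {R : realType}.

Lemma pos_part_ge0 (z : R * R) : 0 <= (pos_part z).1 /\ 0 <= (pos_part z).2.
Proof. by rewrite /= !le_max !lexx !orbT. Qed.

Lemma pos_part_id (z : R * R) : 0 <= z.1 -> 0 <= z.2 -> pos_part z = z.
Proof. by case: z => a b a0 b0; rewrite /pos_part !max_l. Qed.

Lemma measurable_pos_part : measurable_fun setT (@pos_part R).
Proof.
by apply/measurable_fun_pairP; split; apply: measurable_maxr => //.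
Qed.

Lemma measurable_laplace_integrand i j :
  measurable_fun setT (fun z : R * R => laplace_integrand z i j).
Proof.
by apply: measurable_funM; apply: measurable_funX;
  apply: (measurableT_comp (@measurable_expR R)); exact: measurableT_comp.
Qed.

Lemma laplace_integrand_ge0 (z : R * R) i j : 0 <= laplace_integrand z i j.
Proof. by rewrite mulr_ge0// exprn_ge0// expR_ge0. Qed.

Context {p : nat} {d : measure_display} {T : measurableType d}.
Variables (v : 'rV[R]_p) (S : 'M[R]_p) (Rw : 'M[R]_(2, p)).
Variables (P : probability T R) (X : T -> R * R).
Hypothesis mX : measurable_fun setT X.

Lemma MPHstar_laplace i j : MPHstar v S Rw P X ->
  (\int[P]_w (laplace_integrand (pos_part (X w)) i j)%:E =
   ((v *m laplace_vec S (i%:R *: row 0 Rw + j%:R *: row 1 Rw)) 0 0)%:E)%E.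
Proof.
move=> [hv hS Rw0 [d' [T' [P' [J [[Z [W [hZ [mW W0] hW J_jump J_expl]]] term law]]]]]].
have mZ : measurable_states Z by case: hZ.
have r0 k : nneg_mx (row k Rw) by move=> a b; rewrite mxE.
have mr k : measurable_fun setT (fun w => total_reward (row k Rw) (J ^~ w)).
  exact: (measurable_total_reward mZ mW W0 J_jump J_expl (r0 k 0)).
have mX' : measurable_fun setT (fun w =>
    (total_reward (row 0 Rw) (J ^~ w), total_reward (row 1 Rw) (J ^~ w))).
  by apply/measurable_fun_pairP; split; [exact: (mr 0)|exact: (mr 1)].
have mf : measurable_fun setT (fun z : R * R => (laplace_integrand (pos_part z) i j)%:E).
  apply/measurable_EFinP.
  exact: (measurableT_comp (measurable_laplace_integrand i j) measurable_pos_part).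
have := same_law_integral mX mX' law mf; rewrite /= => ->; last first.
  by move=> z; rewrite lee_fin laplace_integrand_ge0.
rewrite -(laplace_total_reward hS hv hZ mW W0 hW J_jump J_expl (r0 0) (r0 1)).
  apply: eq_integral => w _.
  by rewrite pos_part_id//=; apply: total_reward_ge0 => c; rewrite mxE.
exact: (ae_hit hS hv hZ mW W0 hW J_jump term).
Qed.

(** The witness process is built by [exists_jump_process]; its rewards have the prescribed
    integer-point transforms, and these determine the law. *)
Lemma laplace_MPHstar : probability_vector v -> subintensity S ->
  (forall k c, 0 <= Rw k c) -> (v *m laplace_vec S 0) 0 0 = 1 ->
  (forall w, 0 <= (X w).1 /\ 0 <= (X w).2) ->
  (forall i j, \int[P]_w (laplace_integrand (X w) i j)%:E =
   ((v *m laplace_vec S (i%:R *: row 0 Rw + j%:R *: row 1 Rw)) 0 0)%:E)%E ->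
  MPHstar v S Rw P X.
Proof.
move=> hv hS Rw0 L1 X0 lapl; have [E hE] := @unit_exponential R.
have [J [hJ term]] := exists_jump_process hS hv hE L1.
split => //; do 3 eexists; exists J; split; [exact: hJ|exact: term|].
case: hJ => Z [W [hZ [mW W0] hW J_jump J_expl]].
have mZ : measurable_states Z by case: hZ.
have r0 k : nneg_mx (row k Rw) by move=> a b; rewrite mxE.
have mr k : measurable_fun setT (fun w => total_reward (row k Rw) (J ^~ w)).
  exact: (measurable_total_reward mZ mW W0 J_jump J_expl (r0 k 0)).
apply: laplace_same_law => //.
- by apply/measurable_fun_pairP; split; [exact: (mr 0)|exact: (mr 1)].
- by move=> w; split; apply: total_reward_ge0 => c; rewrite mxE.
move=> i j; rewrite lapl.
rewrite -(laplace_total_reward hS hv hZ mW W0 hW J_jump J_expl (r0 0) (r0 1))//.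
exact: (ae_hit hS hv hZ mW W0 hW J_jump term).
Qed.

Lemma MPHstar_ae_eq (Y : T -> R * R) : measurable_fun setT Y ->
  {ae P, forall w, X w = Y w} -> MPHstar v S Rw P X -> MPHstar v S Rw P Y.
Proof.
move=> mY XY [hv hS Rw0 [d' [T' [P' [J [hJ term law]]]]]].
split => //; exists d', T', P', J; split => // A mA; rewrite -law//.
have pre (Z : T -> R * R) : measurable_fun setT Z -> measurable (Z @^-1` A).
  by move=> mZ; rewrite -[X in measurable X]setTI; exact: mZ.
rewrite -[X in P X]setIT -[X in _ = P X]setIT.
rewrite -(integral_indic _ measurableT (pre _ mX)) -(integral_indic _ measurableT (pre _ mY)).
apply: ge0_ae_eq_integral => //.
- by apply/measurable_EFinP; apply: measurable_indic; exact: pre.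
- by apply/measurable_EFinP; apply: measurable_indic; exact: pre.
apply: filterS XY => w XYw _; rewrite !indicE; congr (nat_of_bool _)%:R%:E.
by apply/idP/idP => /set_mem h; apply/mem_set; move: h; rewrite /preimage /= XYw.
Qed.

End mph.

Lemma measurable_random_index d du (T : measurableType d) (U : measurableType du)
    (N : T -> nat) (f : nat -> T -> U) : measurable_fun setT N ->
  (forall k, measurable_fun setT (f k)) -> measurable_fun setT (fun w => f (N w) w).
Proof.
move=> mN mf _ A mA; rewrite setTI.
rewrite [X in measurable X](_ : _ = \bigcup_k (N @^-1` [set k] `&` f k @^-1` A)).
  apply: bigcupT_measurable => k; apply: measurableI; rewrite -[X in measurable X]setTI;
    [exact: mN|exact: mf].
by apply/seteqP; split => w /= h; [exists (N w)|case: h => k _ [/= <-]].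
Qed.

Lemma measurable_set1_pair d1 d2 (T1 : measurableType d1) (T2 : measurableType d2)
    (x : T1 * T2) : measurable [set x.1] -> measurable [set x.2] -> measurable [set x].
Proof.
move=> m1 m2; rewrite [X in measurable X](_ : _ = [set x.1] `*` [set x.2]).
  exact: measurableX.
by apply/seteqP; split => [_ ->//|[y1 y2] [/= -> ->]]; case: x {m1 m2}.
Qed.

(** * Decomposition along the values of (tau_1, tau_2) *)

Section tau.
Context {R : realType} {m n : nat} {d : measure_display} {T : measurableType d}.
Variables (P : probability T R) (alpha : 'rV[R]_m) (Pm : 'M[R]_m)
  (U : 'M[R]_(m, n)) (Q1 Q2 : 'M[R]_n) (tau : T -> nat * nat).
Hypothesis mtau : measurable_fun setT tau.
Hypothesis htau : CDPH alpha Pm U Q1 Q2 P tau.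

Lemma CDPH_weighted x12 x1 x2 N :
  sum_max N (fun a b => pair_weight x12 x1 x2 a.+1 b.+1 *
    fine (P (tau @^-1` [set (a.+1, b.+1)]))) =
  \sum_i alpha 0 i * neumann_term (weighted_mx Pm U Q1 Q2 x12 x1 x2)
    (weighted_exit Pm U Q1 Q2 x12 x1 x2) N (stE i) 0.
Proof.
have [hpar [d' [T' [P' [M1 [M2 [hch law]]]]]]] := htau.
rewrite -(cdph_exit_law hpar hch) sum_maxZ; apply: eq_sum_max => a b.
rewrite pair_weightS -mulrA; congr (_ * (_ * fine _)).
have mab : measurable [set ((a.+1%:R : R)%:E, (b.+1%:R : R)%:E)].
  by apply: measurable_set1_pair; exact: emeasurable_set1.
transitivity (P ((fun w => (((tau w).1%:R : R)%:E, ((tau w).2%:R : R)%:E)) @^-1`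
    [set ((a.+1%:R : R)%:E, (b.+1%:R : R)%:E)])).
  congr (P _); apply/seteqP; split => w /=; first by move=> ->.
  case: (tau w) => x y /= [/eqP + /eqP]; rewrite !eqr_nat => /eqP -> /eqP ->//.
rewrite law//; congr (P' _); apply/seteqP; split => w /=.
  by move=> [/exit_timeS ? /exit_timeS ?].
by move=> [/exit_timeS -> /exit_timeS ->].
Qed.

(** An exit time is an infimum over positive times, so it is never 0; equality in law carries this
    over to [tau]. *)
Lemma CDPH_gt0 : {ae P, forall w, (0 < (tau w).1)%N /\ (0 < (tau w).2)%N}.
Proof.
have [hpar [d' [T' [P' [M1 [M2 [hch law]]]]]]] := htau.
have m0 : measurable [set (0%:R : R)%:E] by exact: emeasurable_set1.
exists (tau @^-1` ([set 0%N] `*` setT `|` setT `*` [set 0%N])); split.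
- rewrite -[X in measurable X]setTI; apply: mtau => //.
  by apply: measurableU; exact: measurableX.
- have := law ([set (0%:R : R)%:E] `*` setT `|` setT `*` [set (0%:R : R)%:E])
    (measurableU _ _ (measurableX m0 measurableT) (measurableX measurableT m0)).
  rewrite [X in _ = P' X](_ : _ = set0); last first.
    by apply/seteqP; split => // w [[/exit_time0]|[_ /exit_time0]].
  rewrite measure0 => <-; congr (P _).
  have z (k : nat) : (k%:R%:E = 0%:R%:E :> \bar R) <-> (k = 0%N).
    by split=> [[/eqP]|->//]; rewrite (eqr_nat _ _ 0) => /eqP.
  by apply/seteqP; split => w [[/= /z tw _]|[_ /= /z tw]]; [left|right|left|right].
- move=> w /= h; apply: contrapT => h0; apply: h; rewrite !lt0n.
  by split; apply/eqP => tw; apply: h0; [left|right].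
Qed.

(** Rewrites the three pieces as one sum over a finite type, to which the exchange with the integral
    applies. *)
Lemma sum_maxE N (c : nat -> nat -> R) : sum_max N c =
  \sum_(x : option ('I_N + 'I_N)) match x with
    | None => c N N | Some (inl a) => c a N | Some (inr b) => c N b end.
Proof. by rewrite sumr_option big_sumType. Qed.

Lemma sum_max_single N a0 b0 (x : R) :
  sum_max N (fun a b => ((a == a0) && (b == b0))%:R * x) = (N == maxn a0 b0)%:R * x.
Proof.
have one (k : nat) : \sum_(a < N) ((a : nat) == k)%:R = (k < N)%N%:R :> R.
  have [kN|Nk] := ltnP k N.
    rewrite (bigD1 (Ordinal kN))//= eqxx big1 ?addr0// => a ak.
    by case: eqP => // e; case/eqP: ak; apply: val_inj.
  rewrite big1// => a _; case: eqP => // e.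
  by move: (ltn_ord a); rewrite e ltnNge Nk.
rewrite /sum_max; under eq_bigr do rewrite -mulnb natrM -mulrA.
under [X in _ + (_ + X)]eq_bigr do rewrite andbC -mulnb natrM -mulrA.
rewrite -!mulr_suml !one !mulrA -!mulrDl -!natrM -!natrD.
congr (_%:R * _); lia.
Qed.

(** Almost every outcome lies in exactly one cell, both times being positive. Grouping the cells by
    their maximum gives a single series that can be matched with a Neumann series term by term. *)
Lemma integral_partition (f : T -> R) : bounded01 f ->
  (\int[P]_w (f w)%:E = \sum_(0 <= N <oo) (sum_max N (fun a b =>
     (\int[P]_w (\1_(tau @^-1` [set (a.+1, b.+1)]) w * f w))%R))%:E)%E.
Proof.
move=> f01; have [mf f01'] := f01.
have mab a b : measurable (tau @^-1` [set (a, b)]).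
  rewrite -[X in measurable X]setTI; apply: mtau => //.
  exact: measurable_set1_pair.
have bd a b : bounded01 (fun w => \1_(tau @^-1` [set (a, b)]) w * f w).
  by apply: bounded01M => //; exact: bounded01_indic.
pose g N w := sum_max N (fun a b => \1_(tau @^-1` [set (a.+1, b.+1)]) w * f w).
have gE w N : (0 < (tau w).1)%N /\ (0 < (tau w).2)%N ->
    g N w = (N.+1 == maxn (tau w).1 (tau w).2)%:R * f w.
  rewrite /g; case tw : (tau w) => [a b] /= [a0 b0].
  case: a a0 tw => // a _; case: b b0 => // b _ tw.
  rewrite maxnSS eqSS -sum_max_single; apply: eq_sum_max => a' b'.
  rewrite indicE; congr (_%:R * _); congr nat_of_bool.
  rewrite -xpair_eqE; apply/idP/eqP => [/set_mem /= tw'|[-> ->]].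
    by move: tw; rewrite tw' => -[<- <-].
  exact/mem_set.
pose part N (x : option ('I_N + 'I_N)) := match x with
  | None => (N, N) | Some (inl a) => (a : nat, N) | Some (inr b) => (N, b : nat) end.
pose G N x w := \1_(tau @^-1` [set ((@part N x).1.+1, (@part N x).2.+1)]) w * f w.
have bdG N x : bounded01 (@G N x) by exact: bd.
have gG N w : g N w = \sum_x @G N x w.
  by rewrite /g sum_maxE; apply: eq_bigr => -[[a|b]|] _.
have g0 N w : 0 <= g N w.
  by rewrite gG sumr_ge0// => x _; case: (bdG N x) => _ /(_ w)/andP[].
have mg N : measurable_fun setT (g N).
  rewrite (funext (gG N)).
  by apply: measurable_sum => x; case: (bdG N x).
transitivity (\int[P]_w (\sum_(0 <= N <oo) (g N w)%:E))%E.
  apply: ge0_ae_eq_integral => //.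
  - exact/measurable_EFinP.
  - by apply: ge0_emeasurable_sum => [N w _ _|N _]; [rewrite lee_fin|exact/measurable_EFinP].
  - by move=> w _; rewrite lee_fin; case/andP: (f01' w).
  - move=> w _; apply: nneseries_ge0 => N _ _.
    by rewrite lee_fin.
  apply: filterS CDPH_gt0 => w pos _.
  rewrite (nneseries_single (N := (maxn (tau w).1 (tau w).2).-1)) => [|k kN].
    by rewrite gE// prednK ?eqxx ?mul1r// leq_max pos.1.
  rewrite gE// -(prednK (n := maxn _ _)) ?leq_max ?pos.1// eqSS (negbTE kN).
  by rewrite mul0r.
rewrite integral_nneseries//; last 2 first.
- by move=> N; exact/measurable_EFinP.
- by move=> N w _; rewrite lee_fin.
apply: eq_eseriesr => N _; rewrite sum_maxE -sumEFin.
under eq_integral do rewrite gG -sumEFin.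
rewrite ge0_integral_sum//.
- by apply: eq_bigr => x _; rewrite Rintegral_EFin//; case: x => [[a|b]|].
- by move=> x; apply/measurable_EFinP; case: (bdG N x).
- by move=> x w _; rewrite lee_fin; case: (bdG N x) => _ /(_ w)/andP[].
Qed.

End tau.

(** * Independence of the summands and transform of the random sum *)

Section independence.
Context {R : realType} {d : measure_display} {T : measurableType d}.
Variable P : probability T R.
Local Notation leb := (@lebesgue_measure R).
Local Notation pdf := (@exponential_pdf R 1).

Lemma bounded01_expN (V : T -> \bar R) : measurable_fun setT V ->
  (forall w, 0 <= V w)%E -> bounded01 (fun w => expN (V w)).
Proof.
move=> mV V0; split; last by move=> w; rewrite expN_ge0 expN_le1.
by apply: measurableT_comp => //; exact: measurable_expN.
Qed.

(** The tails are monotone, hence measurable in the threshold. The same replacement of indicators by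
    exponentials is run twice: with all factors on [E], and with a single factor and weight 1 to
    identify [1 - I i] as its mean. *)
Lemma integral_independent_expN (E : set T) (n : nat) (V : nat -> T -> \bar R) :
  measurable E -> (forall i, measurable_fun setT (V i)) ->
  (forall i w, 0 <= V i w)%E ->
  (forall t : nat -> R,
    P (E `&` [set w | forall i, (i < n)%N -> ((t i)%:E < V i w)%E]) =
    (P E * \prod_(0 <= i < n) P [set w | ((t i)%:E < V i w)%E])%E) ->
  (\int[P]_w (\1_E w * \prod_(0 <= i < n) expN (V i w))%:E =
   (fine (P E) * \prod_(0 <= i < n) (\int[P]_w expN (V i w))%R)%:E)%E.
Proof.
move=> mE mV V0 tails.
have mtail i s : measurable [set w | (s%:E < V i w)%E].
  by have := emeasurable_fun_o_infty measurableT (mV i) s%:E; rewrite setTI.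
pose g i s := fine (P [set w | (s%:E < V i w)%E]).
have g0 i s : 0 <= g i s by exact: fine_ge0.
have g1 i s : g i s <= 1.
  by rewrite -lee_fin (measurable_fin_prob P (mtail i s)) probability_le1.
have mg i : measurable_fun setT (g i).
  apply: nonincreasing_measurable => // s t st.
  rewrite fine_le ?fin_num_measure//.
  apply: le_measure; rewrite ?inE//.
  by move=> w /=; apply: le_lt_trans; rewrite lee_fin.
have mpg i : measurable_fun setT (fun s => (pdf s * g i s)%:E).
  apply/measurable_EFinP; apply: measurable_funM => //.
  exact: measurable_exponential_pdf.
have pdf0 s : 0 <= pdf s by exact: exponential_pdf_ge0.
pose I i := fine (\int[leb]_s (pdf s * g i s)%:E)%E.
have intg i : (\int[leb]_s (pdf s * g i s)%:E = (I i)%:E)%E.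
  rewrite fineK// ge0_fin_numE; last first.
    by apply: integral_ge0 => s _; rewrite lee_fin mulr_ge0.
  apply: (@le_lt_trans _ _ 1%E); last by rewrite ltry.
  rewrite -(@integral_exponential_pdf R 1 ltr01).
  apply: (@ge0_le_integral _ _ _ leb setT) => //.
  - by move=> s _; rewrite lee_fin mulr_ge0.
  - exact: mpg.
  - by apply/measurable_EFinP; exact: measurable_exponential_pdf.
  - by move=> s _; rewrite lee_fin ler_piMr.
have IE i : (\int[P]_w expN (V i w))%R = 1 - I i.
  apply: EFin_inj; rewrite -Rintegral_EFin; last exact: bounded01_expN.
  have h : (\int[P]_w (cst 1 w * expN (V i w))%:E = (1 * (1 - I i))%:E)%E.
    apply: (integral_expN_tail (g := g i)) => //.
    - by move=> w; rewrite /= ler01 lexx.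
    - by rewrite -[RHS](probability_setT P) -[RHS]mul1e -integral_cst.
    move=> s _; rewrite mul1r measurable_fin_prob//.
    rewrite -[X in _ = P X]setIT -(integral_indic _ measurableT (mtail i s)).
    apply: eq_integral => w _; rewrite indicE /= mul1r; congr (nat_of_bool _)%:R%:E.
    by apply/idP/idP => [h|/set_mem//]; exact/mem_set.
  by rewrite mul1r in h; rewrite -h; apply: eq_integral => w _; rewrite /= mul1r.
under eq_bigr do rewrite IE.
apply: (@integral_prod_expN R d T P E n V _ g) => //; last first.
  move=> i s s0; rewrite /g (_ : [set w | _] = setT) ?probability_setT//.
  by apply/seteqP; split => // w _ /=; rewrite (lt_le_trans _ (V0 i w)) ?lte_fin.
move=> t; rewrite tails EFinM measurable_fin_prob//; congr (_ * _)%E.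
by rewrite -prodEFin; apply: eq_bigr => i _; rewrite /g measurable_fin_prob.
Qed.

Variables (dv : measure_display) (K : measurableType dv) (X : nat -> T -> R * R)
  (tau : T -> K).
Hypothesis mX : forall l, measurable_fun setT (X l).
Hypothesis mtau : measurable_fun setT tau.
Hypothesis hindX : mutually_independent P X.
Hypothesis hindtau : independent_of P X tau.

Lemma integral_independent_laplace (B : set K) n (k1 k2 : nat -> nat) : measurable B ->
  (\int[P]_w (\1_(tau @^-1` B) w *
     \prod_(0 <= l < n) laplace_integrand (pos_part (X l w)) (k1 l) (k2 l))%:E =
   (fine (P (tau @^-1` B)) *
    \prod_(0 <= l < n) (\int[P]_w laplace_integrand (pos_part (X l w)) (k1 l) (k2 l))%R)%:E)%E.
Proof.
move=> mB; have mE : measurable (tau @^-1` B).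
  by rewrite -[X in measurable X]setTI; exact: mtau.
(* A Laplace factor is exp of minus a linear form in the truncated vector, so its tails are events
   on [X l] alone, the kind on which independence is stated. *)
pose f l (z : R * R) := (k1 l)%:R * (pos_part z).1 + (k2 l)%:R * (pos_part z).2.
have mf l : measurable_fun setT (f l).
  apply: measurable_funD; apply: measurable_funM => //;
    apply: (measurableT_comp _ (@measurable_pos_part R)) => //.
have f0 l z : 0 <= f l z.
  by have [z1 z2] := pos_part_ge0 z; rewrite addr_ge0// mulr_ge0.
pose V l w := (f l (X l w))%:E.
have VE l w : laplace_integrand (pos_part (X l w)) (k1 l) (k2 l) = expN (V l w).
  by rewrite /laplace_integrand -!expRM_natl -expRD !mulrN -opprD.
under eq_integral do under eq_bigr do rewrite VE.
under [X in _ = (_ * X)%:E]eq_bigr do under eq_Rintegral do rewrite VE.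
apply: integral_independent_expN => //.
  by move=> l; apply/measurable_EFinP; exact: measurableT_comp.
  by move=> l w; rewrite lee_fin.
move=> t; pose A l := [set z | ((t l)%:E < (f l z)%:E)%E].
have mA l : measurable (A l).
  have mfl : measurable_fun setT (fun z => (f l z)%:E) by exact/measurable_EFinP.
  by have := emeasurable_fun_o_infty measurableT mfl (t l)%:E; rewrite setTI.
have := hindtau (iota 0 n) mA mB.
rewrite (hindX (iota_uniq 0 n) mA) /index_iota subn0 => ind.
rewrite [RHS]muleC -[RHS]ind -bigcap_seq; congr (P _).
rewrite setIC; congr (_ `&` _); apply/seteqP; split => w /= h l.
  by rewrite /= mem_iota add0n => /h.
by move=> ln; have := h l; rewrite /= mem_iota add0n => /(_ ln).
Qed.

End independence.

Section weights.
Context {R : realType}.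

Lemma prod_pair_weight (x12 x1 x2 : R) a b :
  \prod_(0 <= l < maxn a b) (if (l < a)%N then if (l < b)%N then x12 else x1 else x2) =
  pair_weight x12 x1 x2 a b.
Proof.
elim: a b => [|a IH] [|b].
- by rewrite big_geq// /pair_weight !expr0 !mulr1.
- by rewrite pair_weight0l max0n big_const_nat iter_mulr mulr1 subn0.
- by rewrite pair_weight0r maxn0 [LHS](eq_big_nat _ _ (F2 := fun=> x1)) => [|l /andP[_ ->]//];
    rewrite big_const_nat iter_mulr mulr1 subn0.
by rewrite maxnSS big_nat_recl// pair_weightS -IH.
Qed.

(** The two sums have different lengths; both become products over the longer range once the
    exponent is set to 0 beyond the end of each sum. *)
Lemma laplace_integrand_sum (z : nat -> R * R) a b i j :
  laplace_integrand (\sum_(l < a) (z l).1, \sum_(l < b) (z l).2) i j =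
  \prod_(0 <= l < maxn a b) laplace_integrand (z l)
    (if (l < a)%N then i else 0) (if (l < b)%N then j else 0).
Proof.
have half (f : nat -> R) c k : (c <= maxn a b)%N ->
    expR (- \sum_(l < c) f l) ^+ k =
    \prod_(0 <= l < maxn a b) expR (- f l) ^+ (if (l < c)%N then k else 0).
  move=> cab; rewrite -sumrN expR_sum -prodrXl.
  rewrite -(big_mkord xpredT (fun l => expR (- f l) ^+ k)).
  rewrite (big_nat_widen _ _ _ _ _ cab) big_mkcond; apply: eq_bigr => l _ /=.
  by case: ifP => //; rewrite expr0.
rewrite /laplace_integrand/= (half (fun l => (z l).1)) ?leq_maxl//.
by rewrite (half (fun l => (z l).2)) ?leq_maxr// -big_split.
Qed.

Context {m n : nat}.
Variables (alpha : 'rV[R]_m) (Pm : 'M[R]_m) (U : 'M[R]_(m, n)) (Q1 Q2 : 'M[R]_n).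
Hypothesis hpar : CDPH_parameters alpha Pm U Q1 Q2.

Local Notation PM := (pair_mx Pm U Q1 Q2).

Lemma subprobability_exit_ge0 k (A : 'M[R]_k) :
  subprobability A -> nneg_mx (exit_vec A).
Proof. by move=> [_ A1] i j; rewrite ord1 exit_vecE subr_ge0. Qed.

Lemma CDPH_pair_mx_ge0 : nneg_mx PM.
Proof.
case: hpar => _ [P1 sQ1 sQ2] U0 _ _.
by apply: pair_mx_ge0; try exact: subprobability_exit_ge0; case: P1 sQ1 sQ2 => ? _ [? _] [? _].
Qed.

Lemma CDPH_pair_exit_ge0 : nneg_mx (exit_vec PM).
Proof.
case: hpar => _ [P1 sQ1 sQ2] U0 PU1 _.
have q1 := subprobability_exit_ge0 sQ1; have q2 := subprobability_exit_ge0 sQ2.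
move=> x j; rewrite ord1; move: x; apply: nblocks_ind => [i|j1 j2|k|k].
- by rewrite pair_exitE.
- by rewrite pair_exitSS mulr_ge0.
- by rewrite pair_exitD1.
- by rewrite pair_exitD2.
Qed.

Variables (x12 x1 x2 : R).
Hypotheses (x12_01 : 0 <= x12 <= 1) (x1_01 : 0 <= x1 <= 1) (x2_01 : 0 <= x2 <= 1).

Lemma block_fun01 (x : 'I_(nblocks m n)) : 0 <= block_fun x12 x1 x2 x 0 <= 1.
Proof.
move: x; apply: nblocks_ind => *;
  by rewrite ?(block_funE, block_funSS, block_funD1, block_funD2).
Qed.

End weights.

Definition random_sum (R : realType) (T : Type) (tau : T -> nat * nat)
    (X : nat -> T -> R * R) (w : T) : R * R :=
  (\sum_(l < (tau w).1) (X l w).1, \sum_(l < (tau w).2) (X l w).2).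

Lemma measurable_random_sum (R : realType) d (T : measurableType d)
    (tau : T -> nat * nat) (X : nat -> T -> R * R) : measurable_fun setT tau ->
  (forall l, measurable_fun setT (X l)) -> measurable_fun setT (random_sum tau X).
Proof.
move=> mtau mX; apply/measurable_fun_pairP; split.
  apply: (measurable_random_index (N := fst \o tau)
    (f := fun k w => \sum_(l < k) (X l w).1)); first exact: measurableT_comp.
  by move=> k; apply: measurable_sum => l; exact: measurableT_comp.
apply: (measurable_random_index (N := snd \o tau)
  (f := fun k w => \sum_(l < k) (X l w).2)); first exact: measurableT_comp.
by move=> k; apply: measurable_sum => l; exact: measurableT_comp.
Qed.

Section random_sum.
Context {R : realType} {m n : nat} {d : measure_display} {T : measurableType d}.
Variables (P : probability T R) (alpha : 'rV[R]_m) (Pm : 'M[R]_m)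
  (U : 'M[R]_(m, n)) (Q1 Q2 : 'M[R]_n) (tau : T -> nat * nat) (X : nat -> T -> R * R)
  (phi : nat -> nat -> R).
Hypothesis mtau : measurable_fun setT tau.
Hypothesis mX : forall l, measurable_fun setT (X l).
Hypothesis htau : CDPH alpha Pm U Q1 Q2 P tau.
Hypothesis hindX : mutually_independent P X.
Hypothesis hindtau : independent_of P X tau.
Hypothesis hphi : forall l i j,
  (\int[P]_w (laplace_integrand (pos_part (X l w)) i j)%:E = (phi i j)%:E)%E.

Local Notation Y := (random_sum tau (fun l w => pos_part (X l w))).

Lemma random_sum_ge0 w : 0 <= (Y w).1 /\ 0 <= (Y w).2.
Proof. by split; apply: sumr_ge0 => l _; have [] := pos_part_ge0 (X l w). Qed.

Let mpX l : measurable_fun setT (fun w => pos_part (X l w)).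
Proof. by apply: measurableT_comp => //; exact: measurable_pos_part. Qed.

Lemma laplace_integrand01 (z : R * R) i j : 0 <= z.1 -> 0 <= z.2 ->
  0 <= laplace_integrand z i j <= 1.
Proof.
move=> z1 z2; rewrite laplace_integrand_ge0/= mulr_ile1 ?exprn_ge0 ?expR_ge0//.
  by rewrite exprn_ile1 ?expR_ge0// expR_le1 oppr_le0.
by rewrite exprn_ile1 ?expR_ge0// expR_le1 oppr_le0.
Qed.

Lemma bounded01_laplace_integrand (Y : T -> R * R) i j : measurable_fun setT Y ->
  (forall w, 0 <= (Y w).1 /\ 0 <= (Y w).2) ->
  bounded01 (fun w => laplace_integrand (Y w) i j).
Proof.
move=> mY Y0; split.
  exact: (measurableT_comp (measurable_laplace_integrand i j) mY).
by move=> w; have [Y1 Y2] := Y0 w; exact: laplace_integrand01.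
Qed.

Let bdX l i j : bounded01 (fun w => laplace_integrand (pos_part (X l w)) i j).
Proof.
by apply: bounded01_laplace_integrand => // w; exact: pos_part_ge0.
Qed.

Lemma phi01 i j : 0 <= phi i j <= 1.
Proof.
have := Rintegral_bounded01 P (bdX 0%N i j).
by have := hphi 0%N i j; rewrite Rintegral_EFin// => -[->].
Qed.

Lemma laplace_random_sum i j :
  (\int[P]_w (laplace_integrand (Y w) i j)%:E =
   (\sum_k alpha 0 k *
     neumann_sum (weighted_mx Pm U Q1 Q2 (phi i j) (phi i 0) (phi 0 j))
       (weighted_exit Pm U Q1 Q2 (phi i j) (phi i 0) (phi 0 j)) (stE k) 0)%:E)%E.
Proof.
rewrite (integral_partition mtau htau); last first.
  apply: bounded01_laplace_integrand; first exact: measurable_random_sum.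
  exact: random_sum_ge0.
pose u : 'rV[R]_(nblocks m n) := row_mx alpha 0.
have uE (y : 'cV[R]_(nblocks m n)) : (u *m y) 0 0 = \sum_k alpha 0 k * y (stE k) 0.
  rewrite mxE big_split_ord/= [X in _ + X]big1 ?addr0 => [|k _].
    by apply: eq_bigr => k _; rewrite row_mxEl.
  by rewrite row_mxEr mxE mul0r.
have [hpar _] := htau; have [[alpha0 _] _ _ _ _] := hpar.
have u0 : nneg_mx u.
  move=> k l; rewrite ord1 mxE; case: splitP => [i' _|i' _]; first exact: alpha0.
  by rewrite mxE.
have w01 := block_fun01 (m := m) (n := n) (phi01 i j) (phi01 i 0) (phi01 0 j).
rewrite -uE -(nneseries_neumann (scaled_mx_ge0 w01 (CDPH_pair_mx_ge0 hpar))
  (scaled_exit_ge0 w01 (CDPH_pair_exit_ge0 hpar)) (@ones_ge0 _ _)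
  (scaled_mx_ones _ w01) u0).
apply: eq_eseriesr => N _; congr EFin; rewrite uE -(CDPH_weighted htau).
apply: eq_sum_max => a b.
have := integral_independent_laplace mX mtau hindX hindtau (maxn a.+1 b.+1)
  (fun l => if (l < a.+1)%N then i else 0%N)
  (fun l => if (l < b.+1)%N then j else 0%N) (measurable_set1_pair (x := (a.+1, b.+1)) I I).
rewrite Rintegral_EFin; last first.
  apply: bounded01M; last by apply: bounded01_prod => l; exact: bdX.
  apply: bounded01_indic; rewrite -[X in measurable X]setTI; apply: mtau => //.
  exact: measurable_set1_pair.
move=> [h]; rewrite mulrC -prod_pair_weight.
rewrite [X in _ = _ * X](eq_big_nat _ _ (F2 := fun l =>
    (\int[P]_w laplace_integrand (pos_part (X l w))
       (if (l < a.+1)%N then i else 0%N) (if (l < b.+1)%N then j else 0%N))%R)).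
  rewrite -h; apply: eq_Rintegral => w _; rewrite !indicE.
  have [/set_mem /= tw|] := boolP (w \in _); last by rewrite !mul0r.
  by rewrite /random_sum tw (laplace_integrand_sum (fun l => pos_part (X l w))).
move=> l /andP[_ lab]; apply: EFin_inj; rewrite -Rintegral_EFin// hphi.
(* Below the maximum at least one of the two sums is still running, so [phi 0 0] never occurs. *)
by move: lab; rewrite leq_max; case: (l < a.+1)%N => [_|/= ->]; [case: ifP|].
Qed.

End random_sum.

(** * The compound process *)

Section kronecker_process.
Context {R : realType} {q p : nat}.
Variables (A : 'M[R]_q) (v : 'rV[R]_p) (S : 'M[R]_p) (th : 'rV[R]_(q * p)).
Hypotheses (A0 : nneg_mx A) (e0 : nneg_mx (exit_vec A)).
Hypotheses (hv : probability_vector v) (hS : subintensity S).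

(** The shape of [compound_mx] for a general [A], so that the comparison of transforms is separated
    from the block structure of [pair_mx]. *)
Definition kronecker_mx : 'M[R]_(q * p) :=
  (1%:M : 'M[R]_q) *t S + A *t (- (S *m ones p *m v)).

Let s c := - \sum_j S c j.
Let s0 c : 0 <= s c. Proof. by rewrite oppr_ge0; case: hS. Qed.
Let v0 : nneg_mx v. Proof. by move=> k l; rewrite ord1; case: hv. Qed.

Lemma kronecker_mxE a c b c' :
  kronecker_mx (mxtens_index (a, c)) (mxtens_index (b, c')) =
  (a == b)%:R * S c c' + A a b * (s c * v 0 c').
Proof.
rewrite mxE !tensmxE; congr (_ + _); first by rewrite [1%:M a b]mxE.
by congr (_ * _); rewrite mxE mxE big_ord1 mulmx_onesE mulNr.
Qed.

Lemma kronecker_mx_sum a c (F : 'cV[R]_(q * p)) :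
  (kronecker_mx *m F) (mxtens_index (a, c)) 0 =
  (S *m (\col_c' F (mxtens_index (a, c')) 0)) c 0 +
  s c * \sum_b A a b * \sum_c' v 0 c' * F (mxtens_index (b, c')) 0.
Proof.
rewrite mxE sum_mxtens.
under eq_bigr do under eq_bigr do rewrite kronecker_mxE mulrDl.
under eq_bigr do rewrite big_split/=.
rewrite big_split/=; congr (_ + _).
  rewrite (bigD1 a)//= [X in _ + X]big1 ?addr0 => [|b ba].
    by rewrite mxE; apply: eq_bigr => c' _; rewrite eqxx mul1r mxE.
  by rewrite big1// => c' _; rewrite eq_sym (negbTE ba) !mul0r.
rewrite mulr_sumr; apply: eq_bigr => b _; rewrite !mulr_sumr.
by apply: eq_bigr => c' _; ring.
Qed.

(** The process terminates from (a, c) when the current copy of the process in C terminates and the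
    chain of matrix [A] stops at the same moment; the unit mass of [v] makes the restarts
    balance. *)
Lemma kronecker_mx_row a c :
  \sum_y kronecker_mx (mxtens_index (a, c)) y = - (s c * exit_vec A a 0).
Proof.
rewrite -mulmx_onesE kronecker_mx_sum.
rewrite [X in (S *m X) c 0](_ : _ = ones p); last by apply/colP => k; rewrite !mxE.
rewrite mulmx_onesE exit_vecE.
rewrite [X in s c * X](_ : _ = \sum_b A a b); first by rewrite /s; ring.
apply: eq_bigr => b _; rewrite [X in _ * X](_ : _ = 1) ?mulr1//.
case: hv => _ <-; apply: eq_bigr => c' _; by rewrite mxE mulr1.
Qed.

Lemma kronecker_subintensity : subintensity kronecker_mx.
Proof.
split=> [x y|x].
  case: (mxtens_indexP x) => a c; case: (mxtens_indexP y) => b c' xy.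
  rewrite kronecker_mxE addr_ge0//; last by rewrite mulr_ge0// mulr_ge0//.
  have [ab|] := eqVneq a b; last by rewrite mul0r.
  rewrite mul1r; case: hS => S0 _; apply: S0; apply: contraNneq xy => cc'.
  by rewrite ab cc'.
case: (mxtens_indexP x) => a c.
by rewrite kronecker_mx_row oppr_le0 mulr_ge0.
Qed.

Hypothesis th0 : nneg_mx th.
Let row_th a : 'rV[R]_p := \row_c th 0 (mxtens_index (a, c)).
Let row_th0 a : nneg_mx (row_th a). Proof. by move=> k l; rewrite mxE. Qed.
Let x a := (v *m laplace_vec S (row_th a)) 0 0.
Let W := scaled_mx x A.
Let e := scaled_exit x A.
Let L := laplace_vec kronecker_mx th.
Let G : 'cV[R]_q := \col_a \sum_c v 0 c * L (mxtens_index (a, c)) 0.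

Let x01 a : 0 <= x a <= 1.
Proof.
rewrite /x mxE; apply/andP; split.
  by apply: sumr_ge0 => c _; rewrite mulr_ge0// laplace_vec_ge0.
case: hv => _ <-; apply: ler_sum => c _.
by rewrite ler_piMr// (le_trans (laplace_vec_le1 hS (row_th0 a) c 0))// mxE.
Qed.

Let W0 : nneg_mx W. Proof. exact: scaled_mx_ge0. Qed.
Let e'0 : nneg_mx e. Proof. exact: scaled_exit_ge0. Qed.
Let W1 : le_mx (W *m ones q + e) (ones q). Proof. exact: scaled_mx_ones. Qed.

(** Mean transform of what follows a sojourn in block [a]: the value at the next block, or 1 if the
    chain stops. *)
Let g (y : 'cV[R]_q) a := \sum_b A a b * y b 0 + exit_vec A a 0.

Let WE y a : (W *m y + e) a 0 = x a * g y a.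
Proof.
rewrite mxE [e _ _]mxE [(W *m y) a 0]mxE mulrDr mulr_sumr; congr (_ + _).
by apply: eq_bigr => b _; rewrite mxE mulrA.
Qed.

Let gE (y : 'cV[R]_q) a : nneg_mx y -> 0 <= g y a.
Proof.
by move=> y0; rewrite addr_ge0// sumr_ge0// => b _; rewrite mulr_ge0.
Qed.

Let L0 : nneg_mx L. Proof. exact: (laplace_vec_ge0 kronecker_subintensity th0). Qed.

Let G0 : nneg_mx G.
Proof. by move=> a j; rewrite mxE sumr_ge0// => c _; rewrite mulr_ge0. Qed.

(** For fixed [a], the slice of [L] solves the system of [S] with exit rates multiplied by [g G a],
    hence dominates [g G a] times the Laplace vector of a sojourn. Averaging over [v] makes [G] a
    supersolution for the scaled matrix. *)
Let G_ge : le_mx (neumann_sum W e) G.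
Proof.
rewrite -[X in le_mx X _]scale1r.
apply: (neumann_sum_min W0 e'0 (@ones_ge0 R q) W1) => //.
move=> a j; rewrite ord1 scale1r WE.
have := @laplace_vec_min R p S (row_th a) hS (row_th0 a)
  (\col_c L (mxtens_index (a, c)) 0) (g G a) (gE a G0).
have -> : G a 0 = \sum_c v 0 c * (\col_c L (mxtens_index (a, c)) 0 : 'cV[R]_p) c 0.
  by rewrite mxE; apply: eq_bigr => c _; rewrite mxE.
move=> h; rewrite /x mxE mulr_suml; apply: ler_sum => c _.
rewrite -mulrA ler_wpM2l// mulrC.
suff /(_ c 0) : le_mx (g G a *: laplace_vec S (row_th a))
    (\col_c L (mxtens_index (a, c)) 0) by rewrite [X in X <= _]mxE.
apply: h => [c' k|c']; first by rewrite mxE.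
rewrite [row_th a 0 c']mxE [in LHS]mxE.
have := laplace_vec_resolvent kronecker_subintensity th0 (mxtens_index (a, c')).
rewrite -/L => ->; rewrite kronecker_mx_row kronecker_mx_sum -addrA; congr (_ + _).
rewrite opprK -mulrDr -mulrN -/(s c') mulrC; congr (_ * _); congr (_ + _).
by apply: eq_bigr => b _; rewrite [G b 0]mxE.
Qed.

(** Conversely, the product [C] of the sojourn transform from [c] with the mean transform [g H a] of
    the rest solves the system of the full process, so it dominates [L]; averaging over [v] recovers
    [H]. *)
Let G_le : le_mx G (neumann_sum W e).
Proof.
set H := neumann_sum W e.
have H0 : nneg_mx H by exact: (neumann_sum_ge0 W0 e'0 (@ones_ge0 R q) W1).
have HE a : H a 0 = x a * g H a.
  by rewrite -WE -(neumann_sum_fix W0 e'0 (@ones_ge0 R q) W1).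
pose C : 'cV[R]_(q * p) := \col_y (laplace_vec S (row_th (mxtens_unindex y).1)
  (mxtens_unindex y).2 0 * g H (mxtens_unindex y).1).
have CE a c : C (mxtens_index (a, c)) 0 = laplace_vec S (row_th a) c 0 * g H a.
  by rewrite [LHS]mxE mxtens_indexK.
have vC a : \sum_c v 0 c * C (mxtens_index (a, c)) 0 = H a 0.
  rewrite HE /x mxE mulr_suml; apply: eq_bigr => c _.
  by rewrite CE mulrA.
have C0 : nneg_mx C.
  move=> y k; rewrite ord1; case: (mxtens_indexP y) => a c.
  by rewrite CE mulr_ge0 ?gE// laplace_vec_ge0.
have := @laplace_vec_min R _ kronecker_mx th kronecker_subintensity th0 C 1 ler01 C0.
rewrite scale1r => LC a k; rewrite ord1 -vC mxE; apply: ler_sum => c _.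
rewrite ler_wpM2l//; apply: LC => y; case: (mxtens_indexP y) => {}a {}c.
rewrite mul1r kronecker_mx_row kronecker_mx_sum opprK CE.
have := laplace_vec_resolvent hS (row_th0 a) c; rewrite [row_th a 0 c]mxE mulrA => ->.
rewrite -/(s c) mulrDl -addrA -mulrDr; congr (_ + _).
  rewrite !mxE mulr_suml; apply: eq_bigr => c' _; rewrite -mulrA; congr (_ * _).
  by rewrite [in RHS]mxE CE.
by congr (_ * (_ + _)); apply: eq_bigr => b _; rewrite vC.
Qed.

(* A visit to [{a} x C] is a copy of the process of matrix [S] started at [v], so
   it contributes the factor [x a], and the successive visits follow [A]. Both
   inequalities come from the minimality of Neumann sums. *)
Lemma kronecker_laplace a :
  \sum_c v 0 c * laplace_vec kronecker_mx th (mxtens_index (a, c)) 0 =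
  neumann_sum (scaled_mx x A) (scaled_exit x A) a 0.
Proof.
have := G_le a 0; have := G_ge a 0; rewrite [G a 0]mxE => h1 h2.
by apply/eqP; rewrite eq_le h1 h2.
Qed.

End kronecker_process.

Section compound.
Context {R : realType} {m n p : nat}.
Variables (alpha : 'rV[R]_m) (v : 'rV[R]_p) (Rw : 'M[R]_(2, p)).

Lemma tens_rowE q (u : 'rV[R]_q) b c :
  (u *t v : 'rV[R]_(q * p)) 0 (mxtens_index (b, c)) = u 0 b * v 0 c.
Proof. by rewrite mxE mxtens_indexK !ord1. Qed.

Lemma compound_initE b c :
  compound_init n alpha v 0 (mxtens_index (b, c)) =
  (row_mx alpha 0 : 'rV[R]_(nblocks m n)) 0 b * v 0 c.
Proof. by rewrite /compound_init tens_rowE !row_mx0. Qed.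

Lemma compound_init_mulmx (y : 'cV[R]_(nblocks m n * p)) :
  (compound_init n alpha v *m y) 0 0 =
  \sum_k alpha 0 k * \sum_c v 0 c * y (mxtens_index (stE k, c)) 0.
Proof.
rewrite mxE sum_mxtens big_split_ord/= [X in _ + X]big1 ?addr0 => [|b _].
  apply: eq_bigr => k _; rewrite mulr_sumr; apply: eq_bigr => c _.
  by rewrite compound_initE row_mxEl mulrA.
by rewrite big1// => c _; rewrite compound_initE row_mxEr mxE !mul0r.
Qed.

Lemma compound_rewardE1 b c :
  compound_reward m n Rw 0 (mxtens_index (b, c)) = block_fun 1 1 0 b 0 * Rw 0 c.
Proof.
have e0 : (0 : 'I_2) = lshift 1 (0 : 'I_1) by exact: val_inj.
rewrite {1}e0 /compound_reward (col_mxEu _ _ (0 : 'I_1)).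
rewrite mxE mxtens_indexK [row _ _ _ _]mxE; congr (_ * _).
move: b; apply: nblocks_ind => [k|j1 j2|k|k].
- by rewrite block_funE row_mxEl !mxE.
- by rewrite block_funSS row_mxEr row_mxEl !mxE.
- by rewrite block_funD1 !row_mxEr row_mxEl !mxE.
- by rewrite block_funD2 !row_mxEr !mxE.
Qed.

Lemma compound_rewardE2 b c :
  compound_reward m n Rw 1 (mxtens_index (b, c)) = block_fun 1 0 1 b 0 * Rw 1 c.
Proof.
have e1 : (1 : 'I_2) = rshift 1 (0 : 'I_1) by exact: val_inj.
have -> : compound_reward m n Rw 1 (mxtens_index (b, c)) =
    compound_reward m n Rw (rshift 1 (0 : 'I_1)) (mxtens_index (b, c)).
  by congr (compound_reward m n Rw _ _).
apply: etrans; first exact: (@col_mxEd _ 1 1 _ _ _ (0 : 'I_1)).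
rewrite mxE mxtens_indexK [row _ _ _ _]mxE; congr (_ * _).
move: b; apply: nblocks_ind => [k|j1 j2|k|k].
- by rewrite block_funE row_mxEl !mxE.
- by rewrite block_funSS row_mxEr row_mxEl !mxE.
- by rewrite block_funD1 !row_mxEr row_mxEl !mxE.
- by rewrite block_funD2 !row_mxEr !mxE.
Qed.

Lemma compound_reward_ge0 : nneg_mx Rw -> nneg_mx (compound_reward m n Rw).
Proof.
move=> Rw0 k y; case: (mxtens_indexP y) => b c.
have b01 (x12 x1 x2 : R) : 0 <= x12 <= 1 -> 0 <= x1 <= 1 -> 0 <= x2 <= 1 ->
    0 <= block_fun x12 x1 x2 b 0.
  by move=> h12 h1 h2; case/andP: (block_fun01 h12 h1 h2 b).
have : (k == 0) || (k == 1) by case: k => -[|[|]].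
by case/orP => /eqP ->; rewrite ?compound_rewardE1 ?compound_rewardE2 mulr_ge0// b01//
  ?lexx ?ler01.
Qed.

Lemma row_combinationE q (x y : R) (r : 'M[R]_(2, q)) c :
  (x *: row 0 r + y *: row 1 r) 0 c = x * r 0 c + y * r 1 c.
Proof. by rewrite !mxE. Qed.

(** On the block where only one component is alive the other coefficient is replaced by 0, which is
    how the transforms with one zero argument arise. *)
Lemma compound_reward_combination i j b :
  \row_c (i *: row 0 (compound_reward m n Rw) +
          j *: row 1 (compound_reward m n Rw)) 0 (mxtens_index (b, c)) =
  (block_fun i i 0 b 0) *: row 0 Rw + (block_fun j 0 j b 0) *: row 1 Rw.
Proof.
apply/rowP => c; rewrite [LHS]mxE !row_combinationE.
rewrite compound_rewardE1 compound_rewardE2 !mulrA; congr (_ * _ + _ * _);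
  by move: b; apply: nblocks_ind => *;
    rewrite ?(block_funE, block_funSS, block_funD1, block_funD2) ?mulr0 ?mulr1.
Qed.

Lemma compound_init_probability : probability_vector alpha -> probability_vector v ->
  probability_vector (compound_init n alpha v).
Proof.
move=> [alpha0 alpha1] [v0 v1]; split.
  move=> y; case: (mxtens_indexP y) => b c; rewrite compound_initE mulr_ge0//.
  by rewrite mxE; case: splitP => // j _; rewrite mxE.
have := compound_init_mulmx (ones _); rewrite mulmx_onesE => ->.
rewrite -alpha1; apply: eq_bigr => k _; rewrite -[RHS]mulr1 -v1; congr (_ * _).
by apply: eq_bigr => c _; rewrite mxE mulr1.
Qed.

Variables (Pm : 'M[R]_m) (U : 'M[R]_(m, n)) (Q1 Q2 : 'M[R]_n) (S : 'M[R]_p).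
Hypotheses (hpar : CDPH_parameters alpha Pm U Q1 Q2) (hv : probability_vector v)
  (hS : subintensity S) (Rw0 : nneg_mx Rw).

Lemma compound_subintensity : subintensity (compound_mx Pm U Q1 Q2 v S).
Proof.
apply: (kronecker_subintensity _ _ hv hS).
  exact: (CDPH_pair_mx_ge0 hpar).
exact: (CDPH_pair_exit_ge0 hpar).
Qed.

Let phi i j : R := (v *m laplace_vec S (i%:R *: row 0 Rw + j%:R *: row 1 Rw)) 0 0.

Lemma compound_laplace i j :
  (compound_init n alpha v *m laplace_vec (compound_mx Pm U Q1 Q2 v S)
     (i%:R *: row 0 (compound_reward m n Rw) +
      j%:R *: row 1 (compound_reward m n Rw))) 0 0 =
  \sum_k alpha 0 k *
    neumann_sum (weighted_mx Pm U Q1 Q2 (phi i j) (phi i 0) (phi 0 j))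
      (weighted_exit Pm U Q1 Q2 (phi i j) (phi i 0) (phi 0 j)) (stE k) 0.
Proof.
set th := _ *: row 0 (compound_reward _ _ _) + _.
have th0 : nneg_mx th.
  by move=> k y; rewrite ord1 row_combinationE addr_ge0// mulr_ge0// compound_reward_ge0.
rewrite compound_init_mulmx; apply: eq_bigr => k _; congr (_ * _).
have -> : compound_mx Pm U Q1 Q2 v S = kronecker_mx (pair_mx Pm U Q1 Q2) v S by [].
rewrite (kronecker_laplace (CDPH_pair_mx_ge0 hpar) (CDPH_pair_exit_ge0 hpar) hv hS th0).
congr (fun_of_matrix (neumann_sum _ _) _ _).
  apply/matrixP => a b; rewrite mxE [RHS]mxE; congr (_ * _).
  rewrite compound_reward_combination.
  move: a; apply: nblocks_ind => *;
    by rewrite ?(block_funE, block_funSS, block_funD1, block_funD2).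
apply/colP => a; rewrite mxE [RHS]mxE; congr (_ * _).
rewrite compound_reward_combination.
move: a; apply: nblocks_ind => *;
  by rewrite ?(block_funE, block_funSS, block_funD1, block_funD2).
Qed.

End compound.

(* E = 'I_m, S = 'I_n, C = 'I_p; X l is the vector (X_{1,l+1}, X_{2,l+1}). *)
Theorem proposition3p3 (R : realType) (m n p : nat) (hm : (0 < m)%N)
  (hn : (0 < n)%N) (alpha : 'rV[R]_m) (Pm : 'M[R]_m) (U : 'M[R]_(m, n))
  (Q1 Q2 : 'M[R]_n) (v : 'rV[R]_p) (S : 'M[R]_p) (Rw : 'M[R]_(2, p))
  (d : measure_display) (T : measurableType d) (P : probability T R)
  (tau : {RV P >-> (nat * nat)%type}) (X : nat -> {RV P >-> (R * R)%type})
  (htau : CDPH alpha Pm U Q1 Q2 P tau)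
  (hX : forall l, MPHstar v S Rw P (X l))
  (hpos : forall l, {ae P, forall w, 0 < (X l w).1 /\ 0 < (X l w).2})
  (hindX : mutually_independent P X)
  (hindtau : independent_of P X tau) :
  MPHstar (compound_init n alpha v) (compound_mx Pm U Q1 Q2 v S)
    (compound_reward m n Rw) P
    (fun w => (\sum_(l < (tau w).1) (X l w).1, \sum_(l < (tau w).2) (X l w).2)).
Proof.
have [hpar _] := htau; have [halpha _ _ _ _] := hpar; have [hv hS Rw0 _] := hX 0%N.
have mtau : measurable_fun setT tau by exact: measurable_funPT.
have mX l : measurable_fun setT (X l) by exact: measurable_funPT.
pose phi i j : R := (v *m laplace_vec S (i%:R *: row 0 Rw + j%:R *: row 1 Rw)) 0 0.
have hphi l i j : (\int[P]_w (laplace_integrand (pos_part (X l w)) i j)%:E = (phi i j)%:E)%E.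
  exact: (MPHstar_laplace (mX l) i j (hX l)).
have lapl i j := laplace_random_sum mtau mX htau hindX hindtau hphi i j.
have mY : measurable_fun setT (random_sum tau (fun l w => pos_part (X l w))).
  apply: measurable_random_sum => // l.
  by apply: measurableT_comp => //; exact: measurable_pos_part.
(* The sums of truncated vectors agree almost surely with the given ones by positivity, so what
   follows deals with nonnegative variables. *)
apply: (MPHstar_ae_eq mY (measurable_random_sum mtau mX)).
- apply: filterS (ae_foralln hpos) => w Xw; rewrite /random_sum.
  by congr (_, _); apply: eq_bigr => l _; have [X1 X2] := Xw l;
    rewrite pos_part_id// ltW.
apply: laplace_MPHstar => //.
- exact: compound_init_probability.
- exact: (compound_subintensity hpar hv hS).
- exact: compound_reward_ge0.
- have := compound_laplace hpar hv hS Rw0 0 0.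
  have -> : (0%:R *: row 0 (compound_reward m n Rw) +
    0%:R *: row 1 (compound_reward m n Rw) : 'rV[R]_(nblocks m n * p)) = 0.
    by rewrite !scale0r addr0.
  move=> ->; apply: EFin_inj; rewrite -(lapl 0%N 0%N).
  under eq_integral do rewrite /laplace_integrand !expr0 mulr1.
  by rewrite -[RHS](probability_setT P) -[RHS]mul1e -integral_cst.
- by move=> w; exact: random_sum_ge0.
- by move=> i j; rewrite lapl compound_laplace.
Qed.
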